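(* Let $0<a\le\infty$ and let $k(t)$ be in $\mathcal{K}_a$. Then for every positive integer $n$, $$\mathcal{M}_a^*[k(t)\ln^n t;1-\lambda]=(-1)^n\frac{d^n}{d\lambda^n}\mathcal{M}_a^*[k(t);1-\lambda].$$ For a positive integer $m$: if $k^{(m-1)}(0)\ne0$, then $\lambda=m$ is a pole of $\mathcal{M}_a^*[k(t)\ln^n t;1-\lambda]$ of order $n+1$; otherwise, when $k^{(m-1)}(0)=0$, $\lambda=m$ is a removable singularity.
   Context: Class $\mathcal{K}_a$ ($0<a\le\infty$): functions $k(t)$ of a real variable such that (1) $k(0)\ne 0$; (2) $k(t)$ is the restriction to $[0,a)$ of a complex function $k(z)$ (the complex extension) that is analytic at every point of $[0,a)$; (3) the Mellin transform $\mathcal{M}_a[k(t);1-\lambda]=\int_0^a k(t)t^{-\lambda}\,dt$ exists for $d<\operatorname{Re}(\lambda)<1$ for some $d<1$ (the strip of analyticity; $d=-\infty$ if $a<\infty$, while $d$ may be finite or $-\infty$ if $a=\infty$). $\mathcal{M}_a[k(t)\ln^n t;1-\lambda]=\int_0^a k(t)\ln^n t\;t^{-\lambda}\,dt$ for $d<\operatorname{Re}(\lambda)<1$. $\mathcal{M}_a^*[k(t);1-\lambda]$ and $\mathcal{M}_a^*[k(t)\ln^n t;1-\lambda]$ denote the analytic continuations (in $\lambda$) of $\mathcal{M}_a[k(t);1-\lambda]$ and $\mathcal{M}_a[k(t)\ln^n t;1-\lambda]$ to the region $\operatorname{Re}(\lambda)\ge1$ (hence to $\operatorname{Re}(\lambda)>d$),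 isolated singularities excepted. *)

(* Defs.v *)
From Stdlib Require Import Reals.
From Coquelicot Require Import Coquelicot.
Open Scope C_scope.

Definition Cexp (z : C) : C := (exp (Re z) * cos (Im z), exp (Re z) * sin (Im z))%R.

(** Principal complex power of a positive real base. *)
Definition real_Cpow (t : R) (s : C) : C := Cexp (s * RtoC (ln t)).

(** Analyticity in the power series sense: [f] is the sum of a convergent
    power series in [z - z0] on a full neighbourhood of [z0]. *)
Definition analytic_at (f : C -> C) (z0 : C) : Prop :=
  exists c : nat -> C,
    locally (T := C_UniformSpace) z0
      (fun z => is_pseries (K := C_AbsRing) (V := C_NormedModule) c (z - z0) (f z)).

Fixpoint C_derive_n (f : C -> C) (n : nat) (z : C) : C :=
  match n with
  | O => f z
  | S p => C_derive (C_derive_n f p) z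
  end.

(** [is_mellin a f lambda l] : the integral of [f t * t ^ (- lambda)] over
    [(0, a)] exists and equals [l].  It is improper at both ends, so that
    conditionally convergent integrals are allowed. *)
Definition is_mellin (a : Rbar) (f : R -> C) (lambda l : C) : Prop :=
  is_RInt_gen (V := C_R_NormedModule)
    (fun t => f t * real_Cpow t (- lambda))
    (at_right 0)
    (within (fun t : R => Rbar_lt t a) (Rbar_locally a)) l.

Definition complex_extension (a : Rbar) (k : R -> C) (K : C -> C) : Prop :=
  forall t : R, (0 <= t)%R -> Rbar_lt t a ->
    K (RtoC t) = k t /\ analytic_at K (RtoC t).

(** The Mellin integral of [k] exists on [d < Re lambda < 1]; for finite [a]
    the abscissa is minus infinity. *)
Definition mellin_strip (a d : Rbar) (k : R -> C) : Prop :=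
  Rbar_lt d 1%R /\
  (is_finite a -> d = m_infty) /\
  (forall lambda : C, Rbar_lt d (Re lambda) -> (Re lambda < 1)%R ->
     exists l : C, is_mellin a k lambda l).

Definition class_K (a : Rbar) (k : R -> C) : Prop :=
  k 0%R <> 0 /\
  (exists K : C -> C, complex_extension a k K) /\
  (exists d : Rbar, mellin_strip a d k).

(** [F] is an analytic continuation of the Mellin transform of [f] from the
    strip [d < Re lambda < 1] to [d < Re lambda], isolated singularities
    excepted: every point of the half-plane has a punctured neighbourhood on
    which [F] is analytic.  The value of the total function [F] at a
    singularity carries no information. *)
Definition mellin_continuation (a d : Rbar) (f : R -> C) (F : C -> C) : Prop :=
  (forall lambda : C, Rbar_lt d (Re lambda) -> (Re lambda < 1)%R ->
     is_mellin a f lambda (F lambda) /\ analytic_at F lambda) /\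
  (forall lambda : C, Rbar_lt d (Re lambda) ->
     locally' (T := C_UniformSpace) lambda (analytic_at F)).

Definition removable_singularity (F : C -> C) (z0 : C) : Prop :=
  exists g : C -> C, analytic_at g z0 /\
    locally' (T := C_UniformSpace) z0 (fun z => F z = g z).

Definition pole_of_order (F : C -> C) (z0 : C) (N : nat) : Prop :=
  (0 < N)%nat /\
  exists g : C -> C, analytic_at g z0 /\ g z0 <> 0 /\
    locally' (T := C_UniformSpace) z0 (fun z => F z = g z / (z - z0) ^ N).

(* Main.v *)
Require Import Defs.
From Stdlib Require Import Reals ZArith Lra Lia Classical Wf_nat Factorial.
From Coquelicot Require Import Coquelicot.
Open Scope C_scope.

(** The singularities come from [t = 0], where [k] has a Taylor expansion with coefficients
    [c_j = K^(j)(0) / j!].  Subtracting the Taylor polynomial of degree [< N] on [(0, 1)]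
    only, one gets, first for [Re lambda < 1],
    [[
      int_0^a k(t) t^(-lambda) dt = sum_(j < N) c_j / (j + 1 - lambda) + V_N(lambda),
    ]]
    where the regularized integral [V_N] converges and is analytic on the larger domain
    [d < Re lambda < N + 1] ([regularized_expansion]).  The right-hand side does not depend on
    [N] ([regularized_step]), so it defines the continuation of the transform of [k]; its only
    singularities are simple poles at the integers [m >= 1] with [c_(m-1) <> 0].

    The integrals may converge only conditionally at [a], and the transform of [k ln^n] has to
    be shown to exist.  Both points are settled at the level of power series.  Over a compact
    interval the truncated transform is entire, and its [j]-th Taylor coefficient at [z] is the
    moment [1/j! int k(t) (-ln t)^j t^(-z) dt] ([mellin_int_expansion]).  When the interval
    grows, these coefficients are Cauchy for a norm [sup_j |u_j| rho^j] ([trunc_coef_cauchy]):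
    near [0] by absolute convergence ([log_moment_bound_zero]), near [a] by integration by parts
    against the primitive of [k(t) t^(-l0)], for a real [l0 < Re z] in the strip
    ([log_moment_bound_abel]).  Hence the limit is analytic and its coefficients are the limits
    of the moments ([weighted_power_series]); in the strip the [n]-th coefficient says that the
    integral of [k ln^n t^(-z)] converges to [(-1)^n] times the [n]-th derivative of the
    transform ([continuation_kln]).

    Thus [(-1)^n] times the [n]-th derivative of the continuation of the transform of [k]
    continues the transform of [k ln^n].  An arbitrary continuation agrees with these two
    around every point, by an identity theorem that tolerates isolated singularities
    ([identity_isolated]).  Differentiating [c_(m-1) / (m - lambda)] [n] times turns the simple
    pole into one of order [n + 1] ([continuation_pole]). *)

(** * Neighbourhoods and series of complex numbers *)

Notation Csum := (is_series (K := C_AbsRing) (V := C_NormedModule)).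

Lemma locally_Cmod (z : C) (P : C -> Prop) :
  locally (T := C_UniformSpace) z P <->
  exists r : R, (0 < r)%R /\ forall w : C, (Cmod (w - z) < r)%R -> P w.
Proof.
split.
- intros [e He]. exists (pos e). split; [apply cond_pos|].
  intros w Hw. apply He. apply C_NormedModule_mixin_compat1. exact Hw.
- intros [r [Hr H]].
  assert (Hs : (0 < sqrt 2)%R) by (apply sqrt_lt_R0; lra).
  assert (He : (0 < r / sqrt 2)%R) by (apply Rdiv_lt_0_compat; lra).
  exists (mkposreal _ He). intros y Hy. apply H.
  apply C_NormedModule_mixin_compat2 in Hy. simpl in Hy.
  replace r with (sqrt 2 * (r / sqrt 2))%R by (field; lra). exact Hy.
Qed.

Lemma locally'_Cmod (z : C) (P : C -> Prop) :
  locally' (T := C_UniformSpace) z P <->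
  exists r : R, (0 < r)%R /\ forall w : C, w <> z -> (Cmod (w - z) < r)%R -> P w.
Proof.
unfold locally', within. rewrite locally_Cmod.
split; intros [r [Hr H]]; exists r; split; auto.
Qed.

Lemma Csum_Cmod (a : nat -> C) (l : C) :
  Csum a l <->
  forall e : R, (0 < e)%R -> exists N, forall n, (N <= n)%nat ->
    (Cmod (sum_n (G := C_AbelianMonoid) a n - l) < e)%R.
Proof.
split.
- intros H e He.
  destruct (H (fun w => Cmod (w - l) < e)%R) as [N HN].
  + apply locally_Cmod. exists e; auto.
  + exists N. exact HN.
- intros H P HP. apply (proj1 (locally_Cmod l P)) in HP. destruct HP as [r [Hr HP]].
  destruct (H r Hr) as [N HN]. exists N. intros n Hn. apply HP, HN, Hn.
Qed.

Lemma pow_n_Cpow (w : C) (n : nat) : pow_n (K := C_Ring) w n = w ^ n.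
Proof. induction n as [|n IH]; [reflexivity|]. simpl. rewrite IH. reflexivity. Qed.

(** Unlike [sum_n], this may be an empty sum: remainders after [N] terms start at [N = 0]. *)
Fixpoint psum (a : nat -> C) (n : nat) : C :=
  match n with O => 0 | S p => psum a p + a p end.

Lemma sum_n_psum (a : nat -> C) (n : nat) :
  sum_n (G := C_AbelianMonoid) a n = psum a (S n).
Proof.
induction n as [|n IH].
- rewrite sum_O. simpl. ring.
- rewrite sum_Sn, IH. reflexivity.
Qed.

Lemma Csum_unique (a : nat -> C) (l1 l2 : C) : Csum a l1 -> Csum a l2 -> l1 = l2.
Proof. intros H1 H2. exact (filterlim_locally_unique _ _ _ H1 H2). Qed.

Lemma Csum_ext (a b : nat -> C) (l : C) : (forall n, a n = b n) -> Csum a l -> Csum b l.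
Proof. exact (is_series_ext (K := C_AbsRing) (V := C_NormedModule) a b l). Qed.

Lemma Csum_plus (a b : nat -> C) (la lb : C) :
  Csum a la -> Csum b lb -> Csum (fun n => a n + b n) (la + lb).
Proof. exact (is_series_plus (K := C_AbsRing) (V := C_NormedModule) a b la lb). Qed.

Lemma Csum_scal (c : C) (a : nat -> C) (l : C) :
  Csum a l -> Csum (fun n => c * a n) (c * l).
Proof. exact (is_series_scal (K := C_AbsRing) (V := C_NormedModule) c a l). Qed.

Lemma Csum_minus (a b : nat -> C) (la lb : C) :
  Csum a la -> Csum b lb -> Csum (fun n => a n - b n) (la - lb).
Proof.
intros Ha Hb. apply (Csum_ext (fun n => a n + (-1) * b n)).
- intros n; ring.
- replace (la - lb) with (la + (-1) * lb) by ring.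
  apply Csum_plus; [exact Ha|]. now apply Csum_scal.
Qed.

Lemma Csum_drop (a : nat -> C) (l : C) (N : nat) :
  Csum a l -> Csum (fun k => a (N + k)%nat) (l - psum a N).
Proof.
intros H. induction N as [|N IH].
- simpl. replace (l - 0) with l by ring. exact H.
- apply (Csum_ext (fun k => a (N + S k)%nat)).
  + intros k. f_equal. lia.
  + apply (is_series_incr_1 (K := C_AbsRing) (V := C_NormedModule) (fun k => a (N + k)%nat)).
    match goal with |- is_series _ ?x => replace x with (l - psum a N) end; [exact IH|].
    rewrite Nat.add_0_r. change (l - psum a N = l - (psum a N + a N) + a N). ring.
Qed.

Lemma Csum_le (a : nat -> C) (b : nat -> R) (l : C) (lb : R) :
  (forall n, (Cmod (a n) <= b n)%R) -> Csum a l -> is_series b lb -> (Cmod l <= lb)%R.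
Proof.
intros Hab Ha Hb.
apply Rnot_lt_le. intros Hlt.
pose (e := ((Cmod l - lb) / 2)%R). assert (He : (0 < e)%R) by (unfold e; lra).
destruct (proj1 (Csum_Cmod a l) Ha e He) as [N1 H1].
assert (Hb' : is_lim_seq (sum_n b) lb) by exact Hb.
apply is_lim_seq_spec in Hb'. destruct (Hb' (mkposreal e He)) as [N2 H2].
pose (n := max N1 N2).
specialize (H1 n (Nat.le_max_l _ _)). specialize (H2 n (Nat.le_max_r _ _)). simpl in H2.
assert (H3 : (Cmod (sum_n (G := C_AbelianMonoid) a n) <= sum_n b n)%R).
{ clear -Hab. induction n as [|n IH].
  - rewrite !sum_O. apply Hab.
  - rewrite !sum_Sn. eapply Rle_trans; [apply Cmod_triangle|]. apply Rplus_le_compat; auto. }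
apply Rabs_lt_between' in H2.
pose proof (Cmod_triangle (sum_n (G := C_AbelianMonoid) a n) (l - sum_n (G := C_AbelianMonoid) a n)) as H4.
replace (sum_n (G := C_AbelianMonoid) a n + (l - sum_n (G := C_AbelianMonoid) a n)) with l in H4 by ring.
replace (Cmod (l - sum_n (G := C_AbelianMonoid) a n)) with (Cmod (sum_n (G := C_AbelianMonoid) a n - l)) in H4.
2:{ rewrite <- Cmod_opp. f_equal. ring. }
unfold e in *. lra.
Qed.

Lemma Csum_dominated (a : nat -> C) (b : nat -> R) :
  (forall n, (Cmod (a n) <= b n)%R) -> ex_series b -> exists l : C, Csum a l.
Proof.
intros H Hb.
exact (ex_series_le (K := C_AbsRing) (V := C_CompleteNormedModule) a b H Hb).
Qed.

Lemma Csum_terms_bounded (a : nat -> C) (l : C) :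
  Csum a l -> exists M, forall k, (Cmod (a k) <= M)%R.
Proof.
intros H.
destruct (filterlim_bounded (K := C_AbsRing) (V := C_NormedModule)
            (sum_n (G := C_AbelianMonoid) a)) as [M HM0]; [now exists l|].
assert (HM : forall n, (Cmod (sum_n (G := C_AbelianMonoid) a n) <= M)%R) by exact HM0.
clear HM0. exists (2 * M)%R. intros [|k].
- specialize (HM 0%nat). rewrite sum_O in HM. pose proof (Cmod_ge_0 (a 0%nat)). lra.
- pose proof (HM (S k)) as H1. rewrite sum_Sn in H1. pose proof (HM k) as H2.
  set (x := sum_n (G := C_AbelianMonoid) a k) in *.
  change (Cmod (x + a (S k)) <= M)%R in H1.
  pose proof (Cmod_triangle (x + a (S k)) (- x)) as H3. rewrite Cmod_opp in H3.
  replace (x + a (S k) + - x) with (a (S k)) in H3 by ring. lra.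
Qed.

(** * Power series expansions *)

(** The radius [r] is one of absolute convergence of the coefficients, so that it can be
    used as a majorant; shrinking [r] keeps the property. *)
Definition expansion (f : C -> C) (z0 : C) (c : nat -> C) (r : R) : Prop :=
  (0 < r)%R /\ ex_series (fun k => Cmod (c k) * r ^ k)%R /\
  forall w : C, (Cmod w < r)%R -> Csum (fun k => c k * w ^ k) (f (z0 + w)).

Lemma ex_series_geom_bound (u : nat -> R) (M r s : R) :
  (0 <= s < r)%R -> (forall k, 0 <= u k)%R -> (forall k, u k * r ^ k <= M)%R ->
  ex_series (fun k => u k * s ^ k)%R.
Proof.
intros Hs Hu HM.
apply (ex_series_le (K := R_AbsRing) (V := R_CompleteNormedModule) _ (fun k => M * (s / r) ^ k)%R).
- intros k. change (Rabs (u k * s ^ k) <= M * (s / r) ^ k)%R.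
  rewrite Rabs_pos_eq.
  + unfold Rdiv. rewrite Rpow_mult_distr, pow_inv.
    assert (0 < r ^ k)%R by (apply pow_lt; lra).
    assert (0 <= s ^ k)%R by (apply pow_le; lra).
    replace (u k * s ^ k)%R with (u k * r ^ k * (s ^ k * / r ^ k))%R by (field; lra).
    apply Rmult_le_compat_r; [|apply HM].
    apply Rmult_le_pos; [lra|]. left; now apply Rinv_0_lt_compat.
  + apply Rmult_le_pos; [apply Hu|]. apply pow_le; lra.
- apply (ex_series_scal_l (K := R_AbsRing) M (fun k => (s / r) ^ k)%R).
  apply ex_series_geom. rewrite Rabs_pos_eq.
  + apply Rmult_lt_reg_r with r; [lra|]. unfold Rdiv. rewrite Rmult_assoc, Rinv_l; lra.
  + apply Rmult_le_pos; [lra|]. left; apply Rinv_0_lt_compat; lra.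
Qed.

Lemma series_terms_bounded (a : nat -> R) :
  ex_series a -> exists M, forall k, (Rabs (a k) <= M)%R.
Proof.
intros [l H].
assert (Hz : is_lim_seq a 0%R) by (apply (ex_series_lim_0 a); exists l; exact H).
assert (Hn : is_lim_seq (fun k => Rabs (a k)) 0%R).
{ replace (Finite 0) with (Rbar_abs (Finite 0)) by (simpl; now rewrite Rabs_R0).
  now apply is_lim_seq_abs. }
destruct (filterlim_bounded (K := R_AbsRing) (V := R_NormedModule) a) as [M HM].
{ exists 0%R. exact Hz. }
exists M. exact HM.
Qed.

Lemma expansion_of_bound (f : C -> C) (z0 : C) (c : nat -> C) (M r s : R) :
  (0 < s < r)%R -> (forall k, Cmod (c k) * r ^ k <= M)%R ->
  (forall w : C, (Cmod w < s)%R -> Csum (fun k => c k * w ^ k) (f (z0 + w))) ->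
  expansion f z0 c s.
Proof.
intros Hs HM H. split; [lra|]. split; [|exact H].
apply (ex_series_geom_bound _ M r s); [lra| |exact HM].
intros k; apply Cmod_ge_0.
Qed.

Lemma expansion_shrink (f : C -> C) (z0 : C) (c : nat -> C) (r s : R) :
  (0 < s <= r)%R -> expansion f z0 c r -> expansion f z0 c s.
Proof.
intros Hs [Hr [Hc H]]. split; [lra|]. split.
- revert Hc. apply (ex_series_le (K := R_AbsRing) (V := R_CompleteNormedModule)).
  intros k. change (Rabs (Cmod (c k) * s ^ k) <= Cmod (c k) * r ^ k)%R.
  rewrite Rabs_pos_eq.
  + apply Rmult_le_compat_l; [apply Cmod_ge_0|]. apply pow_incr; lra.
  + apply Rmult_le_pos; [apply Cmod_ge_0|]. apply pow_le; lra.
- intros w Hw. apply H. lra.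
Qed.

Lemma analytic_at_expansion (f : C -> C) (z0 : C) :
  analytic_at f z0 <-> exists c r, expansion f z0 c r.
Proof.
split.
- intros [c Hc]. apply locally_Cmod in Hc. destruct Hc as [r [Hr H]].
  assert (H' : forall w, (Cmod w < r)%R -> Csum (fun k => c k * w ^ k) (f (z0 + w))).
  { intros w Hw. assert (Hw' : (Cmod (z0 + w - z0) < r)%R).
    { replace (z0 + w - z0) with w by ring. exact Hw. }
    apply H in Hw'. unfold is_pseries in Hw'.
    replace (z0 + w - z0) with w in Hw' by ring.
    revert Hw'. apply Csum_ext. intros n. rewrite pow_n_Cpow.
    change (w ^ n * c n = c n * w ^ n). ring. }
  (* bounded terms at modulus r/2 give absolute convergence at r/4 *)
  destruct (Csum_terms_bounded _ _ (H' (RtoC (r / 2)) ltac:(rewrite Cmod_R, Rabs_pos_eq; lra))) as [M HM].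
  assert (HM' : forall k, (Cmod (c k) * (r / 2) ^ k <= M)%R).
  { intros k. specialize (HM k).
    rewrite Cmod_mult, Cmod_pow, Cmod_R, Rabs_pos_eq in HM by lra. exact HM. }
  exists c, (r / 4)%R. apply (expansion_of_bound f z0 c M (r / 2)%R); [lra|exact HM'|].
  intros w Hw. apply H'. lra.
- intros [c [r [Hr [_ H]]]]. exists c. apply locally_Cmod. exists r. split; [exact Hr|].
  intros z Hz. unfold is_pseries.
  pose proof (H (z - z0) Hz) as H1.
  replace (z0 + (z - z0)) with z in H1 by ring.
  revert H1. apply Csum_ext. intros n.
  transitivity ((z - z0) ^ n * c n); [ring|].
  exact (f_equal (fun x => x * c n) (eq_sym (pow_n_Cpow (z - z0) n))).
Qed.

Lemma expansion_ext (f g : C -> C) (z0 : C) (c : nat -> C) (r : R) :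
  (forall w, (Cmod w < r)%R -> f (z0 + w) = g (z0 + w)) ->
  expansion f z0 c r -> expansion g z0 c r.
Proof.
intros Hfg [Hr [Hc H]]. repeat split; auto. intros w Hw. rewrite <- Hfg by exact Hw. auto.
Qed.

Lemma analytic_at_ext_loc (f g : C -> C) (z0 : C) :
  locally (T := C_UniformSpace) z0 (fun z => f z = g z) ->
  analytic_at f z0 -> analytic_at g z0.
Proof.
intros Hfg [c Hc]. exists c.
generalize (filter_and _ _ Hfg Hc). apply filter_imp. intros z [H1 H2]. now rewrite <- H1.
Qed.

Lemma ex_series_Cmod_plus (a b : nat -> C) (r : R) :
  (0 < r)%R ->
  ex_series (fun k => Cmod (a k) * r ^ k)%R -> ex_series (fun k => Cmod (b k) * r ^ k)%R ->
  ex_series (fun k => Cmod (a k + b k) * r ^ k)%R.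
Proof.
intros Hr Ha Hb.
apply (ex_series_le (K := R_AbsRing) (V := R_CompleteNormedModule) _
  (fun k => Cmod (a k) * r ^ k + Cmod (b k) * r ^ k)%R).
- intros k. change (Rabs (Cmod (a k + b k) * r ^ k) <= Cmod (a k) * r ^ k + Cmod (b k) * r ^ k)%R.
  assert (0 <= r ^ k)%R by (apply pow_le; lra).
  rewrite Rabs_pos_eq by (apply Rmult_le_pos; [apply Cmod_ge_0|assumption]).
  rewrite <- Rmult_plus_distr_r. apply Rmult_le_compat_r; [assumption|apply Cmod_triangle].
- exact (ex_series_plus (K := R_AbsRing) (V := R_NormedModule) _ _ Ha Hb).
Qed.

Lemma expansion_plus (f g : C -> C) (z0 : C) (a b : nat -> C) (r : R) :
  expansion f z0 a r -> expansion g z0 b r ->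
  expansion (fun z => f z + g z) z0 (fun k => a k + b k) r.
Proof.
intros [Hr [Ha Hf]] [_ [Hb Hg]]. split; [exact Hr|]. split.
- now apply ex_series_Cmod_plus.
- intros w Hw. apply (Csum_ext (fun k => a k * w ^ k + b k * w ^ k)).
  + intros k; ring.
  + apply Csum_plus; auto.
Qed.

Lemma expansion_scal (x : C) (f : C -> C) (z0 : C) (a : nat -> C) (r : R) :
  expansion f z0 a r -> expansion (fun z => x * f z) z0 (fun k => x * a k) r.
Proof.
intros [Hr [Ha Hf]]. split; [exact Hr|]. split.
- apply (ex_series_ext (fun k => Cmod x * (Cmod (a k) * r ^ k))%R).
  + intros k. rewrite Cmod_mult. change (Cmod x * (Cmod (a k) * r ^ k) = Cmod x * Cmod (a k) * r ^ k)%R. ring.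
  + exact (ex_series_scal_l (K := R_AbsRing) (Cmod x) _ Ha).
- intros w Hw. apply (Csum_ext (fun k => x * (a k * w ^ k))).
  + intros k; ring.
  + apply Csum_scal; auto.
Qed.

Lemma analytic_at_plus (f g : C -> C) (z : C) :
  analytic_at f z -> analytic_at g z -> analytic_at (fun w => f w + g w) z.
Proof.
rewrite !analytic_at_expansion. intros [a [r Ha]] [b [s Hb]].
exists (fun k => a k + b k), (Rmin r s).
assert (Hm : (0 < Rmin r s)%R) by (apply Rmin_pos; [apply Ha|apply Hb]).
apply expansion_plus.
- apply (expansion_shrink _ _ _ r); [split; [exact Hm|apply Rmin_l]|exact Ha].
- apply (expansion_shrink _ _ _ s); [split; [exact Hm|apply Rmin_r]|exact Hb].
Qed.

Lemma analytic_at_scal (x : C) (f : C -> C) (z : C) :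
  analytic_at f z -> analytic_at (fun w => x * f w) z.
Proof.
rewrite !analytic_at_expansion. intros [a [r Ha]].
exists (fun k => x * a k), r. now apply expansion_scal.
Qed.

Lemma analytic_at_minus (f g : C -> C) (z : C) :
  analytic_at f z -> analytic_at g z -> analytic_at (fun w => f w - g w) z.
Proof.
intros Hf Hg. apply (analytic_at_ext_loc (fun w => f w + (-1) * g w)).
- apply filter_forall. intros w. cbv beta. ring.
- apply analytic_at_plus; [exact Hf|now apply analytic_at_scal].
Qed.

(** The remainder is [w^N] times a power series, dominated by the majorant at radius [r].
    This serves for continuity ([N = 1]), for isolated zeros, and for the comparison of [k]
    with its Taylor polynomials. *)
Lemma expansion_tail (f : C -> C) (z0 : C) (c : nat -> C) (r : R) (N : nat) :
  expansion f z0 c r ->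
  exists M, (0 <= M)%R /\ forall w, (Cmod w < r)%R ->
    (Cmod (f (z0 + w) - psum (fun k => c k * w ^ k) N)%C <= M * Cmod w ^ N)%R.
Proof.
intros [Hr [Hc H]].
assert (Hd : ex_series (fun k => Cmod (c (N + k)%nat) * r ^ k)%R).
{ apply (ex_series_incr_n _ N) in Hc.
  apply (ex_series_ext (fun k => / r ^ N * (Cmod (c (N + k)%nat) * r ^ (N + k)))%R).
  - intros k. rewrite pow_add.
    change (/ r ^ N * (Cmod (c (N + k)%nat) * (r ^ N * r ^ k)) = Cmod (c (N + k)%nat) * r ^ k)%R. field. apply pow_nonzero; lra.
  - exact (ex_series_scal_l (K := R_AbsRing) _ _ Hc). }
destruct Hd as [M HM]. exists M. split.
- apply (Csum_le (fun _ => 0) (fun k => Cmod (c (N + k)%nat) * r ^ k)%R 0 M) in HM.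
  + now rewrite Cmod_0 in HM.
  + intros n. rewrite Cmod_0. apply Rmult_le_pos; [apply Cmod_ge_0|apply pow_le; lra].
  + apply Csum_Cmod. intros e He. exists 0%nat. intros n _.
    rewrite sum_n_psum.
    replace (psum (fun _ => 0) (S n)) with (RtoC 0).
    * replace (0 - 0) with (RtoC 0) by ring. now rewrite Cmod_0.
    * induction n as [|n IH]; simpl; [ring|]. simpl in IH. rewrite <- IH. ring.
- intros w Hw.
  pose proof (Csum_drop _ _ N (H w Hw)) as Hs.
  apply (Csum_le _ (fun k => Cmod w ^ N * (Cmod (c (N + k)%nat) * r ^ k))%R _
          (Cmod w ^ N * M)%R) in Hs.
  + rewrite (Rmult_comm M). exact Hs.
  + intros k. rewrite Cmod_mult, Cmod_pow, pow_add.
    assert (Cmod w ^ k <= r ^ k)%R by (apply pow_incr; split; [apply Cmod_ge_0|lra]).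
    assert (0 <= Cmod w ^ N)%R by (apply pow_le, Cmod_ge_0).
    pose proof (Cmod_ge_0 (c (N + k)%nat)).
    replace (Cmod (c (N + k)%nat) * (Cmod w ^ N * Cmod w ^ k))%R
      with (Cmod w ^ N * (Cmod (c (N + k)%nat) * Cmod w ^ k))%R by ring.
    apply Rmult_le_compat_l; [assumption|]. now apply Rmult_le_compat_l.
  + exact (is_series_scal_l (K := R_AbsRing) (Cmod w ^ N)%R _ _ HM).
Qed.

Lemma expansion_center (f : C -> C) (z0 : C) (c : nat -> C) (r : R) :
  expansion f z0 c r -> f z0 = c 0%nat.
Proof.
intros H. destruct (expansion_tail f z0 c r 1 H) as [M [HM HT]].
destruct H as [Hr _].
specialize (HT 0). rewrite Cmod_0 in HT. specialize (HT Hr).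
replace (z0 + 0) with z0 in HT by ring. simpl in HT.
apply Ceq_minus. apply Cmod_eq_0.
replace (0 + c 0%nat * 1) with (c 0%nat) in HT by ring.
pose proof (Cmod_ge_0 (f z0 - c 0%nat)). lra.
Qed.

Lemma analytic_at_continuous (f : C -> C) (z0 : C) (e : R) :
  analytic_at f z0 -> (0 < e)%R ->
  locally (T := C_UniformSpace) z0 (fun z => (Cmod (f z - f z0) < e)%R).
Proof.
rewrite analytic_at_expansion. intros [c [r H]] He.
destruct (expansion_tail f z0 c r 1 H) as [M [HM HT]].
pose proof (expansion_center _ _ _ _ H) as H0. destruct H as [Hr _].
apply locally_Cmod. exists (Rmin r (e / (M + 1))). split.
- apply Rmin_pos; [exact Hr|]. apply Rdiv_lt_0_compat; lra.
- intros w Hw.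
  pose proof (Rmin_l r (e / (M + 1))). pose proof (Rmin_r r (e / (M + 1))).
  assert (Hwr : (Cmod (w - z0) < r)%R) by lra.
  specialize (HT (w - z0) Hwr). simpl in HT.
  replace (z0 + (w - z0)) with w in HT by ring.
  rewrite H0. replace (f w - c 0%nat) with (f w - (0 + c 0%nat * 1)) by ring.
  eapply Rle_lt_trans; [exact HT|]. rewrite Rmult_1_r.
  assert (Hwe : (Cmod (w - z0) < e / (M + 1))%R) by lra.
  apply Rmult_lt_compat_r with (r := (M + 1)%R) in Hwe; [|lra].
  replace (e / (M + 1) * (M + 1))%R with e in Hwe by (field; lra).
  pose proof (Cmod_ge_0 (w - z0)). nra.
Qed.

(** Zeros that accumulate at the centre kill one coefficient after the other. *)
Lemma expansion_isolated_zeros (f : C -> C) (z0 : C) (c : nat -> C) (r : R) :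
  expansion f z0 c r ->
  (forall d, (0 < d)%R -> exists w : C, w <> 0 /\ (Cmod w < d)%R /\ f (z0 + w) = 0) ->
  forall w, (Cmod w < r)%R -> f (z0 + w) = 0.
Proof.
intros H Hz.
assert (Hc : forall n, c n = 0).
{ intros n. induction n as [n IH] using lt_wf_ind.
  destruct (expansion_tail f z0 c r (S n) H) as [M [HM HT]].
  assert (Hp : forall w, psum (fun k => c k * w ^ k) n = 0).
  { intros w. clear -IH. induction n as [|n IHn]; [reflexivity|]. simpl.
    rewrite IHn, (IH n) by (intros; try apply IH; lia). ring. }
  apply NNPP. intros Hn. apply Cmod_gt_0 in Hn.
  assert (Hd : (0 < Rmin r (Cmod (c n) / (M + 1)))%R).
  { apply Rmin_pos; [apply H|]. apply Rdiv_lt_0_compat; lra. }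
  destruct (Hz _ Hd) as [w [Hw0 [Hw Hf]]].
  pose proof (Rmin_l r (Cmod (c n) / (M + 1))). pose proof (Rmin_r r (Cmod (c n) / (M + 1))).
  assert (Hwr : (Cmod w < r)%R) by lra.
  specialize (HT w Hwr). rewrite Hf in HT. simpl in HT. rewrite Hp in HT.
  replace (0 - (0 + c n * w ^ n)) with (- (c n * w ^ n)) in HT by ring.
  rewrite Cmod_opp, Cmod_mult, Cmod_pow in HT.
  apply Cmod_gt_0 in Hw0.
  assert (Hpw : (0 < Cmod w ^ n)%R) by now apply pow_lt.
  assert (H2 : (Cmod (c n) <= M * Cmod w)%R).
  { apply Rmult_le_reg_r with (Cmod w ^ n)%R; [exact Hpw|]. lra. }
  assert (H3 : (Cmod w < Cmod (c n) / (M + 1))%R) by lra.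
  apply Rmult_lt_compat_r with (r := (M + 1)%R) in H3; [|lra].
  replace (Cmod (c n) / (M + 1) * (M + 1))%R with (Cmod (c n)) in H3 by (field; lra).
  nra. }
intros w Hw. destruct H as [Hr [_ H]].
apply (Csum_unique _ _ _ (H w Hw)).
apply (Csum_ext (fun k => 0 * (c k * w ^ k))).
- intros n. rewrite Hc. ring.
- assert (E : Csum (fun k => 0 * (c k * w ^ k)) (0 * f (z0 + w))) by (apply Csum_scal; auto).
  rewrite Cmult_0_l in E. exact E.
Qed.

(** [C_derive] is defined by limits along the real direction only; a quadratic error bound in
    all directions is more than enough to compute it. *)
Lemma C_derive_quadratic (f : C -> C) (z l : C) (d Q : R) :
  (0 < d)%R ->
  (forall h : C, (Cmod h < d)%R -> (Cmod (f (z + h) - f z - h * l)%C <= Q * Cmod h ^ 2)%R) ->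
  C_derive f z = l.
Proof.
intros Hd H. apply is_C_lim_unique. intros P HP.
apply (proj1 (locally_Cmod l P)) in HP. destruct HP as [e [He HP]].
apply (proj2 (locally'_Cmod z _)).
assert (HQ : (0 < Rabs Q + 1)%R) by (pose proof (Rabs_pos Q); lra).
exists (Rmin d (e / (Rabs Q + 1))). split.
- apply Rmin_pos; [exact Hd|]. now apply Rdiv_lt_0_compat.
- intros w Hw Hwd. apply HP.
  pose proof (Rmin_l d (e / (Rabs Q + 1))) as Hm1. pose proof (Rmin_r d (e / (Rabs Q + 1))) as Hm2.
  set (h := w - z) in *.
  assert (Hh : h <> 0) by (now apply Cminus_eq_contra).
  assert (Hh' := proj1 (Cmod_gt_0 h) Hh).
  assert (H1 : (Cmod (f (z + h) - f z - h * l)%C <= Q * Cmod h ^ 2)%R) by (apply H; lra).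
  replace (z + h) with w in H1 by (unfold h; ring).
  replace ((f w - f z) / h - l) with ((f w - f z - h * l) / h) by (field; exact Hh).
  rewrite Cmod_div by exact Hh.
  apply Rle_lt_trans with (Rabs Q * Cmod h)%R.
  + apply Rmult_le_reg_r with (Cmod h); [exact Hh'|].
    unfold Rdiv. rewrite Rmult_assoc, Rinv_l, Rmult_1_r by lra.
    eapply Rle_trans; [exact H1|]. simpl. rewrite Rmult_1_r, Rmult_assoc.
    apply Rmult_le_compat_r; [nra|]. apply RRle_abs.
  + assert (H2 : (Cmod h < e / (Rabs Q + 1))%R) by lra.
    apply Rmult_lt_compat_r with (r := (Rabs Q + 1)%R) in H2; [|lra].
    replace (e / (Rabs Q + 1) * (Rabs Q + 1))%R with e in H2 by (field; lra). nra.
Qed.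

Lemma CV_radius_ge (a : nat -> R) (r : R) :
  (0 <= r)%R -> ex_series (fun k => Rabs (a k) * r ^ k)%R -> Rbar_le r (CV_radius a).
Proof.
intros Hr H. destruct (CV_radius_bounded a) as [Hub _]. apply Hub.
destruct (series_terms_bounded _ H) as [M HM]. exists M. intros n.
rewrite Rabs_mult, (Rabs_pos_eq (r ^ n)) by (now apply pow_le).
eapply Rle_trans; [|apply (HM n)]. apply RRle_abs.
Qed.

Lemma ex_series_PS_derive (a : nat -> R) (r s : R) :
  (0 <= s < r)%R -> (forall k, 0 <= a k)%R -> ex_series (fun k => a k * r ^ k)%R ->
  exists t, (s < t < r)%R /\ ex_series (fun k => PS_derive a k * t ^ k)%R.
Proof.
intros Hs Ha H. exists ((s + r) / 2)%R. split; [lra|].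
apply ex_pseries_R. apply ex_pseries_derive.
rewrite Rabs_pos_eq by lra.
apply Rbar_lt_le_trans with r; [simpl; lra|].
apply CV_radius_ge; [lra|].
revert H. apply ex_series_ext. intros n. now rewrite Rabs_pos_eq.
Qed.

(** Coefficients of the derived power series. *)
Definition dcoef1 (c : nat -> C) (k : nat) : C := RtoC (INR (S k)) * c (S k).

Lemma Cmod_INR (n : nat) : Cmod (RtoC (INR n)) = INR n.
Proof. rewrite Cmod_R. apply Rabs_pos_eq, pos_INR. Qed.

(** Up to [|h|^2], the bound is the second derivative of [rho^(k+2)]; weighted by the moduli
    of the coefficients it can therefore be summed. *)
Lemma pow_quadratic_remainder (w h : C) (rho : R) (k : nat) :
  (Cmod w <= rho)%R -> (Cmod (w + h) <= rho)%R ->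
  (Cmod ((w + h) ^ S (S k) - w ^ S (S k) - h * (RtoC (INR (S (S k))) * w ^ S k))%C
     <= Cmod h ^ 2 * (INR (S (S k)) * INR (S k) * rho ^ k))%R.
Proof.
intros Hw Hwh.
assert (Hrho : (0 <= rho)%R) by (eapply Rle_trans; [apply (Cmod_ge_0 w)|exact Hw]).
induction k as [|k IH].
- replace ((w + h) ^ 2 - w ^ 2 - h * (RtoC (INR 2) * w ^ 1)) with (h ^ 2).
  + rewrite Cmod_pow. simpl. pose proof (Cmod_ge_0 h). nra.
  + simpl INR. rewrite RtoC_plus. simpl. ring.
- set (E := (w + h) ^ S (S k) - w ^ S (S k) - h * (RtoC (INR (S (S k))) * w ^ S k)) in *.
  replace ((w + h) ^ S (S (S k)) - w ^ S (S (S k)) - h * (RtoC (INR (S (S (S k)))) * w ^ S (S k)))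
    with ((w + h) * E + h ^ 2 * (RtoC (INR (S (S k))) * w ^ S k)).
  2:{ unfold E. rewrite (S_INR (S (S k))), RtoC_plus. simpl Cpow. ring. }
  eapply Rle_trans; [apply Cmod_triangle|].
  rewrite !Cmod_mult, !Cmod_pow, Cmod_INR.
  assert (Hp : (Cmod w ^ S k <= rho ^ S k)%R) by (apply pow_incr; split; [apply Cmod_ge_0|exact Hw]).
  assert (Hr : (0 <= rho ^ k)%R) by (now apply pow_le).
  pose proof (Cmod_ge_0 E). pose proof (Cmod_ge_0 (w + h)).
  assert (0 <= Cmod h ^ 2)%R by (apply pow_le, Cmod_ge_0).
  pose proof (pos_INR k) as Hk.
  assert (H3 : (Cmod (w + h) * Cmod E <=
     rho * (Cmod h ^ 2 * (INR (S (S k)) * INR (S k) * rho ^ k)))%R)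
    by (apply Rmult_le_compat; assumption).
  assert (H4 : (Cmod h ^ 2 * (INR (S (S k)) * Cmod w ^ S k) <=
     Cmod h ^ 2 * (INR (S (S k)) * rho ^ S k))%R).
  { apply Rmult_le_compat_l; [assumption|]. apply Rmult_le_compat_l; [apply pos_INR|exact Hp]. }
  eapply Rle_trans; [apply Rplus_le_compat; [exact H3|exact H4]|].
  rewrite <- !tech_pow_Rmult. rewrite !S_INR in *.
  assert (0 <= rho * rho ^ k)%R by (now apply Rmult_le_pos).
  assert (0 <= Cmod h ^ 2 * (rho * rho ^ k))%R by (now apply Rmult_le_pos).
  nra.
Qed.

Lemma Csum_shift (a : nat -> C) (l : C) :
  Csum (fun k => a (S k)) l -> Csum a (a 0%nat + l).
Proof.
intros H. apply (is_series_decr_1 (K := C_AbsRing) (V := C_NormedModule)).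
match goal with |- is_series _ ?x => replace x with l end; [exact H|].
change (l = a 0%nat + l + - a 0%nat). ring.
Qed.

(** The error of the linear approximation is estimated termwise: its series starts at the
    quadratic term and is dominated by [|h|^2] times the second derivative of the series of
    moduli, which converges inside the disc. *)
Lemma C_derive_pseries (f : C -> C) (z0 : C) (c : nat -> C) (r : R) (w D : C) :
  expansion f z0 c r -> (Cmod w < r)%R ->
  Csum (fun k => dcoef1 c k * w ^ k) D -> C_derive f (z0 + w) = D.
Proof.
intros [Hr [Hc H]] Hw HD.
pose (a := fun k => Cmod (c k)).
assert (Ha : forall k, (0 <= a k)%R) by (intros; apply Cmod_ge_0).
pose proof (Cmod_ge_0 w) as Hw0.
destruct (ex_series_PS_derive a r (Cmod w) (conj Hw0 Hw) Ha Hc) as [t [Ht Hc1]].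
assert (Ha1 : forall k, (0 <= PS_derive a k)%R).
{ intros k. apply Rmult_le_pos; [apply pos_INR|apply Ha]. }
destruct (ex_series_PS_derive (PS_derive a) t (Cmod w)) as [s [Hs [Q HQ]]]; [lra|exact Ha1|exact Hc1|].
apply (C_derive_quadratic f (z0 + w) D (s - Cmod w) Q); [lra|].
intros h Hh.
assert (Hwh : (Cmod (w + h) < s)%R) by (eapply Rle_lt_trans; [apply Cmod_triangle|lra]).
assert (HA : Csum (fun k => c k * ((w + h) ^ k - w ^ k)) (f (z0 + (w + h)) - f (z0 + w))).
{ apply (Csum_ext (fun k => c k * (w + h) ^ k - c k * w ^ k)); [intros; ring|].
  apply Csum_minus; apply H; lra. }
apply (fun X => Csum_drop _ _ 1 X) in HA. simpl psum in HA.
apply (fun X => Csum_minus _ _ _ _ X (Csum_scal h _ _ HD)) in HA.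
apply (fun X => Csum_drop _ _ 1 X) in HA. simpl psum in HA.
match type of HA with is_series _ ?x =>
  replace x with (f (z0 + w + h) - f (z0 + w) - h * D) in HA end.
2:{ unfold dcoef1. rewrite Cplus_assoc. change (RtoC (INR 1)) with (RtoC 1). ring. }
assert (HQ' : is_series (fun k => Cmod h ^ 2 * (PS_derive (PS_derive a) k * s ^ k))%R (Cmod h ^ 2 * Q)%R).
{ exact (is_series_scal_l (K := R_AbsRing) (Cmod h ^ 2)%R _ _ HQ). }
rewrite (Rmult_comm Q). refine (Csum_le _ _ _ _ _ HA HQ').
intros n. cbv beta.
replace (c (1 + (1 + n))%nat * ((w + h) ^ (1 + (1 + n)) - w ^ (1 + (1 + n)))
   - h * (dcoef1 c (1 + n) * w ^ (1 + n)))
 with (c (S (S n)) * ((w + h) ^ S (S n) - w ^ S (S n) - h * (RtoC (INR (S (S n))) * w ^ S n))).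
2:{ unfold dcoef1. change (1 + (1 + n))%nat with (S (S n)). change (1 + n)%nat with (S n). ring. }
rewrite Cmod_mult.
eapply Rle_trans.
- apply Rmult_le_compat_l; [apply Cmod_ge_0|].
  apply (pow_quadratic_remainder w h s n); lra.
- unfold PS_derive, a. right. ring.
Qed.

Lemma expansion_C_derive (f : C -> C) (z0 : C) (c : nat -> C) (r s : R) :
  (0 < s < r)%R -> expansion f z0 c r -> expansion (C_derive f) z0 (dcoef1 c) s.
Proof.
intros Hs H.
assert (Hd : ex_series (fun k => Cmod (dcoef1 c k) * s ^ k)%R).
{ destruct H as [_ [Hc _]].
  destruct (ex_series_PS_derive (fun k => Cmod (c k)) r s) as [t [Ht Hc1]];
    [lra|intros; apply Cmod_ge_0|exact Hc|].
  destruct (series_terms_bounded _ Hc1) as [M HM].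
  apply (ex_series_geom_bound _ M t s); [lra|intros; apply Cmod_ge_0|].
  intros k. specialize (HM k). unfold PS_derive in HM. unfold dcoef1.
  rewrite Cmod_mult, Cmod_INR. eapply Rle_trans; [apply RRle_abs|exact HM]. }
split; [lra|]. split; [exact Hd|].
intros w Hw.
assert (Hle : forall k, (Cmod (dcoef1 c k * w ^ k) <= Cmod (dcoef1 c k) * s ^ k)%R).
{ intros k. rewrite Cmod_mult, Cmod_pow. apply Rmult_le_compat_l; [apply Cmod_ge_0|].
  apply pow_incr; split; [apply Cmod_ge_0|lra]. }
destruct (Csum_dominated _ _ Hle Hd) as [D HD].
rewrite (C_derive_pseries f z0 c r w D H); [exact HD|lra|exact HD].
Qed.

Fixpoint dcoef (c : nat -> C) (n : nat) : nat -> C :=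
  match n with O => c | S p => dcoef1 (dcoef c p) end.

Lemma dcoef_fact (c : nat -> C) (n k : nat) :
  RtoC (INR (fact k)) * dcoef c n k = RtoC (INR (fact (n + k))) * c (n + k)%nat.
Proof.
revert k. induction n as [|n IH]; intros k; [reflexivity|].
simpl dcoef. unfold dcoef1.
replace (S n + k)%nat with (n + S k)%nat by lia.
rewrite <- IH. rewrite fact_simpl, mult_INR, RtoC_mult. ring.
Qed.

Lemma dcoef_0 (c : nat -> C) (n : nat) : dcoef c n 0%nat = RtoC (INR (fact n)) * c n.
Proof.
pose proof (dcoef_fact c n 0) as H. rewrite Nat.add_0_r in H. rewrite <- H. simpl. ring.
Qed.

Lemma expansion_C_derive_n (f : C -> C) (z0 : C) (c : nat -> C) (n : nat) (r s : R) :
  (0 < s < r)%R -> expansion f z0 c r -> expansion (C_derive_n f n) z0 (dcoef c n) s.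
Proof.
revert s. induction n as [|n IH]; intros s Hs H.
- apply (expansion_shrink _ _ _ r); [lra|exact H].
- simpl. apply (expansion_C_derive _ _ _ ((s + r) / 2)%R); [lra|].
  apply IH; [lra|exact H].
Qed.

(** From here on, derivatives are read off the expansion at the point where they are taken, so
    power series never have to be expanded again at another point of their disc. *)
Lemma C_derive_n_center (f : C -> C) (z0 : C) (c : nat -> C) (n : nat) (r : R) :
  expansion f z0 c r -> C_derive_n f n z0 = RtoC (INR (fact n)) * c n.
Proof.
intros H. rewrite <- dcoef_0.
assert (Hr : (0 < r)%R) by apply H.
apply (expansion_center _ _ _ (r / 2)%R).
apply (expansion_C_derive_n _ _ _ _ r); [lra|exact H].
Qed.

Lemma analytic_at_C_derive_n (f : C -> C) (z0 : C) (n : nat) :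
  analytic_at f z0 -> analytic_at (C_derive_n f n) z0.
Proof.
rewrite !analytic_at_expansion. intros [c [r H]].
assert (Hr : (0 < r)%R) by apply H.
exists (dcoef c n), (r / 2)%R. apply (expansion_C_derive_n _ _ _ _ r); [lra|exact H].
Qed.

Lemma C_derive_n_plus (f g : C -> C) (z : C) (n : nat) :
  analytic_at f z -> analytic_at g z ->
  C_derive_n (fun w => f w + g w) n z = C_derive_n f n z + C_derive_n g n z.
Proof.
rewrite !analytic_at_expansion. intros [a [r Ha]] [b [s Hb]].
assert (Hm : (0 < Rmin r s)%R) by (apply Rmin_pos; [apply Ha|apply Hb]).
apply (expansion_shrink _ _ _ r (Rmin r s)) in Ha; [|split; [exact Hm|apply Rmin_l]].
apply (expansion_shrink _ _ _ s (Rmin r s)) in Hb; [|split; [exact Hm|apply Rmin_r]].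
rewrite (C_derive_n_center _ _ _ n _ Ha), (C_derive_n_center _ _ _ n _ Hb).
rewrite (C_derive_n_center _ _ _ n _ (expansion_plus _ _ _ _ _ _ Ha Hb)). ring.
Qed.

Lemma C_derive_ext_loc (f g : C -> C) (z : C) :
  locally (T := C_UniformSpace) z (fun w => f w = g w) -> C_derive f z = C_derive g z.
Proof.
intros H. pose proof (locally_singleton _ _ H) as Hz. apply locally_Cmod in H.
destruct H as [r [Hr H]].
assert (Hx : Rbar_locally' (fst z) (fun x : R => f (x, snd z) = g (x, snd z))).
{ exists (mkposreal r Hr). intros y Hy _. apply H.
  assert (E : Cminus (y, snd z) z = RtoC (y - fst z)).
  { apply injective_projections; simpl; ring. }
  change (Cmod (Cminus (y, snd z) z) < r)%R. rewrite E, Cmod_R. exact Hy. }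
unfold C_derive, C_lim. cbv beta in Hz. f_equal; apply (f_equal real); symmetry; apply Lim_ext_loc;
  (revert Hx; apply filter_imp; intros x E; rewrite E, Hz; reflexivity).
Qed.

Lemma C_derive_n_ext_ball (f g : C -> C) (z : C) (r : R) (n : nat) :
  (forall w, (Cmod (w - z) < r)%R -> f w = g w) ->
  forall w, (Cmod (w - z) < r)%R -> C_derive_n f n w = C_derive_n g n w.
Proof.
intros H. induction n as [|n IH]; [exact H|].
intros w Hw. simpl. apply C_derive_ext_loc. apply locally_Cmod.
exists (r - Cmod (w - z))%R. split; [lra|]. intros v Hv. apply IH.
replace (v - z) with ((v - w) + (w - z)) by ring.
eapply Rle_lt_trans; [apply Cmod_triangle|lra].
Qed.

Lemma C_derive_n_ext_loc (f g : C -> C) (z : C) (n : nat) :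
  locally (T := C_UniformSpace) z (fun w => f w = g w) -> C_derive_n f n z = C_derive_n g n z.
Proof.
rewrite locally_Cmod. intros [r [Hr H]]. apply (C_derive_n_ext_ball f g z r n H).
replace (z - z) with (RtoC 0) by ring. now rewrite Cmod_0.
Qed.

Lemma locally'_open (z : C) (P : C -> Prop) :
  locally' (T := C_UniformSpace) z P ->
  locally' (T := C_UniformSpace) z (fun w => locally (T := C_UniformSpace) w P).
Proof.
rewrite !locally'_Cmod. intros [r [Hr H]]. exists r. split; [exact Hr|].
intros w Hw Hwr. apply locally_Cmod.
assert (Hd : (0 < Cmod (w - z))%R) by (apply Cmod_gt_0, Cminus_eq_contra; exact Hw).
exists (Rmin (r - Cmod (w - z)) (Cmod (w - z))). split; [apply Rmin_pos; lra|].
intros v Hv.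
pose proof (Rmin_l (r - Cmod (w - z)) (Cmod (w - z))).
pose proof (Rmin_r (r - Cmod (w - z)) (Cmod (w - z))).
apply H.
- intros ->. replace (Cmod (z - w)) with (Cmod (w - z)) in Hv; [lra|].
  rewrite <- Cmod_opp. f_equal. ring.
- replace (v - z) with ((v - w) + (w - z)) by ring.
  eapply Rle_lt_trans; [apply Cmod_triangle|lra].
Qed.

Lemma Csum_geom (x : C) : (Cmod x < 1)%R -> Csum (fun k => x ^ k) (/ (1 - x)).
Proof.
intros Hx.
assert (Hx1 : 1 - x <> 0).
{ intros E. assert (x = 1) by (apply eq_sym, Ceq_minus; exact E). subst x.
  rewrite Cmod_1 in Hx. lra. }
assert (Hp : forall n, psum (fun k => x ^ k) n = (1 - x ^ n) / (1 - x)).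
{ induction n as [|n IH]; simpl; [|rewrite IH]; field; exact Hx1. }
apply Csum_Cmod. intros e He.
assert (Hm := proj1 (Cmod_gt_0 _) Hx1).
assert (Hl : is_lim_seq (fun n => Cmod x ^ n)%R 0%R).
{ apply is_lim_seq_geom. rewrite Rabs_pos_eq; [exact Hx|apply Cmod_ge_0]. }
apply is_lim_seq_spec in Hl.
destruct (Hl (mkposreal (e * Cmod (1 - x)) (Rmult_lt_0_compat _ _ He Hm))) as [N HN].
exists N. intros n Hn. rewrite sum_n_psum, Hp.
replace ((1 - x ^ S n) / (1 - x) - / (1 - x)) with (- (x ^ S n / (1 - x))) by (field; exact Hx1).
rewrite Cmod_opp, Cmod_div, Cmod_pow by exact Hx1.
specialize (HN (S n) ltac:(lia)). simpl in HN.
rewrite Rminus_0_r, Rabs_pos_eq in HN by (apply (pow_le _ (S n)), Cmod_ge_0).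
apply Rmult_lt_reg_r with (Cmod (1 - x)); [exact Hm|].
unfold Rdiv. rewrite Rmult_assoc, Rinv_l, Rmult_1_r by lra. exact HN.
Qed.

Lemma expansion_inv_sub (q z0 : C) :
  z0 <> q ->
  expansion (fun z => / (q - z)) z0 (fun k => / (q - z0) ^ S k) (Cmod (q - z0) / 2).
Proof.
intros Hz.
assert (Hd : q - z0 <> 0) by (apply Cminus_eq_contra; auto).
assert (Hm := proj1 (Cmod_gt_0 _) Hd).
apply (expansion_of_bound _ _ _ (/ Cmod (q - z0)) (Cmod (q - z0))); [lra| |].
- intros k. rewrite Cmod_inv by (now apply Cpow_nz). rewrite Cmod_pow. simpl.
  right. field. split; [|apply pow_nonzero]; apply Rgt_not_eq, Hm.
- intros w Hw.
  assert (Hw' : (Cmod (w / (q - z0)) < 1)%R).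
  { rewrite Cmod_div by exact Hd. apply Rmult_lt_reg_r with (Cmod (q - z0)); [exact Hm|].
    unfold Rdiv. rewrite Rmult_assoc, Rinv_l, Rmult_1_r by lra. lra. }
  pose proof (Csum_scal (/ (q - z0)) _ _ (Csum_geom _ Hw')) as H.
  assert (Hne : q - (z0 + w) <> 0).
  { intros E. assert (q - z0 = w).
    { replace (q - z0) with (q - (z0 + w) + w) by ring. rewrite E. ring. }
    rewrite H0 in Hw. pose proof (Cmod_ge_0 w). lra. }
  replace (/ (q - z0) * / (1 - w / (q - z0))) with (/ (q - (z0 + w))) in H.
  + revert H. apply Csum_ext. intros k. unfold Cdiv.
    rewrite Cpow_mult_l, Cpow_inv by exact Hd. simpl. field.
    repeat split; try apply Cpow_nz; exact Hd.
  + field. repeat split; first [exact Hd | exact Hne | intros E; apply Hne; rewrite <- E; ring].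
Qed.

Lemma analytic_at_inv_sub (q z : C) : z <> q -> analytic_at (fun w => / (q - w)) z.
Proof. intros H. apply analytic_at_expansion. do 2 eexists. now apply expansion_inv_sub. Qed.

Lemma C_derive_n_inv_sub (q z : C) (n : nat) :
  z <> q -> C_derive_n (fun w => / (q - w)) n z = RtoC (INR (fact n)) / (q - z) ^ S n.
Proof.
intros H. exact (C_derive_n_center _ _ _ n _ (expansion_inv_sub q z H)).
Qed.

Lemma C_derive_n_scal (x : C) (f : C -> C) (z : C) (n : nat) :
  analytic_at f z -> C_derive_n (fun w => x * f w) n z = x * C_derive_n f n z.
Proof.
rewrite analytic_at_expansion. intros [a [r Ha]].
rewrite (C_derive_n_center _ _ _ n _ Ha).
rewrite (C_derive_n_center _ _ _ n _ (expansion_scal x _ _ _ _ Ha)). ring.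
Qed.

Lemma analytic_at_const (x z : C) : analytic_at (fun _ => x) z.
Proof.
apply analytic_at_expansion.
pose (a := fun k : nat => match k with O => x | S _ => RtoC 0 end). exists a, 1%R.
assert (Hz : forall w, Csum (fun k => a (S k) * w ^ S k) (RtoC 0)).
{ intros w. apply Csum_Cmod. intros e He. exists 0%nat. intros n _. rewrite sum_n_psum.
  replace (psum _ (S n)) with (RtoC 0).
  - replace (0 - 0) with (RtoC 0) by ring. now rewrite Cmod_0.
  - induction (S n) as [|m IH]; [reflexivity|].
    change (RtoC 0 = psum (fun k => a (S k) * w ^ S k) m + 0 * w ^ S m). rewrite <- IH. ring. }
split; [lra|]. split.
- apply (ex_series_incr_1 (K := R_AbsRing) (V := R_NormedModule)).
  apply (ex_series_ext (fun k => 0 * 1 ^ k)%R).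
  + intros k. simpl a. rewrite Cmod_0. change (0 * 1 ^ k = 0 * 1 ^ S k)%R. ring.
  + apply (ex_series_geom_bound (fun _ => 0%R) 0%R 2%R); [lra|intros; lra|intros; lra].
- intros w _. specialize (Hz w). apply (Csum_shift (fun k => a k * w ^ k)) in Hz.
  simpl in Hz. replace (x * 1 + 0) with x in Hz by ring. exact Hz.
Qed.

(** Multiplication by [z - z0] shifts the coefficients at [z0]. *)
Lemma analytic_at_mul_sub (f : C -> C) (z0 : C) :
  analytic_at f z0 -> analytic_at (fun z => f z * (z - z0)) z0.
Proof.
rewrite !analytic_at_expansion. intros [c [r [Hr [Hc H]]]].
pose (a := fun k : nat => match k with O => RtoC 0 | S p => c p end). exists a, r.
split; [exact Hr|]. split.
- apply (ex_series_incr_1 (K := R_AbsRing) (V := R_NormedModule)).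
  apply (ex_series_ext (fun k => r * (Cmod (c k) * r ^ k))%R).
  + intros k. change (r * (Cmod (c k) * r ^ k) = Cmod (c k) * (r * r ^ k))%R. ring.
  + exact (ex_series_scal_l (K := R_AbsRing) r _ Hc).
- intros w Hw.
  pose proof (Csum_scal w _ _ (H w Hw)) as H1.
  assert (H2 : Csum (fun k => a (S k) * w ^ S k) (w * f (z0 + w))).
  { revert H1. apply Csum_ext. intros k. simpl. ring. }
  apply (Csum_shift (fun k => a k * w ^ k)) in H2.
  replace (f (z0 + w) * (z0 + w - z0)) with (a 0%nat * w ^ 0 + w * f (z0 + w)) by (simpl; ring).
  exact H2.
Qed.

Lemma analytic_at_mul_sub_pow (f : C -> C) (z0 : C) (n : nat) :
  analytic_at f z0 -> analytic_at (fun z => f z * (z - z0) ^ n) z0.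
Proof.
intros H. induction n as [|n IH].
- apply (analytic_at_ext_loc f); [|exact H]. apply filter_forall. intros z. simpl. ring.
- apply (analytic_at_ext_loc (fun z => f z * (z - z0) ^ n * (z - z0))).
  + apply filter_forall. intros z. simpl. ring.
  + now apply analytic_at_mul_sub.
Qed.

(** * The identity theorem *)

(** Induction along the unit interval, i.e. its connectedness. *)
Lemma interval_induction (P : R -> Prop) :
  (forall t, (0 <= t <= 1)%R -> (forall s, 0 <= s < t -> P s)%R ->
     exists d, (0 < d)%R /\ forall s, (t <= s < t + d)%R -> (s <= 1)%R -> P s) ->
  P 1%R.
Proof.
intros H.
pose (E := fun t => (0 <= t <= 1)%R /\ forall s, (0 <= s < t)%R -> P s).
assert (HE0 : E 0%R) by (split; [lra|intros; lra]).
destruct (completeness E) as [m [Hub Hlub]].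
- exists 1%R. intros t [Ht _]. lra.
- exists 0%R. exact HE0.
- assert (Hm : (0 <= m <= 1)%R).
  { split; [apply Hub, HE0|]. apply Hlub. intros t [Ht _]. lra. }
  assert (HP : forall s, (0 <= s < m)%R -> P s).
  { intros s Hs. apply NNPP. intros Hn.
    assert (m <= s)%R; [|lra]. apply Hlub. intros t [Ht HPt].
    apply Rnot_lt_le. intros Hst. apply Hn, HPt. lra. }
  destruct (H m Hm HP) as [d [Hd Hs]].
  destruct (Rle_dec 1 m) as [H1|H1].
  + apply Hs; lra.
  + exfalso. pose (t := Rmin 1 (m + d / 2)).
    assert (Ht : (m < t <= 1 /\ t <= m + d / 2)%R).
    { unfold t. split; [split|]; [apply Rmin_glb_lt; lra|apply Rmin_l|apply Rmin_r]. }
    assert (E t); [|assert (t <= m)%R by (now apply Hub); lra].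
    split; [lra|]. intros s Hs'. destruct (Rlt_dec s m) as [H2|H2].
    * apply HP; lra.
    * apply Hs; lra.
Qed.

Definition seg (p q : C) (t : R) : C := p + RtoC t * (q - p).

Lemma seg_0 (p q : C) : seg p q 0 = p.
Proof. unfold seg. ring. Qed.

Lemma seg_1 (p q : C) : seg p q 1 = q.
Proof. unfold seg. ring. Qed.

Lemma seg_dist (p q : C) (s t : R) :
  Cmod (seg p q s - seg p q t) = (Rabs (s - t) * Cmod (q - p))%R.
Proof.
rewrite <- Cmod_R, <- Cmod_mult. f_equal. unfold seg. rewrite RtoC_minus. ring.
Qed.

Lemma seg_neq (p q : C) (s t : R) : p <> q -> s <> t -> seg p q s <> seg p q t.
Proof.
intros Hpq Hst E.
assert (E2 : Cmod (seg p q s - seg p q t) = 0%R).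
{ rewrite E. replace (seg p q t - seg p q t) with (RtoC 0) by ring. apply Cmod_0. }
rewrite seg_dist in E2. apply Rmult_integral in E2. destruct E2 as [E2|E2].
- apply Hst. apply Rminus_diag_uniq. destruct (Req_dec (s - t) 0) as [H|H]; [exact H|].
  apply Rabs_no_R0 in H. contradiction.
- apply Cmod_eq_0 in E2. apply Hpq. symmetry. now apply Ceq_minus.
Qed.

Lemma seg_before (p q : C) (t d : R) :
  p <> q -> (0 < t)%R -> (0 < d)%R ->
  exists s, (0 <= s < t)%R /\ seg p q s <> seg p q t /\ (Cmod (seg p q s - seg p q t) < d)%R.
Proof.
intros Hpq Ht Hd.
assert (Hm : (0 < Cmod (q - p))%R) by (apply Cmod_gt_0, Cminus_eq_contra; auto).
pose (e := Rmin t (d / (2 * Cmod (q - p)))).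
assert (He : (0 < e)%R) by (apply Rmin_pos; [|apply Rdiv_lt_0_compat]; lra).
pose proof (Rmin_l t (d / (2 * Cmod (q - p)))) as H1. fold e in H1.
pose proof (Rmin_r t (d / (2 * Cmod (q - p)))) as H2. fold e in H2.
exists (t - e)%R. split; [lra|]. split; [apply seg_neq; [exact Hpq|lra]|].
rewrite seg_dist. replace (t - e - t)%R with (- e)%R by ring.
rewrite Rabs_Ropp, Rabs_pos_eq by lra.
apply Rmult_le_compat_r with (r := Cmod (q - p)) in H2; [|lra].
replace (d / (2 * Cmod (q - p)) * Cmod (q - p))%R with (d / 2)%R in H2 by (field; lra).
lra.
Qed.

Lemma seg_after (p q : C) (t r : R) :
  (0 < r)%R ->
  exists d, (0 < d)%R /\ forall s, (t <= s < t + d)%R -> (Cmod (seg p q s - seg p q t) < r)%R.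
Proof.
intros Hr. pose proof (Cmod_ge_0 (q - p)) as Hm.
exists (r / (Cmod (q - p) + 1))%R. split; [apply Rdiv_lt_0_compat; lra|].
intros s Hs. rewrite seg_dist, Rabs_pos_eq by lra.
assert (H : (s - t < r / (Cmod (q - p) + 1))%R) by lra.
apply Rmult_lt_compat_r with (r := (Cmod (q - p) + 1)%R) in H; [|lra].
replace (r / (Cmod (q - p) + 1) * (Cmod (q - p) + 1))%R with r in H by (field; lra).
nra.
Qed.

Notation zero_near f z := (locally (T := C_UniformSpace) z (fun w => f w = 0)).
Notation zero_around f z := (locally' (T := C_UniformSpace) z (fun w => f w = 0)).

(** Propagation along the segment: at each point, zeros on the part already covered
    accumulate, so the expansion at this point vanishes identically. *)
Lemma identity_segment (f : C -> C) (p q : C) :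
  (forall t, (0 <= t <= 1)%R -> analytic_at f (seg p q t)) ->
  zero_near f p -> zero_near f q.
Proof.
intros Ha Hp. destruct (classic (p = q)) as [<-|Hpq]; [exact Hp|].
rewrite <- (seg_1 p q). apply (interval_induction (fun t => zero_near f (seg p q t))).
intros t Ht Hs.
assert (Hball : exists r, (0 < r)%R /\ forall w, (Cmod (w - seg p q t) < r)%R -> f w = 0).
{ destruct (Rle_lt_or_eq_dec 0 t (proj1 Ht)) as [H0|<-].
  - destruct (proj1 (analytic_at_expansion _ _) (Ha t Ht)) as [c [r H]].
    exists r. split; [apply H|]. intros w Hw.
    replace w with (seg p q t + (w - seg p q t)) by ring.
    apply (expansion_isolated_zeros _ _ _ _ H); [|exact Hw].
    intros d Hd. destruct (seg_before p q t d Hpq H0 Hd) as [s [Hst [Hne Hsd]]].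
    exists (seg p q s - seg p q t). split; [now apply Cminus_eq_contra|]. split; [exact Hsd|].
    replace (seg p q t + (seg p q s - seg p q t)) with (seg p q s) by ring.
    exact (locally_singleton _ _ (Hs s Hst)).
  - rewrite seg_0. apply locally_Cmod in Hp. exact Hp. }
destruct Hball as [r [Hr Hz]].
destruct (seg_after p q t r Hr) as [d [Hd Hafter]].
exists d. split; [exact Hd|]. intros s Hs1 _. specialize (Hafter s Hs1).
apply locally_Cmod. exists (r - Cmod (seg p q s - seg p q t))%R. split; [lra|].
intros w Hw. apply Hz.
replace (w - seg p q t) with ((w - seg p q s) + (seg p q s - seg p q t)) by ring.
eapply Rle_lt_trans; [apply Cmod_triangle|lra].
Qed.

Lemma seg_in_disc (c p q : C) (r t : R) :
  (0 <= t <= 1)%R -> (Cmod (p - c) < r)%R -> (Cmod (q - c) < r)%R ->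
  (Cmod (seg p q t - c) < r)%R.
Proof.
intros Ht Hp Hq.
replace (seg p q t - c) with (RtoC (1 - t) * (p - c) + RtoC t * (q - c)).
2:{ unfold seg. rewrite RtoC_minus. ring. }
eapply Rle_lt_trans; [apply Cmod_triangle|].
rewrite !Cmod_mult, !Cmod_R, !Rabs_pos_eq by lra.
destruct (Rle_lt_or_eq_dec 0 t (proj1 Ht)) as [H0|<-]; nra.
Qed.

(** Two points of a punctured disc are joined inside it by one segment, or by two when the
    centre lies between them; in the latter case the detour goes through the first point
    rotated by a right angle. *)
Lemma identity_punctured_disc (f : C -> C) (c : C) (r : R) (p q : C) :
  (forall z, z <> c -> (Cmod (z - c) < r)%R -> analytic_at f z) ->
  p <> c -> (Cmod (p - c) < r)%R -> q <> c -> (Cmod (q - c) < r)%R ->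
  zero_near f p -> zero_near f q.
Proof.
intros Ha Hp Hpr Hq Hqr H.
assert (Hline : forall u v, (Cmod (u - c) < r)%R -> (Cmod (v - c) < r)%R ->
   (forall t, (0 <= t <= 1)%R -> seg u v t <> c) -> zero_near f u -> zero_near f v).
{ intros u v Hu Hv Huv. apply identity_segment. intros t Ht.
  apply Ha; [now apply Huv|]. now apply seg_in_disc. }
destruct (classic (exists t, (0 <= t <= 1)%R /\ seg p q t = c)) as [[t [Ht Et]]|Hn].
2:{ apply (Hline p q Hpr Hqr); [|exact H]. intros t Ht E. apply Hn. exists t. auto. }
assert (Hp0 : p - c <> 0) by (now apply Cminus_eq_contra).
assert (Ht0 : (t <> 0)%R).
{ intros ->. rewrite seg_0 in Et. contradiction. }
pose (s := ((1 - t) / t)%R).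
assert (Hqs : q - c = - (RtoC s * (p - c))).
{ unfold s. rewrite RtoC_div, RtoC_minus by exact Ht0. rewrite <- Et. unfold seg. field.
  intros E. apply Ht0. now apply RtoC_inj in E. }
pose (m := c + Ci * (p - c)).
assert (Hm : m - c = Ci * (p - c)) by (unfold m; ring).
assert (Hmr : (Cmod (m - c) < r)%R).
{ rewrite Hm, Cmod_mult, Cmod_Ci. lra. }
assert (Him : forall x y : R, (RtoC x + RtoC y * Ci) * (p - c) = 0 -> x = 0%R /\ y = 0%R).
{ intros x y E. apply NNPP. intros Hxy.
  apply (Cmult_neq_0 (RtoC x + RtoC y * Ci) (p - c)); [|exact Hp0|exact E].
  intros E2. apply Hxy. pose proof (f_equal fst E2) as E3. pose proof (f_equal snd E2) as E4.
  simpl in E3, E4. split; lra. }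
apply (Hline m q Hmr Hqr).
- intros u Hu E.
  assert (E2 : (RtoC (- (u * s)) + RtoC (1 - u) * Ci) * (p - c) = 0).
  { rewrite RtoC_opp, RtoC_mult, RtoC_minus.
    transitivity (seg m q u - c); [|rewrite E; ring].
    replace (seg m q u - c) with ((1 - RtoC u) * (m - c) + RtoC u * (q - c)) by (unfold seg; ring).
    rewrite Hm, Hqs. ring. }
  apply Him in E2. destruct E2 as [_ E2].
  replace u with 1%R in E by lra. rewrite seg_1 in E. contradiction.
- apply (Hline p m Hpr Hmr); [|exact H].
  intros u Hu E.
  assert (E2 : (RtoC (1 - u) + RtoC u * Ci) * (p - c) = 0).
  { rewrite RtoC_minus. transitivity (seg p m u - c); [|rewrite E; ring].
    replace (seg p m u - c) with ((1 - RtoC u) * (p - c) + RtoC u * (m - c)) by (unfold seg; ring).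
    rewrite Hm. ring. }
  apply Him in E2. lra.
Qed.

Lemma locally_punctured (z : C) (P : C -> Prop) :
  locally (T := C_UniformSpace) z P -> locally' (T := C_UniformSpace) z P.
Proof. rewrite locally_Cmod, locally'_Cmod. intros [r [Hr H]]. exists r. auto. Qed.

(** The property propagated along the segment is to vanish on a punctured neighbourhood: a
    singular point on the segment is then passed inside a punctured disc, which is
    connected. *)
Lemma identity_isolated (f : C -> C) (p q : C) :
  (forall t, (0 <= t <= 1)%R -> locally' (T := C_UniformSpace) (seg p q t) (analytic_at f)) ->
  zero_near f p -> zero_around f q.
Proof.
intros Ha Hp. destruct (classic (p = q)) as [<-|Hpq]; [now apply locally_punctured|].
rewrite <- (seg_1 p q). apply (interval_induction (fun t => zero_around f (seg p q t))).
intros t Ht Hs.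
destruct (proj1 (locally'_Cmod _ _) (Ha t Ht)) as [r [Hr Han]].
assert (Hz : exists z, z <> seg p q t /\ (Cmod (z - seg p q t) < r)%R /\ zero_near f z).
{
  (* f vanishes on a punctured neighbourhood of some b in the disc; at most one of the two
     points b + M/2 and b + M/4 of it is the centre of the disc *)
  assert (Hb : exists b, (Cmod (b - seg p q t) < r)%R /\ zero_around f b).
  { destruct (Rle_lt_or_eq_dec 0 t (proj1 Ht)) as [H0|<-].
    - destruct (seg_before p q t r Hpq H0 Hr) as [s [Hst [_ Hsd]]].
      exists (seg p q s). split; [exact Hsd|]. now apply Hs.
    - exists p. rewrite seg_0. split; [|now apply locally_punctured].
      replace (p - p) with (RtoC 0) by ring. now rewrite Cmod_0. }
  destruct Hb as [b [Hbr Hb]]. apply locally'_open, locally'_Cmod in Hb.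
  destruct Hb as [e [He Hb]].
  assert (Hcand : forall x : R, (0 < x < Rmin e (r - Cmod (b - seg p q t)))%R ->
     b + RtoC x <> seg p q t ->
     exists z, z <> seg p q t /\ (Cmod (z - seg p q t) < r)%R /\ zero_near f z).
  { intros x Hx Hne.
    pose proof (Rmin_l e (r - Cmod (b - seg p q t))). pose proof (Rmin_r e (r - Cmod (b - seg p q t))).
    exists (b + RtoC x). split; [exact Hne|]. split.
    - replace (b + RtoC x - seg p q t) with (RtoC x + (b - seg p q t)) by ring.
      eapply Rle_lt_trans; [apply Cmod_triangle|]. rewrite Cmod_R, Rabs_pos_eq by lra. lra.
    - apply Hb.
      + intros E. assert (E2 : RtoC x = 0).
        { replace (RtoC x) with (b + RtoC x - b) by ring. rewrite E. ring. }
        apply RtoC_inj in E2. lra.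
      + replace (b + RtoC x - b) with (RtoC x) by ring. rewrite Cmod_R, Rabs_pos_eq by lra. lra. }
  assert (Hmin : (0 < Rmin e (r - Cmod (b - seg p q t)))%R) by (apply Rmin_pos; lra).
  set (M := Rmin e (r - Cmod (b - seg p q t))) in *.
  destruct (classic (b + RtoC (M / 2) = seg p q t)) as [E|Hne].
  - apply (Hcand (M / 4)%R); [lra|]. rewrite <- E. intros E2.
    assert (E3 : RtoC (M / 4) = RtoC (M / 2)).
    { replace (RtoC (M / 4)) with (b + RtoC (M / 4) - b) by ring. rewrite E2. ring. }
    apply RtoC_inj in E3. lra.
  - apply (Hcand (M / 2)%R); [lra|exact Hne]. }
destruct Hz as [z [Hz1 [Hz2 Hz3]]].
assert (Hall : forall w, w <> seg p q t -> (Cmod (w - seg p q t) < r)%R -> f w = 0).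
{ intros w Hw Hwr. apply (locally_singleton (T := C_UniformSpace) w (fun w => f w = 0)).
  now apply (identity_punctured_disc f (seg p q t) r z w). }
destruct (seg_after p q t r Hr) as [d [Hd Hafter]].
exists d. split; [exact Hd|]. intros s Hs1 _. specialize (Hafter s Hs1).
destruct (Req_dec s t) as [->|Hst].
- apply locally'_Cmod. exists r. auto.
- apply locally_punctured, locally_Cmod.
  assert (Hne := seg_neq p q s t Hpq Hst).
  assert (H0 : (0 < Cmod (seg p q s - seg p q t))%R) by (now apply Cmod_gt_0, Cminus_eq_contra).
  exists (Rmin (Cmod (seg p q s - seg p q t)) (r - Cmod (seg p q s - seg p q t))).
  split; [apply Rmin_pos; lra|]. intros w Hw.
  pose proof (Rmin_l (Cmod (seg p q s - seg p q t)) (r - Cmod (seg p q s - seg p q t))).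
  pose proof (Rmin_r (Cmod (seg p q s - seg p q t)) (r - Cmod (seg p q s - seg p q t))).
  apply Hall.
  + intros ->.
    replace (seg p q t - seg p q s) with (- (seg p q s - seg p q t)) in Hw by ring.
    rewrite Cmod_opp in Hw. lra.
  + replace (w - seg p q t) with ((w - seg p q s) + (seg p q s - seg p q t)) by ring.
    eapply Rle_lt_trans; [apply Cmod_triangle|lra].
Qed.

(** * Complex-valued functions of a real variable *)

Notation Ccont := (continuous (T := R_UniformSpace) (U := C_UniformSpace)).
Notation Cderiv := (is_derive (K := R_AbsRing) (V := C_R_NormedModule)).
Notation is_Cint := (is_RInt (V := C_R_NormedModule)).
Notation Cint := (RInt (V := C_R_CompleteNormedModule)).

Lemma Ccont_components (f : R -> C) (x : R) :
  Ccont f x <-> continuous (fun t => Re (f t)) x /\ continuous (fun t => Im (f t)) x.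
Proof.
split.
- intros H. split.
  + apply (continuous_comp f (fst : C_UniformSpace -> R)); [exact H|apply continuous_fst].
  + apply (continuous_comp f (snd : C_UniformSpace -> R)); [exact H|apply continuous_snd].
- intros [H1 H2]. intros P [e He].
  assert (B1 := H1 _ (locally_ball (T := R_UniformSpace) (Re (f x)) e)).
  assert (B2 := H2 _ (locally_ball (T := R_UniformSpace) (Im (f x)) e)).
  unfold filtermap in *. generalize (filter_and _ _ B1 B2). apply filter_imp.
  intros t [T1 T2]. apply He. split; assumption.
Qed.

Lemma Ccont_pair (f g : R -> R) (x : R) :
  continuous f x -> continuous g x -> Ccont (fun t => (f t, g t)) x.
Proof. intros Hf Hg. apply Ccont_components. split; assumption. Qed.

Lemma Ccont_mult (f g : R -> C) (x : R) :
  Ccont f x -> Ccont g x -> Ccont (fun t => f t * g t) x.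
Proof.
rewrite !Ccont_components. intros [F1 F2] [G1 G2]. split.
- apply (continuous_minus (V := R_NormedModule) (fun t => Re (f t) * Re (g t))%R (fun t => Im (f t) * Im (g t))%R);
  now apply (continuous_mult (K := R_AbsRing)).
- apply (continuous_plus (V := R_NormedModule) (fun t => Re (f t) * Im (g t))%R (fun t => Im (f t) * Re (g t))%R);
  now apply (continuous_mult (K := R_AbsRing)).
Qed.

Lemma Ccont_const (c : C) (x : R) : Ccont (fun _ => c) x.
Proof. apply continuous_const. Qed.

Lemma Ccont_plus (f g : R -> C) (x : R) :
  Ccont f x -> Ccont g x -> Ccont (fun t => f t + g t) x.
Proof. exact (continuous_plus (V := C_R_NormedModule) f g x). Qed.

Lemma Ccont_minus (f g : R -> C) (x : R) :
  Ccont f x -> Ccont g x -> Ccont (fun t => f t - g t) x.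
Proof. exact (continuous_minus (V := C_R_NormedModule) f g x). Qed.

Lemma Ccont_RtoC (f : R -> R) (x : R) : continuous f x -> Ccont (fun t => RtoC (f t)) x.
Proof. intros H. apply (Ccont_pair f (fun _ => 0%R)); [exact H|apply continuous_const]. Qed.

Lemma norm_Cmod (x : C) : norm (V := C_R_NormedModule) x = Cmod x.
Proof.
unfold norm, Cmod. simpl. unfold prod_norm, norm. simpl. f_equal.
unfold abs. simpl. rewrite !Rmult_1_r, <- !Rabs_mult.
rewrite !Rabs_pos_eq by apply Rle_0_sqr. reflexivity.
Qed.

Lemma Ccont_Cmod (f : R -> C) (x : R) : Ccont f x -> continuous (fun t => Cmod (f t)) x.
Proof.
intros H. apply (continuous_ext (fun t => norm (V := C_R_NormedModule) (f t))).
- intros t. apply norm_Cmod.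
- apply (continuous_comp f (norm (V := C_R_NormedModule))); [exact H|].
  apply (filterlim_norm (V := C_R_NormedModule)).
Qed.

Lemma Cderiv_pair (f g : R -> R) (x l m : R) :
  is_derive f x l -> is_derive g x m -> Cderiv (fun t => (f t, g t)) x (l, m).
Proof.
intros Hf Hg.
apply (is_derive_ext (fun t => plus (scal (f t) ((1, 0)%R : C_R_NormedModule)) (scal (g t) ((0, 1)%R : C_R_NormedModule)))).
- intros t. apply injective_projections; unfold plus, scal; simpl; unfold plus, scal; simpl;
  unfold mult; simpl; ring.
- replace (l, m) with (plus (scal l ((1, 0)%R : C_R_NormedModule)) (scal m ((0, 1)%R : C_R_NormedModule))).
  + apply (is_derive_plus (V := C_R_NormedModule)); now apply (is_derive_scal_l (V := C_R_NormedModule)).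
  + apply injective_projections; unfold plus, scal; simpl; unfold plus, scal; simpl;
    unfold mult; simpl; ring.
Qed.

Lemma Cderiv_components (f : R -> C) (x : R) (l : C) :
  Cderiv f x l -> is_derive (fun t => Re (f t)) x (Re l) /\ is_derive (fun t => Im (f t)) x (Im l).
Proof.
intros H. split.
- exact (filterdiff_comp' (V := C_R_NormedModule) (W := R_NormedModule) f
    (fun u : R * R => fst u) x _ _ H
    (filterdiff_linear (U := prod_NormedModule R_AbsRing R_NormedModule R_NormedModule) _ is_linear_fst)).
- exact (filterdiff_comp' (V := C_R_NormedModule) (W := R_NormedModule) f
    (fun u : R * R => snd u) x _ _ H
    (filterdiff_linear (U := prod_NormedModule R_AbsRing R_NormedModule R_NormedModule) _ is_linear_snd)).
Qed.

Lemma Cderiv_mult (f g : R -> C) (x : R) (df dg : C) :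
  Cderiv f x df -> Cderiv g x dg -> Cderiv (fun t => f t * g t) x (df * g x + f x * dg).
Proof.
intros Hf Hg. apply Cderiv_components in Hf, Hg. destruct Hf as [F1 F2], Hg as [G1 G2].
replace (df * g x + f x * dg) with
  ((Re df * Re (g x) + Re (f x) * Re dg - (Im df * Im (g x) + Im (f x) * Im dg))%R,
   (Re df * Im (g x) + Re (f x) * Im dg + (Im df * Re (g x) + Im (f x) * Re dg))%R).
2:{ unfold Re, Im. apply injective_projections; simpl; ring. }
apply (Cderiv_pair (fun t => Re (f t) * Re (g t) - Im (f t) * Im (g t))%R
                   (fun t => Re (f t) * Im (g t) + Im (f t) * Re (g t))%R).
- apply (is_derive_minus (V := R_NormedModule));
  apply (is_derive_mult (K := R_AbsRing)); try assumption; intros; apply Rmult_comm.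
- apply (is_derive_plus (V := R_NormedModule));
  apply (is_derive_mult (K := R_AbsRing)); try assumption; intros; apply Rmult_comm.
Qed.

Lemma Cderiv_cont (f : R -> C) (x : R) (l : C) : Cderiv f x l -> Ccont f x.
Proof. intros H. apply (ex_derive_continuous (V := C_R_NormedModule) f x). now exists l. Qed.

Lemma is_Cint_unique (f : R -> C) (p q : R) (l : C) : is_Cint f p q l -> Cint f p q = l.
Proof. apply (is_RInt_unique (V := C_R_CompleteNormedModule)). Qed.

Lemma is_Cint_cont (f : R -> C) (p q : R) :
  (forall t, (Rmin p q <= t <= Rmax p q)%R -> Ccont f t) -> is_Cint f p q (Cint f p q).
Proof.
intros H. apply (RInt_correct (V := C_R_CompleteNormedModule)).
apply (ex_RInt_continuous (V := C_R_CompleteNormedModule)). exact H.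
Qed.

Lemma is_Cint_mult (c : C) (f : R -> C) (p q : R) (l : C) :
  is_Cint f p q l -> is_Cint (fun t => c * f t) p q (c * l).
Proof.
intros H.
assert (H1 := is_RInt_fct_extend_fst (U := R_NormedModule) (V := R_NormedModule) _ _ _ _ H).
assert (H2 := is_RInt_fct_extend_snd (U := R_NormedModule) (V := R_NormedModule) _ _ _ _ H).
apply (is_RInt_fct_extend_pair (U := R_NormedModule) (V := R_NormedModule)).
- apply (is_RInt_minus (V := R_NormedModule)); now apply (is_RInt_scal (V := R_NormedModule)).
- apply (is_RInt_plus (V := R_NormedModule)); now apply (is_RInt_scal (V := R_NormedModule)).
Qed.

Lemma is_Cint_plus (f g : R -> C) (p q : R) (l m : C) :
  is_Cint f p q l -> is_Cint g p q m -> is_Cint (fun t => f t + g t) p q (l + m).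
Proof. exact (is_RInt_plus (V := C_R_NormedModule) f g p q l m). Qed.

Lemma is_Cint_minus (f g : R -> C) (p q : R) (l m : C) :
  is_Cint f p q l -> is_Cint g p q m -> is_Cint (fun t => f t - g t) p q (l - m).
Proof. exact (is_RInt_minus (V := C_R_NormedModule) f g p q l m). Qed.

Lemma is_Cint_chasles (f : R -> C) (p q r : R) (l m : C) :
  is_Cint f p q l -> is_Cint f q r m -> is_Cint f p r (l + m).
Proof. exact (is_RInt_Chasles (V := C_R_NormedModule) f p q r l m). Qed.

Lemma is_Cint_swap (f : R -> C) (p q : R) (l : C) : is_Cint f p q l -> is_Cint f q p (- l).
Proof. exact (is_RInt_swap (V := C_R_NormedModule) f q p l). Qed.

Lemma is_Cint_ext (f g : R -> C) (p q : R) (l : C) :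
  (forall t, (Rmin p q < t < Rmax p q)%R -> f t = g t) -> is_Cint f p q l -> is_Cint g p q l.
Proof. exact (is_RInt_ext (V := C_R_NormedModule) f g p q l). Qed.

Lemma is_Cint_bound (f : R -> C) (g : R -> R) (p q : R) (l : C) (m : R) :
  (p <= q)%R -> (forall t, (p <= t <= q)%R -> (Cmod (f t) <= g t)%R) ->
  is_Cint f p q l -> is_RInt g p q m -> (Cmod l <= m)%R.
Proof.
intros Hpq H Hf Hg. rewrite <- norm_Cmod.
apply (norm_RInt_le (V := C_R_NormedModule) f g p q l m Hpq); [|exact Hf|exact Hg].
intros t Ht. rewrite norm_Cmod. now apply H.
Qed.

Lemma is_Cint_derive (f df : R -> C) (p q : R) :
  (forall t, (Rmin p q <= t <= Rmax p q)%R -> Cderiv f t (df t)) ->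
  (forall t, (Rmin p q <= t <= Rmax p q)%R -> Ccont df t) ->
  is_Cint df p q (f q - f p).
Proof. exact (is_RInt_derive (V := C_R_CompleteNormedModule) f df p q). Qed.

(** * The exponential series *)

Lemma exp_le_mono (x y : R) : (x <= y)%R -> (exp x <= exp y)%R.
Proof. intros [H|<-]; [left; now apply exp_increasing|apply Rle_refl]. Qed.

Lemma Cmod_Cexp (x : C) : Cmod (Cexp x) = exp (Re x).
Proof.
unfold Cmod, Cexp. simpl fst. simpl snd.
replace ((exp (Re x) * cos (Im x)) ^ 2 + (exp (Re x) * sin (Im x)) ^ 2)%R
  with ((exp (Re x)) ^ 2)%R.
- rewrite <- Rsqr_pow2. apply sqrt_Rsqr. left; apply exp_pos.
- pose proof (sin2_cos2 (Im x)) as H. unfold Rsqr in H.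
  transitivity (exp (Re x) ^ 2 * (sin (Im x) * sin (Im x) + cos (Im x) * cos (Im x)))%R; [rewrite H|]; ring.
Qed.

Lemma Cexp_plus (x y : C) : Cexp (x + y) = Cexp x * Cexp y.
Proof.
unfold Cexp, Re, Im. apply injective_projections; simpl.
- rewrite exp_plus, cos_plus. ring.
- rewrite exp_plus, sin_plus. ring.
Qed.

Lemma Cexp_0 : Cexp 0 = 1.
Proof. unfold Cexp. simpl. rewrite exp_0, cos_0, sin_0. apply injective_projections; simpl; ring. Qed.

Lemma Cderiv_Cexp (x : C) (s : R) : Cderiv (fun u => Cexp (RtoC u * x)) s (x * Cexp (RtoC s * x)).
Proof.
apply (is_derive_ext (fun u : R => (exp (u * Re x) * cos (u * Im x), exp (u * Re x) * sin (u * Im x))%R : C_R_NormedModule)).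
- intros u. unfold Cexp. rewrite re_scal_l, im_scal_l. reflexivity.
- replace (x * Cexp (RtoC s * x)) with
   ((Re x * exp (s * Re x) * cos (s * Im x) - exp (s * Re x) * (Im x * sin (s * Im x)))%R,
    (Re x * exp (s * Re x) * sin (s * Im x) + exp (s * Re x) * (Im x * cos (s * Im x)))%R).
  + apply Cderiv_pair; auto_derive; trivial; ring.
  + unfold Cexp. rewrite re_scal_l, im_scal_l.
    apply injective_projections; unfold Re, Im; simpl; ring.
Qed.

Definition exp_term (x : C) (j : nat) : C := RtoC (/ INR (fact j)) * x ^ j.

Lemma is_derive_exp_term (i : nat) (u : R) :
  is_derive (fun v => / INR (fact (S i)) * v ^ S i)%R u (/ INR (fact i) * u ^ i)%R.
Proof.
auto_derive; [trivial|]. change (fact i + i * fact i)%nat with (fact (S i)).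
change (match i with O => 1%R | S _ => (INR i + 1)%R end) with (INR (S i)).
rewrite fact_simpl, mult_INR.
assert (INR (S i) <> 0)%R by (now apply not_0_INR).
pose proof (INR_fact_neq_0 i). field. split; assumption.
Qed.

Lemma Cderiv_exp_partial (x : C) (J : nat) (s : R) :
  Cderiv (fun u => psum (exp_term (RtoC u * x)) (S J)) s (x * psum (exp_term (RtoC s * x)) J).
Proof.
assert (Hterm : forall i s, Cderiv (fun u => exp_term (RtoC u * x) (S i)) s (x * exp_term (RtoC s * x) i)).
{ intros i u. apply (is_derive_ext (fun v => scal (/ INR (fact (S i)) * v ^ S i)%R (x ^ S i : C_R_NormedModule))).
  - intros v. unfold exp_term. rewrite Cpow_mult_l, scal_R_Cmult, RtoC_mult, RtoC_pow.
    change (RtoC (/ INR (fact (S i))) * RtoC v ^ S i * x ^ S i = RtoC (/ INR (fact (S i))) * (RtoC v ^ S i * x ^ S i)). ring.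
  - replace (x * exp_term (RtoC u * x) i) with (scal (/ INR (fact i) * u ^ i)%R (x ^ S i : C_R_NormedModule)).
    + apply (is_derive_scal_l (V := C_R_NormedModule) (fun v => / INR (fact (S i)) * v ^ S i)%R).
      apply is_derive_exp_term.
    + unfold exp_term. rewrite scal_R_Cmult, Cpow_mult_l, RtoC_mult, RtoC_pow. simpl Cpow.
      change (RtoC (/ INR (fact i)) * RtoC u ^ i * (x * x ^ i) = x * (RtoC (/ INR (fact i)) * (RtoC u ^ i * x ^ i))). ring. }
induction J as [|J IH].
- simpl. replace (x * 0) with (RtoC 0) by ring.
  apply (is_derive_ext (fun _ => (0 + exp_term 0 0 : C_R_NormedModule))).
  + intros t. unfold exp_term. simpl. reflexivity.
  + apply (is_derive_const (V := C_R_NormedModule)).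
- change (psum (exp_term (RtoC s * x)) (S J)) with (psum (exp_term (RtoC s * x)) J + exp_term (RtoC s * x) J).
  rewrite Cmult_plus_distr_l.
  apply (is_derive_plus (V := C_R_NormedModule) (fun u => psum (exp_term (RtoC u * x)) (S J))
     (fun u => exp_term (RtoC u * x) (S J))); [exact IH|apply Hterm].
Qed.

Lemma exp_partial_0 (J : nat) : psum (exp_term 0) (S J) = 1.
Proof.
induction J as [|J IH].
- simpl. unfold exp_term. simpl. rewrite Rinv_1. ring.
- change (psum (exp_term 0) (S J) + exp_term 0 (S J) = 1). rewrite IH. unfold exp_term. simpl. ring.
Qed.

(** Taylor remainder along the ray of [x], by repeated integration. *)
Lemma Cexp_taylor_ray (x : C) (J : nat) (s : R) :
  (0 <= s <= 1)%R ->
  (Cmod (Cexp (RtoC s * x) - psum (exp_term (RtoC s * x)) J)%C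
     <= exp (Cmod x) * Cmod x ^ J * (/ INR (fact J) * s ^ J))%R.
Proof.
revert s. induction J as [|J IH]; intros s Hs.
- simpl. replace (Cexp (RtoC s * x) - 0) with (Cexp (RtoC s * x)) by ring.
  rewrite Cmod_Cexp, Rinv_1, !Rmult_1_r, re_scal_l.
  apply exp_le_mono. pose proof (re_le_Cmod x) as H. apply Rabs_le_between in H.
  pose proof (Cmod_ge_0 x). nra.
- pose (f := fun u => Cexp (RtoC u * x) - psum (exp_term (RtoC u * x)) (S J)).
  pose (df := fun u => x * Cexp (RtoC u * x) - x * psum (exp_term (RtoC u * x)) J).
  assert (Hf : is_Cint df 0 s (f s - f 0%R)).
  { apply is_Cint_derive.
    - intros t _. apply (is_derive_minus (V := C_R_NormedModule) (fun u => Cexp (RtoC u * x))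
        (fun u => psum (exp_term (RtoC u * x)) (S J))); [apply Cderiv_Cexp|apply Cderiv_exp_partial].
    - intros t _. apply Ccont_minus; apply Ccont_mult; try apply Ccont_const.
      + eapply Cderiv_cont, Cderiv_Cexp.
      + destruct J as [|J']; [apply Ccont_const|]. eapply Cderiv_cont, Cderiv_exp_partial. }
  replace (f s - f 0%R) with (f s) in Hf.
  2:{ unfold f at 3. rewrite Cmult_0_l, Cexp_0, exp_partial_0. ring. }
  refine (is_Cint_bound df (fun u => exp (Cmod x) * Cmod x ^ S J * (/ INR (fact J) * u ^ J))%R 0 s _ _ (proj1 Hs) _ Hf _).
  + intros t Ht. unfold df.
    replace (x * Cexp (RtoC t * x) - x * psum (exp_term (RtoC t * x)) J)
      with (x * (Cexp (RtoC t * x) - psum (exp_term (RtoC t * x)) J)) by ring.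
    rewrite Cmod_mult. simpl pow.
    replace (exp (Cmod x) * (Cmod x * Cmod x ^ J) * (/ INR (fact J) * t ^ J))%R
      with (Cmod x * (exp (Cmod x) * Cmod x ^ J * (/ INR (fact J) * t ^ J)))%R by ring.
    apply Rmult_le_compat_l; [apply Cmod_ge_0|]. apply IH. lra.
  + apply (is_RInt_scal (V := R_NormedModule)).
    replace (/ INR (fact (S J)) * s ^ S J)%R with (minus (/ INR (fact (S J)) * s ^ S J) (/ INR (fact (S J)) * 0 ^ S J))%R.
    2:{ unfold minus, plus, opp; simpl. ring. }
    apply (is_RInt_derive (V := R_CompleteNormedModule) (fun u => / INR (fact (S J)) * u ^ S J)%R).
    * intros t _. apply is_derive_exp_term.
    * intros t _. apply (ex_derive_continuous (V := R_NormedModule)). auto_derive. trivial.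
Qed.

Lemma Cexp_taylor (x : C) (J : nat) :
  (Cmod (Cexp x - psum (exp_term x) J)%C <= exp (Cmod x) * (/ INR (fact J) * Cmod x ^ J))%R.
Proof.
pose proof (Cexp_taylor_ray x J 1 ltac:(lra)) as H.
rewrite Cmult_1_l, pow1 in H. lra.
Qed.

Lemma exp_series (y : R) : is_series (fun j => / INR (fact j) * y ^ j)%R (exp y).
Proof.
pose proof (is_exp_Reals y) as H. unfold is_pseries in H.
revert H. apply is_series_ext. intros n. rewrite pow_n_pow.
change (y ^ n * / INR (fact n) = / INR (fact n) * y ^ n)%R. ring.
Qed.

Lemma exp_term_le (y : R) (j : nat) : (0 <= y)%R -> (/ INR (fact j) * y ^ j <= exp y)%R.
Proof.
intros Hy.
assert (Hp : forall i, (0 <= / INR (fact i) * y ^ i)%R).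
{ intros i. apply Rmult_le_pos; [left; apply Rinv_0_lt_compat, INR_fact_lt_0|now apply pow_le]. }
apply Rle_trans with (sum_n (fun i => / INR (fact i) * y ^ i)%R j).
- destruct j as [|j]; [rewrite sum_O; lra|]. rewrite sum_Sn.
  change (/ INR (fact (S j)) * y ^ S j <= sum_n (fun i => / INR (fact i) * y ^ i)%R j + / INR (fact (S j)) * y ^ S j)%R.
  assert (0 <= sum_n (fun i => / INR (fact i) * y ^ i)%R j)%R; [|lra].
  clear -Hp. induction j as [|j IH]; [rewrite sum_O; apply Hp|]. rewrite sum_Sn.
  apply Rplus_le_le_0_compat; [exact IH|apply Hp].
- apply (is_lim_seq_incr_compare (sum_n (fun i => / INR (fact i) * y ^ i)%R)).
  + apply exp_series.
  + intros n. rewrite sum_Sn. specialize (Hp (S n)).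
    change (sum_n (fun i => / INR (fact i) * y ^ i)%R n <= sum_n (fun i => / INR (fact i) * y ^ i)%R n + / INR (fact (S n)) * y ^ S n)%R. lra.
Qed.

Lemma exp_term_small (y e : R) :
  (0 < e)%R -> exists N, forall j, (N <= j)%nat -> (Rabs (/ INR (fact j) * y ^ j) < e)%R.
Proof.
intros He.
assert (H : is_lim_seq (fun j => / INR (fact j) * y ^ j)%R 0%R).
{ apply ex_series_lim_0. eexists. apply exp_series. }
apply is_lim_seq_spec in H. destruct (H (mkposreal e He)) as [N HN]. exists N.
intros j Hj. specialize (HN j Hj). simpl in HN. now rewrite Rminus_0_r in HN.
Qed.

(** * Logarithmic moments over a compact interval *)

Lemma Cmod_real_Cpow (t : R) (s : C) : Cmod (real_Cpow t s) = exp (Re s * ln t).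
Proof. unfold real_Cpow. now rewrite Cmod_Cexp, re_scal_r. Qed.

Lemma real_Cpow_plus (t : R) (s u : C) : real_Cpow t (s + u) = real_Cpow t s * real_Cpow t u.
Proof. unfold real_Cpow. rewrite <- Cexp_plus. f_equal. ring. Qed.

Lemma real_Cpow_1 (s : C) : real_Cpow 1 s = 1.
Proof. unfold real_Cpow. rewrite ln_1, Cmult_0_r. apply Cexp_0. Qed.

Lemma Cderiv_real_Cpow (t : R) (s : C) :
  (0 < t)%R -> Cderiv (fun u => real_Cpow u s) t (s * RtoC (/ t) * real_Cpow t s).
Proof.
intros Ht.
apply (is_derive_ext (fun u : R => (exp (Re s * ln u) * cos (Im s * ln u), exp (Re s * ln u) * sin (Im s * ln u))%R : C_R_NormedModule)).
- intros u. unfold real_Cpow, Cexp. rewrite re_scal_r, im_scal_r. reflexivity.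
- replace (s * RtoC (/ t) * real_Cpow t s) with
   ((Re s * / t * exp (Re s * ln t) * cos (Im s * ln t) - exp (Re s * ln t) * (Im s * / t * sin (Im s * ln t)))%R,
    (Re s * / t * exp (Re s * ln t) * sin (Im s * ln t) + exp (Re s * ln t) * (Im s * / t * cos (Im s * ln t)))%R).
  + apply Cderiv_pair; (auto_derive; [repeat split; exact Ht|field; lra]).
  + unfold real_Cpow, Cexp. rewrite re_scal_r, im_scal_r.
    apply injective_projections; unfold Re, Im; simpl; ring.
Qed.

Lemma Ccont_real_Cpow (t : R) (s : C) : (0 < t)%R -> Ccont (fun u => real_Cpow u s) t.
Proof. intros Ht. eapply Cderiv_cont. now apply Cderiv_real_Cpow. Qed.

(** The [j]-th derivative of [t^(-z)] with respect to [z]. *)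
Definition logpow (j : nat) (z : C) (t : R) : C := RtoC ((- ln t) ^ j) * real_Cpow t (- z).

Lemma Ccont_logpow (j : nat) (z : C) (t : R) : (0 < t)%R -> Ccont (logpow j z) t.
Proof.
intros Ht. apply Ccont_mult; [|now apply Ccont_real_Cpow].
apply Ccont_RtoC. apply (ex_derive_continuous (V := R_NormedModule)).
auto_derive. exact Ht.
Qed.

(** The [j]-th Taylor coefficient at [z] of the entire function
    [s |-> int_p^q g(t) t^(-s) dt]. *)
Definition log_moment (g : R -> C) (j : nat) (z : C) (p q : R) : C :=
  RtoC (/ INR (fact j)) * Cint (fun t => g t * logpow j z t) p q.

Definition mellin_int (g : R -> C) (z : C) (p q : R) : C := Cint (fun t => g t * real_Cpow t (- z)) p q.

Definition Ccont_on (g : R -> C) (p q : R) : Prop :=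
  forall t, (Rmin p q <= t <= Rmax p q)%R -> (0 < t)%R /\ Ccont g t.

Lemma is_Cint_logpow (g : R -> C) (j : nat) (z : C) (p q : R) :
  Ccont_on g p q ->
  is_Cint (fun t => g t * logpow j z t) p q (Cint (fun t => g t * logpow j z t) p q).
Proof.
intros Hg. apply is_Cint_cont. intros t Ht. destruct (Hg t Ht) as [H0 H1].
apply Ccont_mult; [exact H1|now apply Ccont_logpow].
Qed.

Lemma is_Cint_mellin_int (g : R -> C) (z : C) (p q : R) :
  Ccont_on g p q -> is_Cint (fun t => g t * real_Cpow t (- z)) p q (mellin_int g z p q).
Proof.
intros Hg. apply is_Cint_cont. intros t Ht. destruct (Hg t Ht) as [H0 H1].
apply Ccont_mult; [exact H1|now apply Ccont_real_Cpow].
Qed.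

Lemma is_Cint_psum (F : nat -> R -> C) (u : nat -> C) (p q : R) (J : nat) :
  (forall j, is_Cint (F j) p q (u j)) ->
  is_Cint (fun t => psum (fun j => F j t) J) p q (psum u J).
Proof.
intros H. induction J as [|J IH].
- simpl. assert (E : is_Cint (fun t => 0 * F 0%nat t) p q (0 * u 0%nat)) by (apply is_Cint_mult, H).
  rewrite Cmult_0_l in E. revert E. apply is_Cint_ext. intros t _. ring.
- simpl. apply is_Cint_plus; [exact IH|apply H].
Qed.

Lemma psum_ext (a b : nat -> C) (J : nat) : (forall j, a j = b j) -> psum a J = psum b J.
Proof. intros H. induction J as [|J IH]; [reflexivity|]. simpl. now rewrite IH, H. Qed.

Lemma psum_scal (x : C) (a : nat -> C) (J : nat) : psum (fun j => x * a j) J = x * psum a J.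
Proof. induction J as [|J IH]; simpl; [ring|]. rewrite IH. ring. Qed.

Lemma Csum_psum (a : nat -> C) (l : C) :
  (forall e : R, (0 < e)%R -> exists N, forall n, (N <= n)%nat -> (Cmod (l - psum a n) < e)%R) ->
  Csum a l.
Proof.
intros H. apply Csum_Cmod. intros e He. destruct (H e He) as [N HN]. exists N. intros n Hn.
rewrite sum_n_psum.
replace (psum a (S n) - l) with (- (l - psum a (S n))) by ring.
rewrite Cmod_opp. apply HN. lia.
Qed.

(** The exponential series in [w ln t] may be integrated termwise, since its Taylor remainder
    is uniformly small on the compact interval. *)
Lemma mellin_int_expansion (g : R -> C) (p q : R) (z w : C) :
  (p <= q)%R -> Ccont_on g p q ->
  Csum (fun j => log_moment g j z p q * w ^ j) (mellin_int g (z + w) p q).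
Proof.
intros Hpq Hg.
assert (Hpos : forall t, (p <= t <= q)%R -> (0 < t)%R /\ Ccont g t).
{ intros t Ht. apply Hg. rewrite Rmin_left, Rmax_right by exact Hpq. exact Ht. }
assert (Hp : (0 < p)%R) by (apply (Hpos p); lra).
pose (L := (Rabs (ln p) + Rabs (ln q))%R).
assert (HL : forall t, (p <= t <= q)%R -> (Rabs (ln t) <= L)%R).
{ intros t Ht. unfold L.
  assert (ln p <= ln t)%R by (destruct (proj1 Ht) as [H|<-]; [left; apply ln_increasing; lra|lra]).
  assert (ln t <= ln q)%R by (destruct (proj2 Ht) as [H1|<-]; [left; apply ln_increasing; lra|lra]).
  unfold Rabs; repeat destruct Rcase_abs; lra. }
assert (HL0 : (0 <= L)%R) by (unfold L; pose proof (Rabs_pos (ln p)); pose proof (Rabs_pos (ln q)); lra).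
(* the integral A of this modulus replaces a bound of g on the interval *)
pose (G := fun t => Cmod (g t * real_Cpow t (- z))).
assert (HG : ex_RInt G p q).
{ apply (ex_RInt_continuous (V := R_CompleteNormedModule)). intros t Ht.
  rewrite Rmin_left, Rmax_right in Ht by exact Hpq. destruct (Hpos t Ht) as [H0 H1].
  apply Ccont_Cmod, Ccont_mult; [exact H1|now apply Ccont_real_Cpow]. }
destruct HG as [A HA].
assert (HA0 : (0 <= A)%R).
{ apply (is_RInt_ge_0 G p q A Hpq HA). intros t _. apply Cmod_ge_0. }
apply Csum_psum. intros e He.
pose (y := (Cmod w * L)%R).
assert (Hy : (0 <= y)%R) by (apply Rmult_le_pos; [apply Cmod_ge_0|exact HL0]).
assert (He' : (0 < e / ((A + 1) * exp y))%R).
{ apply Rdiv_lt_0_compat; [exact He|]. apply Rmult_lt_0_compat; [lra|apply exp_pos]. }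
destruct (exp_term_small y _ He') as [N HN]. exists N. intros n Hn. specialize (HN n Hn).
rewrite Rabs_pos_eq in HN.
2:{ apply Rmult_le_pos; [left; apply Rinv_0_lt_compat, INR_fact_lt_0|now apply pow_le]. }
assert (Hint := is_Cint_minus _ _ _ _ _ _ (is_Cint_mellin_int g (z + w) p q Hg)
  (is_Cint_psum (fun j t => RtoC (/ INR (fact j)) * w ^ j * (g t * logpow j z t)) _ p q n
    (fun j => is_Cint_mult _ _ _ _ _ (is_Cint_logpow g j z p q Hg)))).
assert (Hle : (Cmod (mellin_int g (z + w) p q
   - psum (fun j => RtoC (/ INR (fact j)) * w ^ j * Cint (fun t => g t * logpow j z t) p q) n)%C
     <= exp y * (/ INR (fact n) * y ^ n) * A)%R).
{ apply (fun HB => is_Cint_bound _ (fun t => exp y * (/ INR (fact n) * y ^ n) * G t)%R p q _ _ Hpq HB Hint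
     (is_RInt_scal (V := R_NormedModule) G p q _ A HA)).
  intros t Ht.
  replace (g t * real_Cpow t (- (z + w)) - psum (fun j => RtoC (/ INR (fact j)) * w ^ j * (g t * logpow j z t)) n)
    with ((g t * real_Cpow t (- z)) * (Cexp (w * RtoC (- ln t)) - psum (exp_term (w * RtoC (- ln t))) n)).
  2:{ rewrite (psum_ext (fun j => RtoC (/ INR (fact j)) * w ^ j * (g t * logpow j z t))
              (fun j => g t * real_Cpow t (- z) * exp_term (w * RtoC (- ln t)) j)).
      - rewrite psum_scal. replace (- (z + w)) with (- z + - w) by ring.
        rewrite real_Cpow_plus. unfold real_Cpow at 3.
        replace (- w * RtoC (ln t)) with (w * RtoC (- ln t)) by (rewrite RtoC_opp; ring). ring.
      - intros j. unfold exp_term, logpow. rewrite Cpow_mult_l, <- RtoC_pow. ring. }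
  rewrite Cmod_mult. rewrite (Rmult_comm _ (G t)). apply Rmult_le_compat_l; [apply Cmod_ge_0|].
  eapply Rle_trans; [apply Cexp_taylor|].
  assert (Hm : (0 <= Cmod (w * RtoC (- ln t)) <= y)%R).
  { split; [apply Cmod_ge_0|]. rewrite Cmod_mult, Cmod_R, Rabs_Ropp. unfold y.
    apply Rmult_le_compat_l; [apply Cmod_ge_0|now apply HL]. }
  apply Rmult_le_compat; [left; apply exp_pos| |apply exp_le_mono, Hm|].
  - apply Rmult_le_pos; [left; apply Rinv_0_lt_compat, INR_fact_lt_0|apply pow_le, Hm].
  - apply Rmult_le_compat_l; [left; apply Rinv_0_lt_compat, INR_fact_lt_0|now apply pow_incr]. }
rewrite (psum_ext _ (fun j => RtoC (/ INR (fact j)) * w ^ j * Cint (fun t => g t * logpow j z t) p q)).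
2:{ intros j. unfold log_moment. ring. }
eapply Rle_lt_trans; [exact Hle|].
pose proof (exp_pos y) as Hey.
apply Rle_lt_trans with (exp y * (/ INR (fact n) * y ^ n) * (A + 1))%R.
- apply Rmult_le_compat_l; [|lra]. apply Rmult_le_pos; [lra|].
  apply Rmult_le_pos; [left; apply Rinv_0_lt_compat, INR_fact_lt_0|now apply pow_le].
- apply Rmult_lt_compat_r with (r := ((A + 1) * exp y)%R) in HN; [|apply Rmult_lt_0_compat; lra].
  replace (e / ((A + 1) * exp y) * ((A + 1) * exp y))%R with e in HN by (field; split; lra).
  lra.
Qed.

(** A term of the exponential series is at most its sum.  The bound is uniform in [j], and all
    estimates of moments rest on it. *)
Lemma log_weight_le (rho t : R) (j : nat) :
  (0 <= rho)%R -> (/ INR (fact j) * rho ^ j * Rabs (ln t) ^ j <= exp (rho * Rabs (ln t)))%R.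
Proof.
intros Hr. rewrite Rmult_assoc, <- Rpow_mult_distr.
apply exp_term_le. apply Rmult_le_pos; [exact Hr|apply Rabs_pos].
Qed.

Lemma log_moment_bound (g : R -> C) (j : nat) (z : C) (p q rho : R) (G : R -> R) (m : R) :
  (p <= q)%R -> (0 <= rho)%R -> Ccont_on g p q ->
  (forall t, (p <= t <= q)%R -> (Cmod (g t) * exp (- Re z * ln t) * exp (rho * Rabs (ln t)) <= G t)%R) ->
  is_RInt G p q m -> (Cmod (log_moment g j z p q) * rho ^ j <= m)%R.
Proof.
intros Hpq Hr Hg HG Hm.
replace (Cmod (log_moment g j z p q) * rho ^ j)%R
  with (Cmod (RtoC (/ INR (fact j) * rho ^ j) * Cint (fun t => g t * logpow j z t) p q)).
2:{ unfold log_moment. rewrite !Cmod_mult, !Cmod_R.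
    assert (0 < / INR (fact j))%R by apply Rinv_0_lt_compat, INR_fact_lt_0.
    assert (0 <= rho ^ j)%R by (now apply pow_le).
    rewrite !Rabs_pos_eq; [ring|lra|now apply Rmult_le_pos; lra]. }
refine (is_Cint_bound _ G p q _ m Hpq _ (is_Cint_mult _ _ _ _ _ (is_Cint_logpow g j z p q Hg)) Hm).
intros t Ht. eapply Rle_trans; [|now apply HG].
unfold logpow. rewrite !Cmod_mult, !Cmod_R, Cmod_real_Cpow, <- RPow_abs, Rabs_Ropp.
rewrite Rabs_pos_eq.
2:{ apply Rmult_le_pos; [left; apply Rinv_0_lt_compat, INR_fact_lt_0|now apply pow_le]. }
change (Re (- z)) with (- Re z)%R.
pose proof (log_weight_le rho t j Hr) as Hw.
pose proof (Cmod_ge_0 (g t)) as H1. pose proof (exp_pos (- Re z * ln t)) as H2.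
replace (/ INR (fact j) * rho ^ j * (Cmod (g t) * (Rabs (ln t) ^ j * exp (- Re z * ln t))))%R
  with (Cmod (g t) * exp (- Re z * ln t) * (/ INR (fact j) * rho ^ j * Rabs (ln t) ^ j))%R by ring.
apply Rmult_le_compat_l; [|exact Hw]. apply Rmult_le_pos; lra.
Qed.

Lemma is_RInt_exp_ln (c p q : R) :
  (0 < p <= q)%R -> c <> 0%R ->
  is_RInt (fun t => exp (c * ln t) / t)%R p q ((exp (c * ln q) - exp (c * ln p)) / c)%R.
Proof.
intros Hp Hc.
replace ((exp (c * ln q) - exp (c * ln p)) / c)%R with (minus (exp (c * ln q) / c) (exp (c * ln p) / c))%R.
2:{ unfold minus, plus, opp; simpl. field. exact Hc. }
apply (is_RInt_derive (V := R_CompleteNormedModule) (fun t => exp (c * ln t) / c)%R);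
  rewrite Rmin_left, Rmax_right by lra; intros t Ht.
- auto_derive; [lra|]. field. split; lra.
- apply (ex_derive_continuous (V := R_NormedModule)). auto_derive. lra.
Qed.

Lemma pow_exp_ln (t : R) (N : nat) : (0 < t)%R -> (t ^ N = exp (INR N * ln t))%R.
Proof.
intros Ht. induction N as [|N IH].
- simpl. now rewrite Rmult_0_l, exp_0.
- rewrite S_INR. simpl pow. rewrite IH, Rmult_plus_distr_r, exp_plus, Rmult_1_l, exp_ln by exact Ht. ring.
Qed.

(** Near [0] a factor [t^N] makes the moments converge up to abscissa [N + 1]. *)
Lemma log_moment_bound_zero (g : R -> C) (j N : nat) (z : C) (p q rho M b : R) :
  (0 < p <= q)%R -> (q <= b <= 1)%R -> (0 <= rho)%R -> (0 < INR N + 1 - rho - Re z)%R ->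
  (forall t, (0 < t <= b)%R -> (Cmod (g t) <= M * t ^ N)%R) -> Ccont_on g p q ->
  (Cmod (log_moment g j z p q) * rho ^ j
     <= M / (INR N + 1 - rho - Re z) * exp ((INR N + 1 - rho - Re z) * ln q))%R.
Proof.
intros Hp Hq Hr Hd HM Hg. set (d := (INR N + 1 - rho - Re z)%R) in *.
assert (HM0 : (0 <= M)%R).
{ assert (Hp0 : (0 < p ^ N)%R) by (apply pow_lt; lra).
  pose proof (HM p ltac:(lra)) as H. pose proof (Cmod_ge_0 (g p)). nra. }
apply Rle_trans with (M * ((exp (d * ln q) - exp (d * ln p)) / d))%R.
- apply (log_moment_bound g j z p q rho (fun t => M * (exp (d * ln t) / t))%R); [lra|exact Hr|exact Hg| |].
  + intros t Ht.
    assert (Hln : (ln t <= 0)%R).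
    { rewrite <- ln_1. destruct (Rle_lt_or_eq_dec t 1 ltac:(lra)) as [H| ->]; [left; apply ln_increasing; lra|lra]. }
    rewrite Rabs_left1 by exact Hln.
    replace (M * (exp (d * ln t) / t))%R
      with (M * t ^ N * (exp (- Re z * ln t) * exp (rho * - ln t)))%R.
    * rewrite Rmult_assoc. apply Rmult_le_compat_r; [|apply HM; lra].
      left. apply Rmult_lt_0_compat; apply exp_pos.
    * rewrite pow_exp_ln by lra. unfold d.
      replace (/ t)%R with (exp (- ln t)) by (rewrite exp_Ropp, exp_ln by lra; reflexivity).
      unfold Rdiv. replace (/ t)%R with (exp (- ln t)) by (rewrite exp_Ropp, exp_ln by lra; reflexivity).
      rewrite !Rmult_assoc, <- !exp_plus. do 2 f_equal. ring.
  + apply (is_RInt_scal (V := R_NormedModule)). apply is_RInt_exp_ln; lra.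
- pose proof (exp_pos (d * ln p)) as H1.
  unfold Rdiv. rewrite Rmult_assoc. apply Rmult_le_compat_l; [exact HM0|].
  rewrite Rmult_comm. apply Rmult_le_compat_l; [left; now apply Rinv_0_lt_compat|]. lra.
Qed.

Lemma Cderiv_logpow (j : nat) (z : C) (t : R) :
  (0 < t)%R ->
  Cderiv (logpow j z) t
    (RtoC (/ t) * (RtoC (- INR j * (- ln t) ^ pred j) * real_Cpow t (- z) - z * logpow j z t)).
Proof.
intros Ht.
assert (H1 : Cderiv (fun u => RtoC ((- ln u) ^ j)) t (RtoC (- INR j * (- ln t) ^ pred j * / t))).
{ apply Cderiv_pair; [|apply (is_derive_const (V := R_NormedModule))].
  auto_derive; [exact Ht|]. field. lra. }
pose proof (Cderiv_mult _ _ _ _ _ H1 (Cderiv_real_Cpow t (- z) Ht)) as H.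
replace (RtoC (/ t) * (RtoC (- INR j * (- ln t) ^ pred j) * real_Cpow t (- z) - z * logpow j z t))
  with (RtoC (- INR j * (- ln t) ^ pred j * / t) * real_Cpow t (- z)
        + RtoC ((- ln t) ^ j) * (- z * RtoC (/ t) * real_Cpow t (- z))).
- exact H.
- unfold logpow. rewrite !RtoC_mult. ring.
Qed.

Lemma log_weight_deriv_le (rho t : R) (j : nat) :
  (0 <= rho)%R ->
  (/ INR (fact j) * rho ^ j * (INR j * Rabs (ln t) ^ pred j) <= rho * exp (rho * Rabs (ln t)))%R.
Proof.
intros Hr. destruct j as [|j].
- simpl INR. rewrite Rmult_0_l, Rmult_0_r. apply Rmult_le_pos; [exact Hr|left; apply exp_pos].
- simpl pred.
  replace (/ INR (fact (S j)) * rho ^ S j * (INR (S j) * Rabs (ln t) ^ j))%R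
    with (rho * (/ INR (fact j) * rho ^ j * Rabs (ln t) ^ j))%R.
  + apply Rmult_le_compat_l; [exact Hr|]. now apply log_weight_le.
  + rewrite fact_simpl, mult_INR. simpl pow. field.
    split; [apply INR_fact_neq_0|now apply not_0_INR].
Qed.

Lemma mellin_int_chasles (g : R -> C) (z : C) (p q r : R) :
  Ccont_on g p q -> Ccont_on g q r -> mellin_int g z p q + mellin_int g z q r = mellin_int g z p r.
Proof.
intros H1 H2. symmetry. apply is_Cint_unique.
apply (is_Cint_chasles _ p q r); now apply is_Cint_mellin_int.
Qed.

Lemma log_moment_chasles (g : R -> C) (j : nat) (z : C) (p q r : R) :
  Ccont_on g p q -> Ccont_on g q r -> log_moment g j z p q + log_moment g j z q r = log_moment g j z p r.
Proof.
intros H1 H2. unfold log_moment. rewrite <- Cmult_plus_distr_l. f_equal. symmetry. apply is_Cint_unique.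
apply (is_Cint_chasles _ p q r); now apply is_Cint_logpow.
Qed.

Lemma log_moment_swap (g : R -> C) (j : nat) (z : C) (p q : R) :
  Ccont_on g p q -> log_moment g j z q p = - log_moment g j z p q.
Proof.
intros H. unfold log_moment.
rewrite (is_Cint_unique _ q p _ (is_Cint_swap _ _ _ _ (is_Cint_logpow g j z p q H))). ring.
Qed.

Lemma log_moment_minus (g h : R -> C) (j : nat) (z : C) (p q : R) :
  Ccont_on g p q -> Ccont_on h p q ->
  log_moment (fun t => g t - h t) j z p q = log_moment g j z p q - log_moment h j z p q.
Proof.
intros Hg Hh. unfold log_moment.
assert (E : Cint (fun t => (g t - h t) * logpow j z t) p q =
  Cint (fun t => g t * logpow j z t) p q - Cint (fun t => h t * logpow j z t) p q).
{ apply is_Cint_unique.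
  apply (is_Cint_ext (fun t => g t * logpow j z t - h t * logpow j z t)); [intros; ring|].
  apply is_Cint_minus; now apply is_Cint_logpow. }
rewrite E. ring.
Qed.

Lemma exp_abs_ln_le (rho b t : R) :
  (0 <= rho)%R -> (0 < b <= t)%R ->
  (exp (rho * Rabs (ln t)) <= exp (2 * rho * Rabs (ln b)) * exp (rho * ln t))%R.
Proof.
intros Hr Hb. rewrite <- exp_plus. apply exp_le_mono.
assert (H : (ln b <= ln t)%R).
{ destruct (Rle_lt_or_eq_dec b t (proj2 Hb)) as [H|<-]; [left; apply ln_increasing; lra|lra]. }
assert (H2 : (Rabs (ln t) <= 2 * Rabs (ln b) + ln t)%R) by (unfold Rabs; repeat destruct Rcase_abs; lra).
apply Rmult_le_compat_l with (r := rho) in H2; [lra|exact Hr].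
Qed.

(** Bound for the boundary term and for the integral over [[b, oo)] that appear in the
    integration by parts; with [u = z - l0] and [d = Re u - rho], the weight
    [rho^j / j! (-ln t)^j t^(-u)] and its derivative are dominated by constant multiples of [t^(-d)] and [t^(-d-1)].  It depends neither on the
    interval nor on [j]. *)
Definition abel_const (b rho d : R) (u : C) : R :=
  (exp (2 * rho * Rabs (ln b)) * (1 + rho + Cmod u) * (exp (- d * ln b) * (1 + / d)))%R.

Lemma abel_const_pos (b rho d : R) (u : C) : (0 <= rho)%R -> (0 < d)%R -> (0 < abel_const b rho d u)%R.
Proof.
intros Hr Hd. unfold abel_const. pose proof (Cmod_ge_0 u).
assert (0 < / d)%R by (now apply Rinv_0_lt_compat).
repeat apply Rmult_lt_0_compat; try apply exp_pos; lra.
Qed.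

(** Abel summation: conditional convergence at abscissa [l0] controls the moments at [z],
    [Re z > l0], through integration by parts against the primitive of [k(t) t^(-l0)]. *)
Lemma log_moment_bound_abel (k : R -> C) (j : nat) (z : C) (l0 b p q lo hi rho d eta : R) :
  (0 < b <= p)%R -> (0 <= lo < p)%R -> (p <= q)%R -> (q < hi)%R ->
  (forall t, (lo < t < hi)%R -> Ccont k t) ->
  (0 <= rho)%R -> (0 < d)%R -> (Re z - l0 = d + rho)%R ->
  (forall s, (p <= s <= q)%R -> (Cmod (mellin_int k (RtoC l0) p s) <= eta)%R) ->
  (Cmod (log_moment k j z p q) * rho ^ j <= eta * abel_const b rho d (z - RtoC l0))%R.
Proof.
intros Hb Hlo Hpq Hhi Hk Hr Hd Hz Heta.
set (u := z - RtoC l0).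
assert (Hu : Re u = (d + rho)%R).
{ unfold u. change (Re (z - RtoC l0)) with (Re z + - l0)%R. lra. }
assert (Heta0 : (0 <= eta)%R).
{ eapply Rle_trans; [apply Cmod_ge_0|apply (Heta p); lra]. }
(* H is a primitive of h, and dpsi the derivative of the weight logpow j u *)
pose (h := fun t => k t * real_Cpow t (- RtoC l0)).
pose (H := fun s => mellin_int k (RtoC l0) p s).
pose (dpsi := fun t => RtoC (/ t) * (RtoC (- INR j * (- ln t) ^ pred j) * real_Cpow t (- u) - u * logpow j u t)).
assert (Hon : forall s, (lo < s < hi)%R -> Ccont_on k p s).
{ intros s Hs t Ht. split.
  - assert (Rmin p s > lo)%R by (apply Rmin_glb_lt; lra). lra.
  - apply Hk. assert (Rmin p s > lo)%R by (apply Rmin_glb_lt; lra).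
    assert (Rmax p s < hi)%R by (apply Rmax_lub_lt; lra). lra. }
assert (HH : forall s, (lo < s < hi)%R -> Cderiv H s (h s)).
{ intros s Hs. apply (is_derive_RInt (V := C_R_NormedModule) h H p s).
  - assert (He : (0 < Rmin (s - lo) (hi - s))%R) by (apply Rmin_pos; lra).
    exists (mkposreal _ He). intros t Ht. apply is_Cint_mellin_int, Hon.
    pose proof (Rmin_l (s - lo) (hi - s)). pose proof (Rmin_r (s - lo) (hi - s)).
    change (Rabs (t - s) < Rmin (s - lo) (hi - s))%R in Ht. apply Rabs_lt_between' in Ht. lra.
  - apply Ccont_mult; [now apply Hk|]. apply Ccont_real_Cpow. lra. }
assert (Hdpsi : forall t, (0 < t)%R -> Ccont dpsi t).
{ intros t Ht. apply Ccont_mult.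
  - apply Ccont_RtoC. apply (ex_derive_continuous (V := R_NormedModule)). auto_derive. lra.
  - apply Ccont_minus; apply Ccont_mult.
    + apply Ccont_RtoC. apply (ex_derive_continuous (V := R_NormedModule)). auto_derive. lra.
    + now apply Ccont_real_Cpow.
    + apply Ccont_const.
    + now apply Ccont_logpow. }
assert (Hparts : is_Cint (fun t => h t * logpow j u t + H t * dpsi t) p q
                    (H q * logpow j u q - H p * logpow j u p)).
{ apply (is_Cint_derive (fun t => H t * logpow j u t)); rewrite Rmin_left, Rmax_right by lra; intros t Ht.
  - apply Cderiv_mult; [apply HH; lra|]. apply Cderiv_logpow; lra.
  - apply Ccont_plus; apply Ccont_mult.
    + apply Ccont_mult; [apply Hk; lra|apply Ccont_real_Cpow; lra].
    + apply Ccont_logpow; lra.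
    + eapply Cderiv_cont, HH; lra.
    + apply Hdpsi; lra. }
assert (Hp0 : H p = 0).
{ apply is_Cint_unique. exact (is_RInt_point (V := C_R_NormedModule) _ p). }
rewrite Hp0 in Hparts.
assert (Hrest : is_Cint (fun t => H t * dpsi t) p q (Cint (fun t => H t * dpsi t) p q)).
{ apply is_Cint_cont. rewrite Rmin_left, Rmax_right by lra. intros t Ht.
  apply Ccont_mult; [eapply Cderiv_cont, HH; lra|apply Hdpsi; lra]. }
set (J := Cint (fun t => H t * dpsi t) p q) in *.
assert (Hmom : Cint (fun t => k t * logpow j z t) p q = H q * logpow j u q - J).
{ apply is_Cint_unique.
  replace (H q * logpow j u q - J) with (H q * logpow j u q - 0 * logpow j u p - J) by ring.
  generalize (is_Cint_minus _ _ _ _ _ _ Hparts Hrest). apply is_Cint_ext.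
  intros t _. unfold h, logpow.
  replace (- z) with (- RtoC l0 + - u) by (unfold u; ring). rewrite real_Cpow_plus. ring. }
pose (W := (/ INR (fact j) * rho ^ j)%R).
assert (HW : (0 <= W)%R).
{ apply Rmult_le_pos; [left; apply Rinv_0_lt_compat, INR_fact_lt_0|now apply pow_le]. }
pose (E := exp (2 * rho * Rabs (ln b))).
assert (HE : (0 < E)%R) by apply exp_pos.
assert (Hexp : forall t, (p <= t)%R ->
  (exp (- Re u * ln t) * exp (rho * Rabs (ln t)) <= E * exp (- d * ln t))%R).
{ intros t Ht. apply Rle_trans with (exp (- Re u * ln t) * (E * exp (rho * ln t)))%R.
  - apply Rmult_le_compat_l; [left; apply exp_pos|]. apply exp_abs_ln_le; lra.
  - right. replace (exp (- Re u * ln t) * (E * exp (rho * ln t)))%R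
      with (E * (exp (- Re u * ln t) * exp (rho * ln t)))%R by ring.
    rewrite <- exp_plus, Hu. do 2 f_equal. ring. }
assert (Hpsi : forall t, (p <= t)%R -> (W * Cmod (logpow j u t) <= E * exp (- d * ln t))%R).
{ intros t Ht. eapply Rle_trans; [|now apply Hexp].
  unfold logpow. rewrite Cmod_mult, Cmod_R, Cmod_real_Cpow, <- RPow_abs, Rabs_Ropp.
  change (Re (- u)) with (- Re u)%R.
  pose proof (log_weight_le rho t j Hr) as Hw. fold W in Hw.
  pose proof (exp_pos (- Re u * ln t)). nra. }
assert (Hdp : forall t, (p <= t)%R ->
   (W * Cmod (dpsi t) <= (rho + Cmod u) * E * (exp (- d * ln t) / t))%R).
{ intros t Ht. assert (Ht0 : (0 < / t)%R) by (apply Rinv_0_lt_compat; lra).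
  unfold dpsi. rewrite Cmod_mult, Cmod_R, Rabs_pos_eq by lra.
  assert (H1 : (W * Cmod (RtoC (- INR j * (- ln t) ^ pred j) * real_Cpow t (- u))%C
     <= rho * (E * exp (- d * ln t)))%R).
  { rewrite Cmod_mult, Cmod_R, Cmod_real_Cpow, Rabs_mult, <- RPow_abs, !Rabs_Ropp.
    rewrite (Rabs_pos_eq (INR j)) by apply pos_INR.
    change (Re (- u)) with (- Re u)%R.
    pose proof (log_weight_deriv_le rho t j Hr) as Hw. fold W in Hw.
    pose proof (exp_pos (- Re u * ln t)) as He.
    apply Rle_trans with (rho * (exp (- Re u * ln t) * exp (rho * Rabs (ln t))))%R.
    - apply Rmult_le_compat_r with (r := exp (- Re u * ln t)) in Hw; lra.
    - apply Rmult_le_compat_l; [exact Hr|now apply Hexp]. }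
  assert (H2 : (W * Cmod (u * logpow j u t) <= Cmod u * (E * exp (- d * ln t)))%R).
  { rewrite Cmod_mult. pose proof (Hpsi t Ht) as H3. pose proof (Cmod_ge_0 u).
    apply Rmult_le_compat_l with (r := Cmod u) in H3; lra. }
  set (A := (RtoC (- INR j * (- ln t) ^ pred j) * real_Cpow t (- u))%C) in *.
  set (B := (u * logpow j u t)%C) in *.
  pose proof (Cmod_triangle A (- B)) as H3. rewrite Cmod_opp in H3.
  replace (A + - B) with (A - B) in H3 by ring.
  apply Rmult_le_compat_l with (r := W) in H3; [|exact HW].
  unfold Rdiv. apply Rle_trans with (/ t * ((rho + Cmod u) * (E * exp (- d * ln t))))%R; [|right; ring].
  replace (W * (/ t * Cmod (A - B)%C))%R with (/ t * (W * Cmod (A - B)%C))%R by ring.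
  apply Rmult_le_compat_l; lra. }
pose (m := ((exp (- d * ln q) - exp (- d * ln p)) / (- d))%R).
assert (Hm : is_RInt (fun t => eta * ((rho + Cmod u) * E) * (exp (- d * ln t) / t))%R p q
   (eta * ((rho + Cmod u) * E) * m)%R).
{ apply (is_RInt_scal (V := R_NormedModule)). apply is_RInt_exp_ln; lra. }
assert (HJ : (Cmod (RtoC W * J) <= eta * ((rho + Cmod u) * E) * m)%R).
{ refine (is_Cint_bound _ _ p q _ _ Hpq _ (is_Cint_mult (RtoC W) _ _ _ _ Hrest) Hm).
  intros t Ht. rewrite !Cmod_mult, Cmod_R, Rabs_pos_eq by exact HW.
  pose proof (Hdp t (proj1 Ht)) as H1. pose proof (Heta t Ht) as H2. fold (H t) in H2.
  pose proof (Cmod_ge_0 (H t)). pose proof (Cmod_ge_0 (dpsi t)).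
  assert (H5 : (0 <= W * Cmod (dpsi t))%R) by (now apply Rmult_le_pos).
  replace (W * (Cmod (H t) * Cmod (dpsi t)))%R with (Cmod (H t) * (W * Cmod (dpsi t)))%R by ring.
  rewrite (Rmult_assoc eta). apply Rmult_le_compat; assumption. }
assert (Hmono : forall t, (b <= t)%R -> (exp (- d * ln t) <= exp (- d * ln b))%R).
{ intros t Ht. apply exp_le_mono.
  assert (ln b <= ln t)%R.
  { destruct (Rle_lt_or_eq_dec b t Ht) as [H1|<-]; [left; apply ln_increasing; lra|lra]. }
  nra. }
assert (Hm1 : (m <= exp (- d * ln b) * / d)%R).
{ unfold m. replace ((exp (- d * ln q) - exp (- d * ln p)) / - d)%R
    with ((exp (- d * ln p) - exp (- d * ln q)) * / d)%R by (field; lra).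
  apply Rmult_le_compat_r; [left; now apply Rinv_0_lt_compat|].
  pose proof (exp_pos (- d * ln q)). pose proof (Hmono p (proj2 Hb)). lra. }
replace (Cmod (log_moment k j z p q) * rho ^ j)%R with (Cmod (RtoC W * (H q * logpow j u q) - RtoC W * J)).
2:{ unfold log_moment. rewrite Hmom. replace (RtoC W * (H q * logpow j u q) - RtoC W * J)
      with (RtoC W * (H q * logpow j u q - J)) by ring.
    rewrite !Cmod_mult, !Cmod_R. rewrite (Rabs_pos_eq W HW). rewrite Rabs_pos_eq.
    - unfold W. ring.
    - left; apply Rinv_0_lt_compat, INR_fact_lt_0. }
assert (H1 : (Cmod (RtoC W * (H q * logpow j u q)) <= eta * (E * exp (- d * ln b)))%R).
{ rewrite !Cmod_mult, Cmod_R, Rabs_pos_eq by exact HW.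
  pose proof (Hpsi q Hpq) as H1. pose proof (Heta q ltac:(lra)) as H2. fold (H q) in H2.
  pose proof (Cmod_ge_0 (logpow j u q)).
  replace (W * (Cmod (H q) * Cmod (logpow j u q)))%R with (Cmod (H q) * (W * Cmod (logpow j u q)))%R by ring.
  apply Rmult_le_compat; [apply Cmod_ge_0|now apply Rmult_le_pos|exact H2|].
  eapply Rle_trans; [exact H1|]. apply Rmult_le_compat_l; [lra|]. apply Hmono. lra. }
pose proof (Cmod_triangle (RtoC W * (H q * logpow j u q)) (- (RtoC W * J))) as H2. rewrite Cmod_opp in H2.
change (RtoC W * (H q * logpow j u q) + - (RtoC W * J)) with (RtoC W * (H q * logpow j u q) - RtoC W * J) in H2.
pose proof (Cmod_ge_0 u) as Hu0.
assert (H3 : (eta * ((rho + Cmod u) * E) * m <= eta * ((rho + Cmod u) * E) * (exp (- d * ln b) * / d))%R).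
{ apply Rmult_le_compat_l; [|exact Hm1]. repeat apply Rmult_le_pos; lra. }
unfold abel_const. fold E.
pose proof (exp_pos (- d * ln b)) as He.
assert (Hid : (0 < / d)%R) by (now apply Rinv_0_lt_compat).
assert (H4 : (eta * ((rho + Cmod u) * E) * (exp (- d * ln b) * / d) + eta * (E * exp (- d * ln b))
   <= eta * (E * (1 + rho + Cmod u) * (exp (- d * ln b) * (1 + / d))))%R).
{ replace (eta * (E * (1 + rho + Cmod u) * (exp (- d * ln b) * (1 + / d))))%R
    with (eta * ((rho + Cmod u) * E) * (exp (- d * ln b) * / d) + eta * (E * exp (- d * ln b))
          + eta * (E * exp (- d * ln b)) * (/ d + rho + Cmod u))%R by ring.
  assert (0 <= eta * (E * exp (- d * ln b)) * (/ d + rho + Cmod u))%R; [|lra].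
  repeat apply Rmult_le_pos; lra. }
lra.
Qed.

(** * Truncated integrals [p -> 0], [q -> a] *)

Definition ends (a : Rbar) : (R * R -> Prop) -> Prop :=
  filter_prod (at_right 0) (within (fun t : R => Rbar_lt t a) (Rbar_locally a)).

Lemma within_left_spec (a : Rbar) (b : R) (Q : R -> Prop) :
  Rbar_lt b a ->
  within (fun t : R => Rbar_lt t a) (Rbar_locally a) Q <->
  exists q0 : R, (b <= q0)%R /\ Rbar_lt q0 a /\ forall q : R, (q0 < q)%R -> Rbar_lt q a -> Q q.
Proof.
intros Hb. unfold within. destruct a as [a| |]; simpl in Hb; [| |contradiction].
- split.
  + intros [e He]. exists (Rmax b (a - e)). pose proof (cond_pos e) as He0.
    split; [apply Rmax_l|]. split; [simpl; apply Rmax_lub_lt; lra|].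
    intros q Hq Hqa. simpl in Hqa. apply He; [|exact Hqa].
    change (Rabs (q - a) < e)%R. pose proof (Rmax_r b (a - e)).
    rewrite Rabs_left; lra.
  + intros [q0 [_ [Hq0 H]]]. simpl in Hq0.
    assert (He : (0 < a - q0)%R) by lra. exists (mkposreal _ He).
    intros q Hq Hqa. change (Rabs (q - a) < a - q0)%R in Hq. apply Rabs_lt_between' in Hq.
    apply H; [lra|exact Hqa].
- split.
  + intros [M HM]. exists (Rmax b M). split; [apply Rmax_l|]. split; [exact I|].
    intros q Hq _. apply HM; [|exact I]. pose proof (Rmax_r b M). lra.
  + intros [q0 [_ [_ H]]]. exists q0. intros q Hq _. now apply H.
Qed.

(** The number [b] separates the two ends, so that eventually [p < b < q]. *)
Lemma ends_spec (a : Rbar) (b : R) (P : R * R -> Prop) :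
  (0 < b)%R -> Rbar_lt b a ->
  ends a P <->
  exists p0 q0 : R, (0 < p0 <= b)%R /\ (b <= q0)%R /\ Rbar_lt q0 a /\
    forall p q : R, (0 < p < p0)%R -> (q0 < q)%R -> Rbar_lt q a -> P (p, q).
Proof.
intros Hb Hba. split.
- intros [Q S HQ HS H]. destruct HQ as [e He].
  apply (within_left_spec a b) in HS; [|exact Hba]. destruct HS as [q0 [Hq0 [Hq0a HS]]].
  pose proof (cond_pos e) as He0.
  exists (Rmin b e), q0. split; [split; [now apply Rmin_pos|apply Rmin_l]|].
  split; [exact Hq0|]. split; [exact Hq0a|]. intros p q Hp Hq Hqa. apply H; [|now apply HS].
  apply He; [|lra]. change (Rabs (p - 0) < e)%R. pose proof (Rmin_r b e).
  rewrite Rminus_0_r, Rabs_pos_eq; lra.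
- intros [p0 [q0 [Hp0 [Hq0 [Hq0a H]]]]].
  apply (Filter_prod _ _ _ (fun p => 0 < p < p0)%R (fun q => (q0 < q)%R /\ Rbar_lt q a)).
  + exists (mkposreal p0 (proj1 Hp0)). intros p Hp Hp0'. change (Rabs (p - 0) < p0)%R in Hp.
    rewrite Rminus_0_r, Rabs_pos_eq in Hp; lra.
  + apply (within_left_spec a b _ Hba). exists q0. auto.
  + intros p q Hp [Hq Hqa]. now apply H.
Qed.

Lemma Rbar_between (b : R) (a : Rbar) : Rbar_lt b a -> exists c : R, (b < c)%R /\ Rbar_lt c a.
Proof.
destruct a as [a| |]; simpl; intros H; [| |contradiction].
- exists ((a + b) / 2)%R. split; lra.
- exists (b + 1)%R. split; [lra|exact I].
Qed.

Lemma ends_proper (a : Rbar) : Rbar_lt 0%R a -> ProperFilter (ends a).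
Proof.
intros Ha. destruct (Rbar_between 0 a Ha) as [b [Hb Hba]]. constructor.
- intros P HP. apply (ends_spec a b P Hb Hba) in HP.
  destruct HP as [p0 [q0 [Hp0 [Hq0 [Hq0a H]]]]].
  destruct (Rbar_between q0 a Hq0a) as [q [Hq Hqa]].
  exists (p0 / 2, q)%R. apply H; [lra|exact Hq|exact Hqa].
- apply filter_prod_filter; [apply within_filter, locally_filter|].
  apply within_filter, Rbar_locally_filter.
Qed.

Notation tends F u l := (filterlim (U := C_UniformSpace) u F (locally (T := C_UniformSpace) l)).

Lemma tends_Cmod {T : Type} (F : (T -> Prop) -> Prop) (u : T -> C) (l : C) :
  Filter F ->
  tends F u l <-> forall e : R, (0 < e)%R -> F (fun x => (Cmod (u x - l) < e)%R).
Proof.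
intros HF. split.
- intros H e He. apply (H (fun w => Cmod (w - l) < e)%R). apply locally_Cmod. exists e; auto.
- intros H P HP. apply (proj1 (locally_Cmod l P)) in HP. destruct HP as [r [Hr HP]].
  unfold filtermap. generalize (H r Hr). apply filter_imp. intros x Hx. now apply HP.
Qed.

Lemma tends_unique {T : Type} (F : (T -> Prop) -> Prop) (u : T -> C) (l m : C) :
  ProperFilter F -> tends F u l -> tends F u m -> l = m.
Proof. intros HF H1 H2. exact (filterlim_locally_unique (V := C_NormedModule) u l m H1 H2). Qed.

Lemma tends_ext {T : Type} (F : (T -> Prop) -> Prop) (u v : T -> C) (l : C) :
  Filter F -> F (fun x => u x = v x) -> tends F u l -> tends F v l.
Proof. intros HF H. apply filterlim_ext_loc. exact H. Qed.

Lemma tends_plus {T : Type} (F : (T -> Prop) -> Prop) (u v : T -> C) (l m : C) :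
  Filter F -> tends F u l -> tends F v m -> tends F (fun x => u x + v x) (l + m).
Proof.
intros HF Hu Hv.
exact (filterlim_comp_2 (G := locally (T := C_UniformSpace) l) (H := locally (T := C_UniformSpace) m)
   (FF := HF) u v Cplus Hu Hv (filterlim_plus (V := C_NormedModule) l m)).
Qed.

Lemma tends_scal {T : Type} (F : (T -> Prop) -> Prop) (c : C) (u : T -> C) (l : C) :
  Filter F -> tends F u l -> tends F (fun x => c * u x) (c * l).
Proof.
intros HF Hu. exact (filterlim_comp _ _ _ u (fun x => c * x) F _ _ Hu (filterlim_scal_r (V := C_NormedModule) c l)).
Qed.

(** Completeness for the norm [sup_j |u_j| rho^j]: each coefficient converges because [C] is
    complete, and the estimates, being uniform in [j], pass to the limit. *)
Lemma weighted_complete {T : Type} (F : (T -> Prop) -> Prop) (u : nat -> T -> C) (rho : R) :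
  ProperFilter F -> (0 < rho)%R ->
  (forall eta : R, (0 < eta)%R -> exists P, F P /\
     forall x y, P x -> P y -> forall j, (Cmod (u j x - u j y) * rho ^ j <= eta)%R) ->
  exists v : nat -> C, forall eta : R, (0 < eta)%R ->
    F (fun x => forall j, (Cmod (u j x - v j) * rho ^ j <= eta)%R).
Proof.
intros HF Hr HC.
exists (fun j => lim (T := C_CompleteNormedModule) (filtermap (u j) F)).
assert (Hv : forall j, tends F (u j) (lim (T := C_CompleteNormedModule) (filtermap (u j) F))).
{ intros j P [e He]. unfold filtermap at 1.
  assert (HPF : ProperFilter (filtermap (u j) F)) by (apply filtermap_proper_filter, HF).
  assert (Hc : cauchy (T := C_CompleteNormedModule) (filtermap (u j) F)).
  { intros e2. pose proof (cond_pos e2) as He2. assert (Hrj : (0 < rho ^ j)%R) by (now apply pow_lt).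
    assert (Hm : (0 < e2 * rho ^ j / 2)%R) by (apply Rdiv_lt_0_compat; [apply Rmult_lt_0_compat|]; lra).
    destruct (HC _ Hm) as [Q [HQ HQ2]].
    destruct (filter_ex _ HQ) as [x0 Hx0]. exists (u j x0). unfold filtermap.
    revert HQ. apply filter_imp. intros x Hx. apply C_NormedModule_mixin_compat1.
    change (Cmod (u j x - u j x0) < e2)%R.
    specialize (HQ2 x x0 Hx Hx0 j).
    apply Rmult_lt_reg_r with (rho ^ j)%R; [exact Hrj|].
    eapply Rle_lt_trans; [exact HQ2|]. assert (0 < e2 * rho ^ j)%R by (now apply Rmult_lt_0_compat). lra. }
  pose proof (complete_cauchy (T := C_CompleteNormedModule) _ HPF Hc e) as H.
  revert H. unfold filtermap. apply filter_imp. intros x Hx. now apply He. }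
intros eta Heta. destruct (HC eta Heta) as [P [HP H]].
generalize HP. apply filter_imp. intros x Hx j.
apply Rnot_lt_le. intros Hlt.
assert (Hrj : (0 < rho ^ j)%R) by (now apply pow_lt).
set (v := lim (T := C_CompleteNormedModule) (filtermap (u j) F)) in *.
pose (e := ((Cmod (u j x - v) * rho ^ j - eta) / rho ^ j)%R).
assert (He : (0 < e)%R) by (apply Rdiv_lt_0_compat; lra).
pose proof (proj1 (tends_Cmod F (u j) v _) (Hv j) e He) as Hy.
destruct (filter_ex _ (filter_and _ _ HP Hy)) as [y [Hy1 Hy2]].
specialize (H x y Hx Hy1 j).
pose proof (Cmod_triangle (u j x - u j y) (u j y - v)) as Ht.
replace (u j x - u j y + (u j y - v)) with (u j x - v) in Ht by ring.
apply Rmult_le_compat_r with (r := (rho ^ j)%R) in Ht; [|lra].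
apply Rmult_lt_compat_r with (r := (rho ^ j)%R) in Hy2; [|lra].
replace (e * rho ^ j)%R with (Cmod (u j x - v) * rho ^ j - eta)%R in Hy2 by (unfold e; field; lra).
lra.
Qed.

Lemma weighted_tends {T : Type} (F : (T -> Prop) -> Prop) (u : nat -> T -> C) (v : nat -> C) (rho : R) (j : nat) :
  Filter F -> (0 < rho)%R ->
  (forall eta : R, (0 < eta)%R -> F (fun x => forall i, (Cmod (u i x - v i) * rho ^ i <= eta)%R)) ->
  tends F (u j) (v j).
Proof.
intros HF Hr H. apply tends_Cmod; [exact HF|]. intros e He.
assert (Hrj : (0 < rho ^ j)%R) by (now apply pow_lt).
assert (Hm : (0 < e * rho ^ j / 2)%R) by (apply Rdiv_lt_0_compat; [apply Rmult_lt_0_compat|]; lra).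
generalize (H _ Hm). apply filter_imp. intros x Hx. specialize (Hx j).
apply Rmult_lt_reg_r with (rho ^ j)%R; [exact Hrj|].
eapply Rle_lt_trans; [exact Hx|]. assert (0 < e * rho ^ j)%R by (now apply Rmult_lt_0_compat). lra.
Qed.

(** Weierstrass' theorem in terms of coefficients: at [w], the difference of the two series is
    dominated by [eta] times the geometric series of ratio [|w| / rho]. *)
Lemma weighted_power_series {T : Type} (F : (T -> Prop) -> Prop) (u : nat -> T -> C) (v : nat -> C)
  (rho M : R) (Phi : T -> C) (w : C) :
  Filter F -> (0 < rho)%R -> (Cmod w < rho)%R ->
  (forall eta : R, (0 < eta)%R -> F (fun x => forall j, (Cmod (u j x - v j) * rho ^ j <= eta)%R)) ->
  (forall j, Cmod (v j) * rho ^ j <= M)%R ->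
  F (fun x => Csum (fun j => u j x * w ^ j) (Phi x)) ->
  exists S : C, Csum (fun j => v j * w ^ j) S /\ tends F Phi S.
Proof.
intros HF Hr Hw Huv HM HPhi.
pose proof (Cmod_ge_0 w) as Hw0.
pose (q := (Cmod w / rho)%R).
assert (Hq : (0 <= q < 1)%R).
{ unfold q. split.
  - apply Rmult_le_pos; [exact Hw0|left; now apply Rinv_0_lt_compat].
  - apply Rmult_lt_reg_r with rho; [exact Hr|]. unfold Rdiv. rewrite Rmult_assoc, Rinv_l; lra. }
assert (Hbound : forall (x : C) (B : R) j, (Cmod x * rho ^ j <= B)%R -> (Cmod (x * w ^ j) <= B * q ^ j)%R).
{ intros x B j HB. rewrite Cmod_mult, Cmod_pow.
  assert (Hrj : (0 < rho ^ j)%R) by (now apply pow_lt).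
  replace (Cmod w ^ j)%R with (rho ^ j * q ^ j)%R.
  - rewrite <- Rmult_assoc. apply Rmult_le_compat_r; [apply pow_le; lra|exact HB].
  - rewrite <- Rpow_mult_distr. f_equal. unfold q. field. lra. }
destruct (Csum_dominated (fun j => v j * w ^ j) (fun j => M * q ^ j)%R) as [S HS].
- intros j. now apply Hbound.
- assert (Hq1 : (Rabs q < 1)%R) by (rewrite Rabs_pos_eq; lra).
  exact (ex_series_scal_l (K := R_AbsRing) M _ (ex_series_geom q Hq1)).
- exists S. split; [exact HS|].
  apply tends_Cmod; [exact HF|]. intros e He.
  assert (Heta : (0 < e * (1 - q) / 2)%R) by (apply Rdiv_lt_0_compat; [apply Rmult_lt_0_compat|]; lra).
  generalize (filter_and _ _ HPhi (Huv _ Heta)). apply filter_imp. intros x [H1 H2].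
  pose proof (Csum_minus _ _ _ _ H1 HS) as H3.
  assert (Hg : is_series (fun j => e * (1 - q) / 2 * q ^ j)%R (e * (1 - q) / 2 * / (1 - q))%R).
  { assert (Hq1 : (Rabs q < 1)%R) by (rewrite Rabs_pos_eq; lra).
    exact (is_series_scal_l (K := R_AbsRing) (e * (1 - q) / 2)%R _ _ (is_series_geom q Hq1)). }
  assert (H4 : (Cmod (Phi x - S) <= e * (1 - q) / 2 * / (1 - q))%R).
  { refine (Csum_le _ _ _ _ _ H3 Hg). intros j. cbv beta.
    replace (u j x * w ^ j - v j * w ^ j) with ((u j x - v j) * w ^ j) by ring.
    apply Hbound, H2. }
  replace (e * (1 - q) / 2 * / (1 - q))%R with (e / 2)%R in H4 by (field; lra). lra.
Qed.

(** * Convergence of the truncated transforms *)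

Definition taylor (c : nat -> C) (N : nat) (t : R) : C := psum (fun i => c i * RtoC t ^ i) N.

Lemma Ccont_taylor (c : nat -> C) (N : nat) (t : R) : Ccont (taylor c N) t.
Proof.
unfold taylor. induction N as [|N IH]; [apply Ccont_const|]. simpl.
apply Ccont_plus; [exact IH|]. apply Ccont_mult; [apply Ccont_const|].
apply (continuous_ext (fun t => RtoC (t ^ N))); [intros; apply RtoC_pow|].
apply Ccont_RtoC. apply (ex_derive_continuous (V := R_NormedModule)). auto_derive. trivial.
Qed.

(** The consequences of membership in the class from which the continuation is built; [c] are
    the Taylor coefficients at [0] of the complex extension. *)
Record mellin_data (a d : Rbar) (k : R -> C) (c : nat -> C) : Prop := {
  md_pos : Rbar_lt 0%R a;
  md_cont : forall t : R, (0 < t)%R -> Rbar_lt t a -> Ccont k t;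
  md_taylor : forall N, exists b M, (0 < b <= 1)%R /\ Rbar_lt b a /\
    forall t, (0 < t <= b)%R -> (Cmod (k t - taylor c N t) <= M * t ^ N)%R;
  md_d : Rbar_lt d 1%R;
  md_strip : forall z : C, Rbar_lt d (Re z) -> (Re z < 1)%R -> exists l, is_mellin a k z l }.

Definition trunc_coef (k : R -> C) (c : nat -> C) (N : nat) (z : C) (j : nat) (x : R * R) : C :=
  log_moment k j z (fst x) (snd x) - log_moment (taylor c N) j z (fst x) 1.

(** The Taylor polynomial is subtracted on [(0, 1)] only, whatever [a] is: on this interval
    its Mellin integral is, for [Re z < 1], the sum of the simple fractions
    [c_j / (j + 1 - z)]. *)
Definition trunc (k : R -> C) (c : nat -> C) (N : nat) (z : C) (x : R * R) : C :=
  mellin_int k z (fst x) (snd x) - mellin_int (taylor c N) z (fst x) 1.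

Lemma Ccont_on_taylor (c : nat -> C) (N : nat) (p q : R) :
  (0 < p)%R -> (0 < q)%R -> Ccont_on (taylor c N) p q.
Proof.
intros Hp Hq t Ht. split; [|apply Ccont_taylor].
assert (0 < Rmin p q)%R by (now apply Rmin_pos). lra.
Qed.

Lemma Rbar_le_lt (x y : R) (a : Rbar) : (x <= y)%R -> Rbar_lt y a -> Rbar_lt x a.
Proof. intros Hxy Hy. apply (Rbar_le_lt_trans x y a); [exact Hxy|exact Hy]. Qed.

Lemma Ccont_on_data (a d : Rbar) (k : R -> C) (c : nat -> C) (p q : R) :
  mellin_data a d k c -> (0 < p)%R -> (0 < q)%R -> Rbar_lt p a -> Rbar_lt q a -> Ccont_on k p q.
Proof.
intros H Hp Hq Hpa Hqa t Ht.
assert (Ht0 : (0 < t)%R) by (assert (0 < Rmin p q)%R by (now apply Rmin_pos); lra).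
split; [exact Ht0|]. apply (md_cont _ _ _ _ H t Ht0).
destruct (Rle_dec p q) as [H1|H1].
- rewrite Rmax_right in Ht by exact H1. apply (Rbar_le_lt t q); [lra|exact Hqa].
- rewrite Rmax_left in Ht by lra. apply (Rbar_le_lt t p); [lra|exact Hpa].
Qed.

Lemma trunc_expansion (a d : Rbar) (k : R -> C) (c : nat -> C) (N : nat) (z w : C) (p q : R) :
  mellin_data a d k c -> (0 < p <= 1)%R -> (p <= q)%R -> Rbar_lt q a ->
  Csum (fun j => trunc_coef k c N z j (p, q) * w ^ j) (trunc k c N (z + w) (p, q)).
Proof.
intros H Hp Hpq Hqa. unfold trunc_coef, trunc. simpl fst. simpl snd.
apply (Csum_ext (fun j => log_moment k j z p q * w ^ j - log_moment (taylor c N) j z p 1 * w ^ j)).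
- intros j. ring.
- apply Csum_minus; apply mellin_int_expansion; try lra.
  + apply (Ccont_on_data a d k c); try assumption; try lra. now apply (Rbar_le_lt p q).
  + apply Ccont_on_taylor; lra.
Qed.

(** For integrands that are continuous inside the interval, the improper integral is the limit
    of the integrals over compact intervals as total functions. *)
Lemma is_mellin_tends (a : Rbar) (k : R -> C) (z l : C) :
  (forall p q : R, (0 < p)%R -> (0 < q)%R -> Rbar_lt p a -> Rbar_lt q a -> Ccont_on k p q) ->
  Rbar_lt 0%R a ->
  is_mellin a k z l <-> tends (ends a) (fun x => mellin_int k z (fst x) (snd x)) l.
Proof.
intros Hk Ha. destruct (Rbar_between 0 a Ha) as [b [Hb Hba]].
assert (Hev : ends a (fun x => is_Cint (fun t => k t * real_Cpow t (- z)) (fst x) (snd x)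
                       (mellin_int k z (fst x) (snd x)))).
{ apply (ends_spec a b _ Hb Hba). exists b, b. repeat split; try lra; [exact Hba|].
  intros p q Hp Hq Hqa. simpl. apply is_Cint_mellin_int, Hk; try assumption; try lra.
  apply (Rbar_le_lt p q); [lra|exact Hqa]. }
pose proof (ends_proper a Ha) as HF.
split.
- intros H P HP. unfold filtermap. generalize (filter_and _ _ Hev (H P HP)). apply filter_imp.
  intros x [H1 [y [H2 H3]]].
  replace (mellin_int k z (fst x) (snd x)) with y; [exact H3|].
  symmetry. now apply is_Cint_unique.
- intros H P HP. unfold filtermapi. generalize (filter_and _ _ Hev (H P HP)). apply filter_imp.
  intros x [H1 H2]. exists (mellin_int k z (fst x) (snd x)). split; assumption.
Qed.

Lemma exp_ln_small (d e : R) :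
  (0 < d)%R -> (0 < e)%R ->
  exists p0, (0 < p0)%R /\ forall p, (0 < p < p0)%R -> (exp (d * ln p) < e)%R.
Proof.
intros Hd He. exists (exp (ln e / d)). split; [apply exp_pos|].
intros p [Hp Hp0]. rewrite <- (exp_ln e) by exact He. apply exp_increasing.
apply ln_increasing in Hp0; [|exact Hp]. rewrite ln_exp in Hp0.
apply Rmult_lt_compat_l with (r := d) in Hp0; [|exact Hd].
replace (d * (ln e / d))%R with (ln e) in Hp0 by (field; lra). exact Hp0.
Qed.

(** Cauchy criterion at the end [a], the form in which conditional convergence enters the
    estimates. *)
Lemma mellin_int_tail_small (a d : Rbar) (k : R -> C) (c : nat -> C) (z l : C) (b eta : R) :
  mellin_data a d k c -> is_mellin a k z l -> (0 < b)%R -> Rbar_lt b a -> (0 < eta)%R ->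
  exists q0 : R, (b <= q0)%R /\ Rbar_lt q0 a /\
    forall q s : R, (q0 < q <= s)%R -> Rbar_lt s a -> (Cmod (mellin_int k z q s) <= eta)%R.
Proof.
intros H Hl Hb Hba Heta. pose proof (md_pos _ _ _ _ H) as Ha.
pose proof (ends_proper a Ha) as HF.
apply (is_mellin_tends a k z l (fun p q Hp Hq => Ccont_on_data a d k c p q H Hp Hq) Ha) in Hl.
assert (Heta2 : (0 < eta / 2)%R) by lra.
pose proof (proj1 (tends_Cmod _ _ _ _) Hl (eta / 2)%R Heta2) as He.
apply (ends_spec a b _ Hb Hba) in He. destruct He as [p0 [q0 [Hp0 [Hq0 [Hq0a He]]]]].
exists q0. split; [exact Hq0|]. split; [exact Hq0a|]. intros q s Hqs Hsa.
assert (Hqa : Rbar_lt q a) by (apply (Rbar_le_lt q s); [lra|exact Hsa]).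
pose proof (He (p0 / 2)%R q ltac:(lra) ltac:(lra) Hqa) as H1.
pose proof (He (p0 / 2)%R s ltac:(lra) ltac:(lra) Hsa) as H2. simpl in H1, H2.
assert (Hpa : Rbar_lt (p0 / 2)%R a) by (apply (Rbar_le_lt _ b); [lra|exact Hba]).
rewrite <- (mellin_int_chasles k z (p0 / 2) q s) in H2;
  try (apply (Ccont_on_data a d k c); try assumption; lra).
set (A := mellin_int k z (p0 / 2) q) in *. set (B := mellin_int k z q s) in *.
replace B with ((A + B - l) + - (A - l)) by ring.
eapply Rle_trans; [apply Cmod_triangle|]. rewrite Cmod_opp. lra.
Qed.

Lemma Rbar_below (d : Rbar) (x : R) :
  Rbar_lt d x -> exists y : R, Rbar_lt d y /\ (y < x)%R.
Proof.
destruct d as [d| |]; simpl; intros H; [| contradiction|].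
- exists ((d + x) / 2)%R. split; lra.
- exists (x - 1)%R. split; [exact I|lra].
Qed.

(** When the interval changes, a coefficient changes by a moment of [k] minus its Taylor
    polynomial near [0] and a moment of [k] near [a].  The radius [rho] is half of the distance
    from [Re z] to the nearer of [N + 1] and an abscissa [l0] of the strip, which leaves room
    for the factor [exp (rho |ln t|)] at either end. *)
Lemma trunc_coef_cauchy (a d : Rbar) (k : R -> C) (c : nat -> C) (N : nat) (z : C) :
  mellin_data a d k c -> Rbar_lt d (Re z) -> (Re z < INR N + 1)%R ->
  exists rho, (0 < rho)%R /\ forall eta : R, (0 < eta)%R ->
    exists P, ends a P /\ forall x y, P x -> P y ->
      forall j, (Cmod (trunc_coef k c N z j x - trunc_coef k c N z j y) * rho ^ j <= eta)%R.
Proof.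
intros H Hdz HzN.
destruct (Rbar_below d (Rmin (Re z) 1)) as [l0 [Hdl0 Hl0]].
{ unfold Rmin. destruct Rle_dec; [exact Hdz|exact (md_d _ _ _ _ H)]. }
pose proof (Rmin_l (Re z) 1) as Hm1. pose proof (Rmin_r (Re z) 1) as Hm2.
destruct (md_strip _ _ _ _ H (RtoC l0)) as [l Hl]; [exact Hdl0|simpl; lra|].
pose (rho := (Rmin (INR N + 1 - Re z) (Re z - l0) / 2)%R).
assert (Hrho : (0 < rho)%R) by (unfold rho; assert (0 < Rmin (INR N + 1 - Re z) (Re z - l0))%R by (apply Rmin_pos; lra); lra).
assert (Hrho1 : (2 * rho <= INR N + 1 - Re z)%R) by (unfold rho; pose proof (Rmin_l (INR N + 1 - Re z) (Re z - l0)); lra).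
assert (Hrho2 : (2 * rho <= Re z - l0)%R) by (unfold rho; pose proof (Rmin_r (INR N + 1 - Re z) (Re z - l0)); lra).
exists rho. split; [exact Hrho|]. intros eta Heta.
destruct (md_taylor _ _ _ _ H N) as [b [M [Hb [Hba HM]]]].
set (d0 := (INR N + 1 - rho - Re z)%R). assert (Hd0 : (0 < d0)%R) by (unfold d0; lra).
set (d1 := (Re z - l0 - rho)%R). assert (Hd1 : (0 < d1)%R) by (unfold d1; lra).
assert (HM0 : (0 <= M)%R).
{ assert (Hbp : (0 < b ^ N)%R) by (apply pow_lt; lra).
  pose proof (HM b ltac:(lra)) as H1. pose proof (Cmod_ge_0 (k b - taylor c N b)). nra. }
destruct (exp_ln_small d0 (eta / 2 * d0 / (M + 1)) Hd0) as [e0 [He0 Hsmall]].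
{ apply Rdiv_lt_0_compat; [|lra]. apply Rmult_lt_0_compat; lra. }
set (A := abel_const b rho d1 (z - RtoC l0)).
assert (HA : (0 < A)%R) by (apply abel_const_pos; lra).
destruct (mellin_int_tail_small a d k c (RtoC l0) l b (eta / 2 / A) H Hl ltac:(lra) Hba) as [q0 [Hq0 [Hq0a Htail]]].
{ apply Rdiv_lt_0_compat; lra. }
pose (p0 := Rmin b e0).
assert (Hp0 : (0 < p0 <= b /\ p0 <= e0)%R).
{ unfold p0. split; [split|]; [apply Rmin_pos; lra|apply Rmin_l|apply Rmin_r]. }
exists (fun x => (0 < fst x < p0)%R /\ (q0 < snd x)%R /\ Rbar_lt (snd x) a).
split.
{ apply (ends_spec a b _ ltac:(lra) Hba). exists p0, q0.
  split; [lra|]. split; [lra|]. split; [exact Hq0a|]. intros p q Hp Hq Hqa. simpl. auto. }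
assert (Hzero : forall p p' j, (0 < p < p0)%R -> (0 < p' < p0)%R ->
   (Cmod (log_moment k j z p p' - log_moment (taylor c N) j z p p') * rho ^ j <= eta / 2)%R).
{ assert (Hle : forall p p' j, (0 < p < p0)%R -> (0 < p' < p0)%R -> (p <= p')%R ->
   (Cmod (log_moment k j z p p' - log_moment (taylor c N) j z p p') * rho ^ j <= eta / 2)%R).
  { intros p p' j Hp Hp' Hpp.
    assert (Hpa : Rbar_lt p a) by (apply (Rbar_le_lt p b); [lra|exact Hba]).
    assert (Hpa' : Rbar_lt p' a) by (apply (Rbar_le_lt p' b); [lra|exact Hba]).
    assert (Hk : Ccont_on k p p') by (apply (Ccont_on_data a d k c); try assumption; lra).
    assert (Ht : Ccont_on (taylor c N) p p') by (apply Ccont_on_taylor; lra).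
    rewrite <- log_moment_minus by assumption.
    eapply Rle_trans.
    - apply (log_moment_bound_zero (fun t => k t - taylor c N t) j N z p p' rho M b); try lra.
      + intros t Ht0. now apply HM.
      + intros t Htt. destruct (Hk t Htt) as [T1 T2]. split; [exact T1|].
        apply Ccont_minus; [exact T2|apply Ccont_taylor].
    - fold d0. pose proof (Hsmall p' ltac:(lra)) as Hs. pose proof (exp_pos (d0 * ln p')) as Hs0.
      apply Rmult_lt_compat_r with (r := ((M + 1) / d0)%R) in Hs; [|apply Rdiv_lt_0_compat; lra].
      replace (eta / 2 * d0 / (M + 1) * ((M + 1) / d0))%R with (eta / 2)%R in Hs by (field; lra).
      apply Rle_trans with (exp (d0 * ln p') * ((M + 1) / d0))%R; [|lra].
      rewrite Rmult_comm. apply Rmult_le_compat_l; [lra|].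
      apply Rmult_le_compat_r; [left; now apply Rinv_0_lt_compat|lra]. }
  intros p p' j Hp Hp'. destruct (Rle_dec p p') as [Hpp|Hpp]; [now apply Hle|].
  assert (Hpa : Rbar_lt p a) by (apply (Rbar_le_lt p b); [lra|exact Hba]).
  assert (Hpa' : Rbar_lt p' a) by (apply (Rbar_le_lt p' b); [lra|exact Hba]).
  rewrite (log_moment_swap k j z p' p), (log_moment_swap (taylor c N) j z p' p).
  - replace (- log_moment k j z p' p - - log_moment (taylor c N) j z p' p)
      with (- (log_moment k j z p' p - log_moment (taylor c N) j z p' p)) by ring.
    rewrite Cmod_opp. apply Hle; lra.
  - apply Ccont_on_taylor; lra.
  - apply (Ccont_on_data a d k c); try assumption; lra. }
assert (Hfar : forall q q' j, (q0 < q)%R -> Rbar_lt q a -> (q0 < q')%R -> Rbar_lt q' a ->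
   (Cmod (log_moment k j z q q') * rho ^ j <= eta / 2)%R).
{ assert (Hle : forall q q' j, (q0 < q)%R -> (q <= q')%R -> Rbar_lt q' a ->
   (Cmod (log_moment k j z q q') * rho ^ j <= eta / 2)%R).
  { intros q q' j Hq Hqq Hqa'.
    destruct (Rbar_between q' a Hqa') as [hi [Hhi Hhia]].
    replace (eta / 2)%R with (eta / 2 / A * A)%R by (field; lra).
    apply (log_moment_bound_abel k j z l0 b q q' 0 hi rho d1); try lra.
    - intros t Ht. apply (md_cont _ _ _ _ H); [lra|]. apply (Rbar_le_lt t hi); [lra|exact Hhia].
    - unfold d1. lra.
    - intros s Hs. apply Htail; [lra|]. apply (Rbar_le_lt s q'); [lra|exact Hqa']. }
  intros q q' j Hq Hqa Hq' Hqa'. destruct (Rle_dec q q') as [Hqq|Hqq]; [now apply Hle|].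
  rewrite (log_moment_swap k j z q' q).
  - rewrite Cmod_opp. apply Hle; try assumption. lra.
  - apply (Ccont_on_data a d k c); try assumption; lra. }
intros [p q] [p' q'] [Hp [Hq Hqa]] [Hp' [Hq' Hqa']] j. simpl in Hp, Hq, Hqa, Hp', Hq', Hqa'.
assert (Hpa : Rbar_lt p a) by (apply (Rbar_le_lt p b); [lra|exact Hba]).
assert (Hpa' : Rbar_lt p' a) by (apply (Rbar_le_lt p' b); [lra|exact Hba]).
assert (E : trunc_coef k c N z j (p, q) - trunc_coef k c N z j (p', q')
  = (log_moment k j z p p' - log_moment (taylor c N) j z p p') + log_moment k j z q' q).
{ unfold trunc_coef. simpl fst. simpl snd.
  rewrite <- (log_moment_chasles k j z p p' q), <- (log_moment_chasles k j z p' q' q),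
          <- (log_moment_chasles (taylor c N) j z p p' 1).
  - ring.
  - apply Ccont_on_taylor; lra.
  - apply Ccont_on_taylor; lra.
  - apply (Ccont_on_data a d k c); try assumption; lra.
  - apply (Ccont_on_data a d k c); try assumption; lra.
  - apply (Ccont_on_data a d k c); try assumption; lra.
  - apply (Ccont_on_data a d k c); try assumption; lra. }
rewrite E.
assert (Hrj : (0 <= rho ^ j)%R) by (apply pow_le; lra).
eapply Rle_trans; [apply Rmult_le_compat_r; [exact Hrj|apply Cmod_triangle]|].
rewrite Rmult_plus_distr_r.
pose proof (Hzero p p' j Hp Hp'). pose proof (Hfar q' q j Hq' Hqa' Hq Hqa). lra.
Qed.

(** The Mellin integral with its first [N] polar parts [c_j / (j + 1 - z)] removed. *)
Definition regularized (a : Rbar) (k : R -> C) (c : nat -> C) (N : nat) (z : C) : C :=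
  lim (T := C_CompleteNormedModule) (filtermap (trunc k c N z) (ends a)).

Lemma lim_tends {T : Type} (F : (T -> Prop) -> Prop) (u : T -> C) (l : C) :
  ProperFilter F -> tends F u l ->
  lim (T := C_CompleteNormedModule) (filtermap u F) = l.
Proof.
intros HF Hl. symmetry.
assert (HPF : ProperFilter (filtermap u F)) by (apply filtermap_proper_filter, HF).
apply (tends_unique F u); [exact HF|exact Hl|].
intros P [e He]. unfold filtermap at 1.
assert (Hc : cauchy (T := C_CompleteNormedModule) (filtermap u F)).
{ intros e2. exists l. apply (Hl (ball l e2)). apply locally_ball. }
exact (filter_imp _ _ He (complete_cauchy (T := C_CompleteNormedModule) _ HPF Hc e)).
Qed.

Lemma regularized_expansion (a d : Rbar) (k : R -> C) (c : nat -> C) (N : nat) (z : C) :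
  mellin_data a d k c -> Rbar_lt d (Re z) -> (Re z < INR N + 1)%R ->
  exists v r, expansion (regularized a k c N) z v r /\
    (forall j, tends (ends a) (trunc_coef k c N z j) (v j)) /\
    tends (ends a) (trunc k c N z) (regularized a k c N z).
Proof.
intros H Hdz HzN. pose proof (md_pos _ _ _ _ H) as Ha. pose proof (ends_proper a Ha) as HF.
destruct (trunc_coef_cauchy a d k c N z H Hdz HzN) as [rho [Hrho HC]].
destruct (weighted_complete (ends a) (trunc_coef k c N z) rho HF Hrho HC) as [v Hv].
assert (Hexp : forall w, ends a (fun x => Csum (fun j => trunc_coef k c N z j x * w ^ j) (trunc k c N (z + w) x))).
{ intros w. destruct (Rbar_between 0 a Ha) as [b0 [Hb0 Hb0a]].
  assert (Hb : (0 < Rmin b0 1)%R) by (apply Rmin_pos; lra).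
  pose proof (Rmin_l b0 1). pose proof (Rmin_r b0 1).
  assert (Hba : Rbar_lt (Rmin b0 1) a) by (apply (Rbar_le_lt _ b0); [lra|exact Hb0a]).
  apply (ends_spec a (Rmin b0 1) _ Hb Hba). exists (Rmin b0 1), (Rmin b0 1).
  repeat split; try lra; [exact Hba|]. intros p q Hp Hq Hqa.
  apply (trunc_expansion a d); try assumption; lra. }
(* the truncated expansions converge at w = rho, which bounds their coefficients *)
assert (HM : exists M, forall j, (Cmod (v j) * rho ^ j <= M)%R).
{ destruct (filter_ex _ (filter_and _ _ (Hv 1%R Rlt_0_1) (Hexp (RtoC rho)))) as [x [H1 H2]].
  destruct (Csum_terms_bounded _ _ H2) as [M HM]. exists (M + 1)%R. intros j.
  specialize (H1 j). specialize (HM j). rewrite Cmod_mult, Cmod_pow, Cmod_R, Rabs_pos_eq in HM by lra.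
  assert (Hrj : (0 <= rho ^ j)%R) by (apply pow_le; lra).
  pose proof (Cmod_triangle (trunc_coef k c N z j x) (- (trunc_coef k c N z j x - v j))) as Ht.
  rewrite Cmod_opp in Ht.
  replace (trunc_coef k c N z j x + - (trunc_coef k c N z j x - v j)) with (v j) in Ht by ring.
  apply Rmult_le_compat_r with (r := (rho ^ j)%R) in Ht; [|exact Hrj]. lra. }
destruct HM as [M HM].
assert (Hsum : forall w, (Cmod w < rho)%R ->
   Csum (fun j => v j * w ^ j) (regularized a k c N (z + w)) /\
   tends (ends a) (trunc k c N (z + w)) (regularized a k c N (z + w))).
{ intros w Hw.
  destruct (weighted_power_series (ends a) _ v rho M (trunc k c N (z + w)) w _ Hrho Hw Hv HM (Hexp w))
    as [S [HS1 HS2]].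
  unfold regularized. rewrite (lim_tends _ _ S HF HS2). split; assumption. }
exists v, (rho / 2)%R. split; [|split].
- apply (expansion_of_bound _ _ _ M rho); [lra|exact HM|]. intros w Hw. apply Hsum. lra.
- intros j. apply (weighted_tends (ends a) _ v rho j _ Hrho Hv).
- destruct (Hsum 0) as [_ Ht]; [rewrite Cmod_0; exact Hrho|].
  replace (z + 0) with z in Ht by ring. exact Ht.
Qed.

Lemma mellin_int_monomial (x : C) (N : nat) (z : C) (p : R) :
  (0 < p <= 1)%R -> RtoC (INR N + 1) <> z ->
  mellin_int (fun t => x * RtoC t ^ N) z p 1
    = x / (RtoC (INR N + 1) - z) * (1 - real_Cpow p (RtoC (INR N + 1) - z)).
Proof.
intros Hp Hz. set (s := RtoC (INR N + 1) - z).
assert (Hs : s <> 0) by (now apply Cminus_eq_contra).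
apply is_Cint_unique.
replace (x / s * (1 - real_Cpow p s)) with (x / s * real_Cpow 1 s - x / s * real_Cpow p s)
  by (rewrite real_Cpow_1; ring).
assert (Hd : forall t, (0 < t)%R ->
  x * RtoC t ^ N * real_Cpow t (- z) = 0 * real_Cpow t s + x / s * (s * RtoC (/ t) * real_Cpow t s)).
{ intros t Ht. unfold s. rewrite RtoC_plus.
  replace (RtoC (INR N) + RtoC 1 - z) with (RtoC (INR N + 1) + - z) by (rewrite RtoC_plus; ring).
  rewrite real_Cpow_plus.
  assert (E : real_Cpow t (RtoC (INR N + 1)) = RtoC t ^ N * RtoC t).
  { unfold real_Cpow, Cexp. rewrite re_scal_l, im_scal_l, re_RtoC, im_RtoC, Rmult_0_r, cos_0, sin_0.
    rewrite Rmult_plus_distr_r, exp_plus, Rmult_1_l, exp_ln, <- pow_exp_ln by exact Ht.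
    rewrite <- RtoC_pow, <- RtoC_mult. unfold RtoC. f_equal; ring. }
  rewrite E, RtoC_inv by lra.
  replace (RtoC (INR N + 1) + - z) with s by (unfold s; ring).
  field. split; [intros E2; apply RtoC_inj in E2; lra|exact Hs]. }
apply (is_Cint_ext (fun t => 0 * real_Cpow t s + x / s * (s * RtoC (/ t) * real_Cpow t s))).
{ rewrite Rmin_left, Rmax_right by lra. intros t Ht. symmetry. apply Hd. lra. }
apply (is_Cint_derive (fun t => x / s * real_Cpow t s)); rewrite Rmin_left, Rmax_right by lra; intros t Ht.
- apply (Cderiv_mult (fun _ => x / s)).
  + apply (is_derive_const (V := C_R_NormedModule)).
  + apply Cderiv_real_Cpow. lra.
- assert (Ht0 : (0 < t)%R) by lra.
  apply Ccont_plus; apply Ccont_mult; try apply Ccont_const; try (now apply Ccont_real_Cpow).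
  apply Ccont_mult; [|now apply Ccont_real_Cpow].
  apply Ccont_mult; [apply Ccont_const|]. apply Ccont_RtoC.
  apply (ex_derive_continuous (V := R_NormedModule)). auto_derive. lra.
Qed.

(** The two truncations differ by the integral of [c_N t^(N - z)] over [(p, 1)], which tends to
    [c_N / (N + 1 - z)]. *)
Lemma regularized_step (a d : Rbar) (k : R -> C) (c : nat -> C) (N : nat) (z : C) :
  mellin_data a d k c -> Rbar_lt d (Re z) -> (Re z < INR N + 1)%R ->
  regularized a k c N z = regularized a k c (S N) z + c N / (RtoC (INR N + 1) - z).
Proof.
intros H Hdz HzN. pose proof (md_pos _ _ _ _ H) as Ha. pose proof (ends_proper a Ha) as HF.
destruct (regularized_expansion a d k c N z H Hdz HzN) as [_ [_ [_ [_ H1]]]].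
destruct (regularized_expansion a d k c (S N) z H Hdz) as [_ [_ [_ [_ H2]]]].
{ rewrite S_INR. lra. }
set (s := RtoC (INR N + 1) - z).
assert (Hsre : Re s = (INR N + 1 - Re z)%R).
{ unfold s. change (Re (RtoC (INR N + 1) - z)) with (INR N + 1 + - Re z)%R. ring. }
assert (Hs : s <> 0).
{ intros E. rewrite E in Hsre. simpl in Hsre. lra. }
assert (H3 : tends (ends a) (fun x => c N / s * (1 - real_Cpow (fst x) s)) (c N / s)).
{ apply tends_Cmod; [apply HF|]. intros e He.
  destruct (exp_ln_small (Re s) (e / (Cmod (c N / s) + 1))) as [p0 [Hp0 Hsm]].
  - rewrite Hsre. lra.
  - apply Rdiv_lt_0_compat; [exact He|]. pose proof (Cmod_ge_0 (c N / s)). lra.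
  - destruct (Rbar_between 0 a Ha) as [b0 [Hb0 Hb0a]].
    apply (ends_spec a b0 _ Hb0 Hb0a). exists (Rmin b0 p0), b0.
    split; [split; [apply Rmin_pos; lra|apply Rmin_l]|].
    split; [lra|]. split; [exact Hb0a|]. intros p q Hp _ _. simpl fst.
    replace (c N / s * (1 - real_Cpow p s) - c N / s) with (- (c N / s * real_Cpow p s)) by ring.
    rewrite Cmod_opp, Cmod_mult, Cmod_real_Cpow.
    pose proof (Rmin_r b0 p0). specialize (Hsm p ltac:(lra)).
    pose proof (Cmod_ge_0 (c N / s)) as Hc. pose proof (exp_pos (Re s * ln p)).
    apply Rmult_lt_compat_r with (r := (Cmod (c N / s) + 1)%R) in Hsm; [|lra].
    replace (e / (Cmod (c N / s) + 1) * (Cmod (c N / s) + 1))%R with e in Hsm by (field; lra).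
    nra. }
pose proof (tends_plus _ _ _ _ _ _ H2 H3) as H4.
apply (tends_unique (ends a) (trunc k c N z)); [exact HF|exact H1|].
revert H4. apply tends_ext; [apply HF|].
destruct (Rbar_between 0 a Ha) as [b0 [Hb0 Hb0a]].
assert (Hb : (0 < Rmin b0 1)%R) by (apply Rmin_pos; lra).
pose proof (Rmin_l b0 1) as Hr1. pose proof (Rmin_r b0 1) as Hr2.
assert (Hba : Rbar_lt (Rmin b0 1) a) by (apply (Rbar_le_lt _ b0); [lra|exact Hb0a]).
apply (ends_spec a (Rmin b0 1) _ Hb Hba). exists (Rmin b0 1), (Rmin b0 1).
repeat split; try lra; [exact Hba|]. intros p q Hp Hq Hqa.
unfold trunc. simpl fst. simpl snd.
assert (Hon : Ccont_on (fun t => c N * RtoC t ^ N) p 1).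
{ intros t Ht. split; [rewrite Rmin_left in Ht by lra; lra|].
  generalize (Ccont_minus _ _ t (Ccont_taylor c (S N) t) (Ccont_taylor c N t)).
  apply continuous_ext. intros u. unfold taylor. simpl. ring. }
assert (E : mellin_int (taylor c (S N)) z p 1 = mellin_int (taylor c N) z p 1 + mellin_int (fun t => c N * RtoC t ^ N) z p 1).
{ apply is_Cint_unique.
  apply (is_Cint_ext (fun t => taylor c N t * real_Cpow t (- z) + c N * RtoC t ^ N * real_Cpow t (- z))).
  - intros t _. unfold taylor. simpl. ring.
  - apply is_Cint_plus; apply is_Cint_mellin_int; [apply Ccont_on_taylor; lra|exact Hon]. }
rewrite E, (mellin_int_monomial (c N) N z p).
- fold s. ring.
- lra.
- intros E2. apply Hs. unfold s. rewrite E2. ring.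
Qed.

Lemma Rbar_lt_locally (d : Rbar) (z : C) :
  Rbar_lt d (Re z) -> locally (T := C_UniformSpace) z (fun w => Rbar_lt d (Re w)).
Proof.
intros H. destruct (Rbar_below d (Re z) H) as [y [Hy Hyz]].
apply locally_Cmod. exists (Re z - y)%R. split; [lra|]. intros w Hw.
apply (Rbar_lt_trans d y); [exact Hy|]. simpl.
pose proof (re_le_Cmod (w - z)) as H1. change (Re (w - z)) with (Re w + - Re z)%R in H1.
apply Rabs_le_between in H1. lra.
Qed.

Lemma Re_lt_locally (x : R) (z : C) :
  (Re z < x)%R -> locally (T := C_UniformSpace) z (fun w => (Re w < x)%R).
Proof.
intros H. apply locally_Cmod. exists (x - Re z)%R. split; [lra|]. intros w Hw.
pose proof (re_le_Cmod (w - z)) as H1. change (Re (w - z)) with (Re w + - Re z)%R in H1.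
apply Rabs_le_between in H1. lra.
Qed.

Lemma locally'_neq (q z : C) : locally' (T := C_UniformSpace) z (fun w => w <> q).
Proof.
apply locally'_Cmod. destruct (classic (q = z)) as [->|Hqz].
- exists 1%R. split; [lra|]. auto.
- assert (H := proj1 (Cmod_gt_0 _) (Cminus_eq_contra _ _ Hqz)).
  exists (Cmod (q - z)). split; [exact H|]. intros w _ Hw E. rewrite E in Hw. lra.
Qed.

(** * The analytic continuation *)

Definition simple_fractions (c : nat -> C) (N : nat) (z : C) : C :=
  psum (fun j => c j * / (RtoC (INR j + 1) - z)) N.

(** Any [N > Re z - 1] gives the same value; this definition takes one of them. *)
Definition continuation (a : Rbar) (k : R -> C) (c : nat -> C) (z : C) : C :=
  let N := Z.to_nat (up (Re z)) in regularized a k c N z + simple_fractions c N z.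

Lemma continuation_eq (a d : Rbar) (k : R -> C) (c : nat -> C) (N : nat) (z : C) :
  mellin_data a d k c -> Rbar_lt d (Re z) -> (Re z < INR N + 1)%R ->
  continuation a k c z = regularized a k c N z + simple_fractions c N z.
Proof.
intros H Hdz HN.
assert (Hadd : forall N m, (Re z < INR N + 1)%R ->
  regularized a k c N z + simple_fractions c N z
  = regularized a k c (N + m) z + simple_fractions c (N + m) z).
{ intros N' m HN'. induction m as [|m IH]; [now rewrite Nat.add_0_r|].
  rewrite IH, Nat.add_succ_r, (regularized_step a d k c (N' + m) z H Hdz).
  - unfold simple_fractions. simpl. unfold Cdiv. ring.
  - rewrite plus_INR. pose proof (pos_INR m). lra. }
unfold continuation. set (N0 := Z.to_nat (up (Re z))).
assert (HN0 : (Re z < INR N0 + 1)%R).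
{ destruct (archimed (Re z)) as [H1 _]. unfold N0.
  destruct (Z.le_gt_cases 0 (up (Re z))) as [H0|H0].
  - rewrite INR_IZR_INZ, Z2Nat.id by exact H0. lra.
  - pose proof (pos_INR (Z.to_nat (up (Re z)))). apply IZR_lt in H0. lra. }
destruct (Nat.le_ge_cases N0 N) as [Hle|Hle].
- rewrite (Hadd N0 (N - N0)%nat HN0). now replace (N0 + (N - N0))%nat with N by lia.
- rewrite (Hadd N (N0 - N)%nat HN). now replace (N + (N0 - N))%nat with N0 by lia.
Qed.

Lemma continuation_locally (a d : Rbar) (k : R -> C) (c : nat -> C) (N : nat) (z : C) :
  mellin_data a d k c -> Rbar_lt d (Re z) -> (Re z < INR N + 1)%R ->
  locally (T := C_UniformSpace) z
    (fun w => continuation a k c w = regularized a k c N w + simple_fractions c N w).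
Proof.
intros H Hdz HN. generalize (filter_and _ _ (Rbar_lt_locally d z Hdz) (Re_lt_locally _ z HN)).
apply filter_imp. intros w [H1 H2]. now apply (continuation_eq a d).
Qed.

Lemma analytic_at_regularized (a d : Rbar) (k : R -> C) (c : nat -> C) (N : nat) (z : C) :
  mellin_data a d k c -> Rbar_lt d (Re z) -> (Re z < INR N + 1)%R ->
  analytic_at (regularized a k c N) z.
Proof.
intros H Hdz HN. destruct (regularized_expansion a d k c N z H Hdz HN) as [v [r [He _]]].
apply analytic_at_expansion. eauto.
Qed.

Lemma analytic_at_simple_fractions (c : nat -> C) (N : nat) (z : C) :
  (forall j, (j < N)%nat -> z <> RtoC (INR j + 1)) -> analytic_at (simple_fractions c N) z.
Proof.
unfold simple_fractions. induction N as [|N IH]; intros H; [exact (analytic_at_const 0 z)|].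
apply analytic_at_plus; [apply IH; intros; apply H; lia|].
apply analytic_at_scal, analytic_at_inv_sub, H. lia.
Qed.

Lemma locally'_not_pole (N : nat) (z : C) :
  locally' (T := C_UniformSpace) z (fun w => forall j, (j < N)%nat -> w <> RtoC (INR j + 1)).
Proof.
induction N as [|N IH].
- apply (locally_punctured z). apply filter_forall. intros w j Hj. lia.
- assert (HF : Filter (locally' (T := C_UniformSpace) z)) by apply within_filter, locally_filter.
  generalize (filter_and _ _ IH (locally'_neq (RtoC (INR N + 1)) z)). apply filter_imp.
  intros w [H1 H2] j Hj. destruct (Nat.eq_dec j N) as [->|Hne]; [exact H2|]. apply H1. lia.
Qed.

Lemma exists_INR_gt (x : R) : exists N, (x < INR N + 1)%R.
Proof.
destruct (INR_unbounded x) as [N HN]. exists N. lra.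
Qed.

Lemma continuation_isolated (a d : Rbar) (k : R -> C) (c : nat -> C) (z : C) :
  mellin_data a d k c -> Rbar_lt d (Re z) ->
  locally' (T := C_UniformSpace) z (analytic_at (continuation a k c)).
Proof.
intros H Hdz. destruct (exists_INR_gt (Re z)) as [N HN].
assert (HF : Filter (locally' (T := C_UniformSpace) z)) by apply within_filter, locally_filter.
generalize (filter_and _ _ (locally'_not_pole N z) (filter_and _ _
   (locally_punctured _ _ (Rbar_lt_locally d z Hdz)) (locally_punctured _ _ (Re_lt_locally _ z HN)))).
apply filter_imp. intros w [H1 [H2 H3]].
apply (analytic_at_ext_loc (fun w => regularized a k c N w + simple_fractions c N w)).
- generalize (continuation_locally a d k c N w H H2 H3). apply filter_imp. auto.
- apply analytic_at_plus; [now apply (analytic_at_regularized a d)|now apply analytic_at_simple_fractions].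
Qed.

Lemma log_moment_zero (j : nat) (z : C) (p q : R) (g : R -> C) :
  (0 < p)%R -> (0 < q)%R -> (forall t, g t = 0) -> log_moment g j z p q = 0.
Proof.
intros Hp Hq Hg. unfold log_moment.
assert (H : is_Cint (fun t => g t * logpow j z t) p q (RtoC 0)).
{ assert (Hon : Ccont_on (fun _ => 1) p q).
  { intros t Ht. split; [|apply Ccont_const]. assert (0 < Rmin p q)%R by (now apply Rmin_pos). lra. }
  assert (E := is_Cint_mult 0 _ _ _ _ (is_Cint_logpow _ j z p q Hon)).
  rewrite Cmult_0_l in E. revert E. apply is_Cint_ext. intros t _. rewrite Hg. ring. }
rewrite (is_Cint_unique _ _ _ _ H). ring.
Qed.

Lemma log_moment_0 (g : R -> C) (z : C) (p q : R) : Ccont_on g p q -> log_moment g 0 z p q = mellin_int g z p q.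
Proof.
intros Hg. unfold log_moment. simpl fact. simpl INR. rewrite Rinv_1, Cmult_1_l.
symmetry. apply is_Cint_unique. generalize (is_Cint_logpow g 0 z p q Hg). apply is_Cint_ext.
intros t _. unfold logpow. simpl. ring.
Qed.

Lemma strip_expansion (a d : Rbar) (k : R -> C) (c : nat -> C) (z : C) :
  mellin_data a d k c -> Rbar_lt d (Re z) -> (Re z < 1)%R ->
  exists v r, expansion (continuation a k c) z v r /\
    forall j, tends (ends a) (fun x => log_moment k j z (fst x) (snd x)) (v j).
Proof.
intros H Hdz Hz1. pose proof (md_pos _ _ _ _ H) as Ha. pose proof (ends_proper a Ha) as HF.
assert (Hz : (Re z < INR 0 + 1)%R) by (simpl; lra).
destruct (regularized_expansion a d k c 0 z H Hdz Hz) as [v [r [He [Hv _]]]].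
pose proof (continuation_locally a d k c 0 z H Hdz Hz) as Hloc.
apply (proj1 (locally_Cmod z _)) in Hloc. destruct Hloc as [s [Hs Hloc]].
assert (Hm : (0 < Rmin s r)%R) by (apply Rmin_pos; [exact Hs|apply He]).
exists v, (Rmin s r). split.
- apply (expansion_ext (regularized a k c 0)).
  + intros w Hw. pose proof (Rmin_l s r). rewrite Hloc.
    * unfold simple_fractions. simpl. ring.
    * replace (z + w - z) with w by ring. lra.
  + apply (expansion_shrink _ _ _ r); [split; [exact Hm|apply Rmin_r]|exact He].
- intros j. generalize (Hv j). apply tends_ext; [apply HF|].
  destruct (Rbar_between 0 a Ha) as [b [Hb Hba]].
  apply (ends_spec a b _ Hb Hba). exists b, b. repeat split; try lra; [exact Hba|].
  intros p q Hp Hq Hqa. unfold trunc_coef. simpl fst. simpl snd.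
  rewrite (log_moment_zero j z p 1 (taylor c 0)); [ring|lra|lra|reflexivity].
Qed.

(** In the strip this is the case [N = 0] of the regularization, where nothing is
    subtracted. *)
Lemma continuation_mellin (a d : Rbar) (k : R -> C) (c : nat -> C) :
  mellin_data a d k c -> mellin_continuation a d k (continuation a k c).
Proof.
intros H. pose proof (md_pos _ _ _ _ H) as Ha. pose proof (ends_proper a Ha) as HF. split.
- intros z Hdz Hz1. destruct (strip_expansion a d k c z H Hdz Hz1) as [v [r [He Hv]]]. split.
  + apply (is_mellin_tends a k z _ (fun p q Hp Hq => Ccont_on_data a d k c p q H Hp Hq) Ha).
    rewrite (expansion_center _ _ _ _ He). generalize (Hv 0%nat). apply tends_ext; [apply HF|].
    destruct (Rbar_between 0 a Ha) as [b [Hb Hba]].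
    apply (ends_spec a b _ Hb Hba). exists b, b. repeat split; try lra; [exact Hba|].
    intros p q Hp Hq Hqa. simpl fst. simpl snd. apply log_moment_0, (Ccont_on_data a d k c); try assumption; try lra.
    apply (Rbar_le_lt p q); [lra|exact Hqa].
  + apply analytic_at_expansion. eauto.
- intros z Hdz. now apply (continuation_isolated a d).
Qed.

Lemma Ccont_on_kln (k : R -> C) (n : nat) (p q : R) :
  Ccont_on k p q -> Ccont_on (fun t => k t * RtoC (ln t ^ n)) p q.
Proof.
intros H t Ht. destruct (H t Ht) as [H1 H2]. split; [exact H1|].
apply Ccont_mult; [exact H2|]. apply Ccont_RtoC.
apply (ex_derive_continuous (V := R_NormedModule)). auto_derive. exact H1.
Qed.

Lemma mellin_int_kln (k : R -> C) (n : nat) (z : C) (p q : R) :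
  Ccont_on k p q ->
  mellin_int (fun t => k t * RtoC (ln t ^ n)) z p q = (- 1) ^ n * (RtoC (INR (fact n)) * log_moment k n z p q).
Proof.
intros H.
assert (E : RtoC (INR (fact n)) * log_moment k n z p q = Cint (fun t => k t * logpow n z t) p q).
{ unfold log_moment. rewrite Cmult_assoc, <- RtoC_mult, Rinv_r, Cmult_1_l; [reflexivity|apply INR_fact_neq_0]. }
rewrite E. apply is_Cint_unique.
generalize (is_Cint_mult ((- 1) ^ n) _ _ _ _ (is_Cint_logpow k n z p q H)). apply is_Cint_ext.
intros t _. unfold logpow.
replace (RtoC ((- ln t) ^ n)) with ((- 1) ^ n * RtoC (ln t ^ n)).
- assert (E2 : (- 1) ^ n * (- 1) ^ n = 1).
  { rewrite <- Cpow_mult_l. replace (- 1 * - 1) with (RtoC 1) by ring. apply Cpow_1_l. }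
  transitivity ((- 1) ^ n * (- 1) ^ n * (k t * RtoC (ln t ^ n) * real_Cpow t (- z))); [ring|].
  rewrite E2. ring.
- rewrite !RtoC_pow, <- Cpow_mult_l. f_equal. rewrite RtoC_opp. ring.
Qed.

(** The [n]-th Taylor coefficient of the continuation at a point of the strip is the limit of
    the moments of order [n], which are the truncated transforms of [k ln^n] up to the factor
    [(-1)^n n!]. *)
Lemma continuation_kln (a d : Rbar) (k : R -> C) (c : nat -> C) (n : nat) :
  mellin_data a d k c ->
  mellin_continuation a d (fun t => k t * RtoC (ln t ^ n))
    (fun z => (- 1) ^ n * C_derive_n (continuation a k c) n z).
Proof.
intros H. pose proof (md_pos _ _ _ _ H) as Ha. pose proof (ends_proper a Ha) as HF.
assert (Han : forall z, analytic_at (continuation a k c) z ->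
   analytic_at (fun z => (- 1) ^ n * C_derive_n (continuation a k c) n z) z).
{ intros z Hz. now apply analytic_at_scal, analytic_at_C_derive_n. }
split.
- intros z Hdz Hz1. destruct (strip_expansion a d k c z H Hdz Hz1) as [v [r [He Hv]]]. split.
  + apply (is_mellin_tends a _ z _ (fun p q Hp Hq Hpa Hqa =>
       Ccont_on_kln k n p q (Ccont_on_data a d k c p q H Hp Hq Hpa Hqa)) Ha).
    rewrite (C_derive_n_center _ _ _ n _ He).
    generalize (tends_scal _ ((- 1) ^ n) _ _ _ (tends_scal _ (RtoC (INR (fact n))) _ _ _ (Hv n))).
    apply tends_ext; [apply HF|].
    destruct (Rbar_between 0 a Ha) as [b [Hb Hba]].
    apply (ends_spec a b _ Hb Hba). exists b, b. repeat split; try lra; [exact Hba|].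
    intros p q Hp Hq Hqa. simpl fst. simpl snd. symmetry.
    apply mellin_int_kln, (Ccont_on_data a d k c); try assumption; try lra.
    apply (Rbar_le_lt p q); [lra|exact Hqa].
  + apply Han, analytic_at_expansion. eauto.
- intros z Hdz. generalize (continuation_isolated a d k c z H Hdz). apply filter_imp. exact Han.
Qed.

(** * Uniqueness and the singularities *)

(** Both continuations are given by the Mellin integral in the strip, and a segment leads from
    the strip to any point of the half-plane. *)
Lemma mellin_continuation_unique (a d : Rbar) (f : R -> C) (F G : C -> C) (z : C) :
  (forall p q : R, (0 < p)%R -> (0 < q)%R -> Rbar_lt p a -> Rbar_lt q a -> Ccont_on f p q) ->
  Rbar_lt 0%R a -> Rbar_lt d 1%R ->
  mellin_continuation a d f F -> mellin_continuation a d f G -> Rbar_lt d (Re z) ->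
  locally' (T := C_UniformSpace) z (fun w => F w = G w).
Proof.
intros Hf Ha Hd [F1 F2] [G1 G2] Hdz. pose proof (ends_proper a Ha) as HFe.
destruct (Rbar_below d 1 Hd) as [x [Hdx Hx1]].
assert (HF : forall v, Filter (locally' (T := C_UniformSpace) v)) by (intros; apply within_filter, locally_filter).
assert (HZ : locally' (T := C_UniformSpace) z (fun w => F w - G w = 0)).
{ apply (identity_isolated (fun w => F w - G w) (RtoC x) z).
  - intros t Ht.
    assert (Hdt : Rbar_lt d (Re (seg (RtoC x) z t))).
    { unfold seg. change (Re (RtoC x + RtoC t * (z - RtoC x)))
        with (x + (t * (Re z + - x) - 0 * (Im z + - 0)))%R.
      destruct (Rle_dec x (Re z)) as [Hxz|Hxz].
      - apply (Rbar_lt_le_trans d x); [exact Hdx|]. simpl. nra.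
      - apply (Rbar_lt_le_trans d (Re z)); [exact Hdz|]. simpl. nra. }
    generalize (filter_and _ _ (F2 _ Hdt) (G2 _ Hdt)). apply filter_imp.
    intros w [H1 H2]. now apply analytic_at_minus.
  - generalize (filter_and _ _ (Rbar_lt_locally d (RtoC x) Hdx) (Re_lt_locally 1 (RtoC x) Hx1)).
    apply filter_imp. intros w [H1 H2].
    destruct (F1 w H1 H2) as [M1 _]. destruct (G1 w H1 H2) as [M2 _].
    apply (is_mellin_tends a f w _ Hf Ha) in M1. apply (is_mellin_tends a f w _ Hf Ha) in M2.
    rewrite (tends_unique _ _ _ _ HFe M1 M2). ring. }
revert HZ. apply filter_imp. intros w E. now apply Ceq_minus.
Qed.

Lemma analytic_at_eq_center (f g : C -> C) (z : C) :
  analytic_at f z -> analytic_at g z -> locally' (T := C_UniformSpace) z (fun w => f w = g w) ->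
  f z = g z.
Proof.
intros Hf Hg H. apply Ceq_minus, Cmod_eq_0.
apply Rle_antisym; [|apply Cmod_ge_0]. apply Rnot_lt_le. intros He.
set (e := Cmod (f z - g z)) in *.
pose proof (analytic_at_continuous f z (e / 2) Hf ltac:(lra)) as H1.
pose proof (analytic_at_continuous g z (e / 2) Hg ltac:(lra)) as H2.
assert (HF : Filter (locally' (T := C_UniformSpace) z)) by apply within_filter, locally_filter.
pose proof (filter_and _ _ H (filter_and _ _ (locally_punctured _ _ H1) (locally_punctured _ _ H2))) as H3.
apply (proj1 (locally'_Cmod z _)) in H3. destruct H3 as [r [Hr H3]].
assert (Hne : z + RtoC (r / 2) <> z).
{ intros E. assert (E2 : RtoC (r / 2) = 0).
  { replace (RtoC (r / 2)) with (z + RtoC (r / 2) - z) by ring. rewrite E. ring. }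
  apply RtoC_inj in E2. lra. }
destruct (H3 _ Hne) as [E [B1 B2]].
{ replace (z + RtoC (r / 2) - z) with (RtoC (r / 2)) by ring. rewrite Cmod_R, Rabs_pos_eq; lra. }
rewrite E in B1.
pose proof (Cmod_triangle (- (g (z + RtoC (r / 2)) - f z)) (g (z + RtoC (r / 2)) - g z)) as Ht.
rewrite Cmod_opp in Ht.
replace (- (g (z + RtoC (r / 2)) - f z) + (g (z + RtoC (r / 2)) - g z)) with (f z - g z) in Ht by ring.
fold e in Ht. lra.
Qed.

(** Near [m + 1] a single simple fraction is singular, and its [n]-th derivative is
    explicit. *)
Lemma continuation_near_integer (a d : Rbar) (k : R -> C) (c : nat -> C) (m n : nat) :
  mellin_data a d k c ->
  exists h : C -> C, analytic_at h (RtoC (INR m + 1)) /\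
    locally' (T := C_UniformSpace) (RtoC (INR m + 1)) (fun z =>
      C_derive_n (continuation a k c) n z
      = c m * (RtoC (INR (fact n)) / (RtoC (INR m + 1) - z) ^ S n) + h z).
Proof.
intros H. set (z0 := RtoC (INR m + 1)).
pose (h0 := fun z => regularized a k c (S m) z + simple_fractions c m z).
assert (Hdz : Rbar_lt d (Re z0)).
{ apply (Rbar_lt_le_trans d 1%R); [exact (md_d _ _ _ _ H)|]. simpl. pose proof (pos_INR m). lra. }
assert (Hz : (Re z0 < INR (S m) + 1)%R) by (rewrite S_INR; simpl; lra).
assert (Hh0 : forall w, Rbar_lt d (Re w) -> (Re w < INR (S m) + 1)%R ->
   (forall j, (j < m)%nat -> w <> RtoC (INR j + 1)) -> analytic_at h0 w).
{ intros w H1 H2 H3. apply analytic_at_plus; [now apply (analytic_at_regularized a d)|].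
  now apply analytic_at_simple_fractions. }
exists (C_derive_n h0 n). split.
- apply analytic_at_C_derive_n, Hh0; [exact Hdz|exact Hz|].
  intros j Hj E. unfold z0 in E. apply RtoC_inj in E. apply lt_INR in Hj. lra.
- assert (HF : Filter (locally' (T := C_UniformSpace) z0)) by apply within_filter, locally_filter.
  generalize (filter_and _ _ (locally'_not_pole (S m) z0) (filter_and _ _
   (locally_punctured _ _ (Rbar_lt_locally d z0 Hdz)) (locally_punctured _ _ (Re_lt_locally _ z0 Hz)))).
  apply filter_imp. intros w [H1 [H2 H3]].
  assert (Hne : w <> z0) by (apply H1; lia).
  assert (Hw : analytic_at h0 w) by (apply Hh0; [exact H2|exact H3|]; intros j Hj; apply H1; lia).
  rewrite (C_derive_n_ext_loc _ (fun z => c m * / (z0 - z) + h0 z) w n).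
  + rewrite C_derive_n_plus; [|now apply analytic_at_scal, analytic_at_inv_sub|exact Hw].
    rewrite C_derive_n_scal by (now apply analytic_at_inv_sub).
    now rewrite C_derive_n_inv_sub by exact Hne.
  + generalize (continuation_locally a d k c (S m) w H H2 H3). apply filter_imp.
    intros v ->. unfold h0, simple_fractions, z0. simpl psum. ring.
Qed.

(** Multiplying by [(z - (m + 1))^(n + 1)] leaves the value [- c_m n!] at the pole. *)
Lemma continuation_pole (a d : Rbar) (k : R -> C) (c : nat -> C) (m n : nat) (G : C -> C) :
  mellin_data a d k c ->
  locally' (T := C_UniformSpace) (RtoC (INR m + 1))
    (fun z => G z = (- 1) ^ n * C_derive_n (continuation a k c) n z) ->
  (c m <> 0 -> pole_of_order G (RtoC (INR m + 1)) (S n)) /\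
  (c m = 0 -> removable_singularity G (RtoC (INR m + 1))).
Proof.
intros H HG. set (z0 := RtoC (INR m + 1)) in *.
destruct (continuation_near_integer a d k c m n H) as [h [Hh HC]]. fold z0 in Hh, HC.
assert (HF : Filter (locally' (T := C_UniformSpace) z0)) by apply within_filter, locally_filter.
assert (Hneq := locally'_neq z0 z0).
split.
- intros Hc. split; [lia|].
  exists (fun z => - (c m * RtoC (INR (fact n))) + (- 1) ^ n * (h z * (z - z0) ^ S n)).
  split; [|split].
  + apply analytic_at_plus; [apply analytic_at_const|].
    now apply analytic_at_scal, analytic_at_mul_sub_pow.
  + replace (z0 - z0) with (RtoC 0) by ring.
    replace (- (c m * RtoC (INR (fact n))) + (- 1) ^ n * (h z0 * 0 ^ S n))
      with (- (c m * RtoC (INR (fact n)))) by (simpl; ring).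
    intros E. apply (Cmult_neq_0 (c m) (RtoC (INR (fact n))) Hc).
    * intros E2. apply RtoC_inj in E2. now apply (INR_fact_neq_0 n).
    * replace (c m * RtoC (INR (fact n))) with (- - (c m * RtoC (INR (fact n)))) by ring.
      rewrite E. ring.
  + generalize (filter_and _ _ Hneq (filter_and _ _ HG HC)). apply filter_imp.
    intros z [Hz [-> ->]].
    assert (Hp : (z - z0) ^ S n <> 0) by (apply Cpow_nz, Cminus_eq_contra; exact Hz).
    replace (z0 - z) with (- 1 * (z - z0)) by ring. rewrite Cpow_mult_l.
    assert (Hs : (- 1) ^ S n = - (- 1) ^ n) by (simpl; ring).
    assert (Hs2 : (- 1) ^ n <> 0).
    { apply Cpow_nz. intros E. apply RtoC_inj in E. lra. }
    rewrite Hs. field. repeat split; try assumption.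
- intros Hc. exists (fun z => (- 1) ^ n * h z). split; [now apply analytic_at_scal|].
  generalize (filter_and _ _ HG HC). apply filter_imp. intros z [-> ->]. rewrite Hc. ring.
Qed.

Lemma class_mellin_data (a d : Rbar) (k : R -> C) (K : C -> C) :
  Rbar_lt 0%R a -> complex_extension a k K -> mellin_strip a d k ->
  exists c r, expansion K 0 c r /\ mellin_data a d k c.
Proof.
intros Ha HK [Hd [_ Hstrip]].
destruct (HK 0%R (Rle_refl 0) Ha) as [_ HK0].
destruct (proj1 (analytic_at_expansion _ _) HK0) as [c [r Hc]].
exists c, r. split; [exact Hc|]. constructor; [exact Ha| | |exact Hd|exact Hstrip].
- intros t Ht Hta. intros P HP. apply (proj1 (locally_Cmod _ P)) in HP.
  destruct HP as [e [He HP]].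
  destruct (HK t ltac:(lra) Hta) as [Ekt Hat].
  pose proof (analytic_at_continuous K (RtoC t) e Hat He) as HC.
  apply (proj1 (locally_Cmod _ _)) in HC. destruct HC as [s [Hs HC]].
  destruct (Rbar_between t a Hta) as [b [Hb Hba]].
  assert (Hm : (0 < Rmin s (Rmin t (b - t)))%R) by (repeat apply Rmin_pos; lra).
  unfold filtermap. exists (mkposreal _ Hm). intros u Hu.
  change (Rabs (u - t) < Rmin s (Rmin t (b - t)))%R in Hu.
  pose proof (Rmin_l s (Rmin t (b - t))). pose proof (Rmin_r s (Rmin t (b - t))).
  pose proof (Rmin_l t (b - t)). pose proof (Rmin_r t (b - t)).
  assert (Hu2 : (Rabs (u - t) < Rmin t (b - t))%R) by lra.
  apply Rabs_lt_between' in Hu2.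
  destruct (HK u) as [Eku _]; [lra|apply (Rbar_le_lt u b); [lra|exact Hba]|].
  apply HP. rewrite <- Eku, <- Ekt. apply HC.
  rewrite <- RtoC_minus, Cmod_R. lra.
- intros N. destruct (expansion_tail K 0 c r N Hc) as [M [HM HT]].
  destruct (Rbar_between 0 a Ha) as [b0 [Hb0 Hb0a]].
  assert (Hr : (0 < r)%R) by apply Hc.
  exists (Rmin b0 (Rmin 1 (r / 2))), M.
  pose proof (Rmin_l b0 (Rmin 1 (r / 2))). pose proof (Rmin_r b0 (Rmin 1 (r / 2))).
  pose proof (Rmin_l 1 (r / 2)). pose proof (Rmin_r 1 (r / 2)).
  split; [split; [repeat apply Rmin_pos; lra|lra]|].
  split; [apply (Rbar_le_lt _ b0); [lra|exact Hb0a]|].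
  intros t Ht. destruct (HK t) as [Ekt _]; [lra|apply (Rbar_le_lt t b0); [lra|exact Hb0a]|].
  pose proof (HT (RtoC t)) as HTt. rewrite Cplus_0_l, Cmod_R, Rabs_pos_eq, Ekt in HTt by lra.
  apply HTt. lra.
Qed.

Theorem theorem5p2 :
  forall (a : Rbar) (k : R -> C), Rbar_lt 0%R a -> class_K a k ->
  forall (K : C -> C) (d : Rbar), complex_extension a k K -> mellin_strip a d k ->
  forall n : nat, (0 < n)%nat ->
  let kln : R -> C := fun t => k t * RtoC (ln t ^ n) in
  (exists F : C -> C, mellin_continuation a d k F) /\
  (exists G : C -> C, mellin_continuation a d kln G) /\
  (forall F G : C -> C,
     mellin_continuation a d k F -> mellin_continuation a d kln G ->
     (forall lambda : C, Rbar_lt d (Re lambda) ->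
        analytic_at F lambda -> analytic_at G lambda ->
        G lambda = (- 1) ^ n * C_derive_n F n lambda) /\
     (forall m : nat, (0 < m)%nat ->
        (C_derive_n K (m - 1) 0 <> 0 ->
           pole_of_order G (RtoC (INR m)) (n + 1)) /\
        (C_derive_n K (m - 1) 0 = 0 ->
           removable_singularity G (RtoC (INR m))))).
Proof.
intros a k Ha _ K d HK Hstrip n _ kln.
destruct (class_mellin_data a d k K Ha HK Hstrip) as [c [r [Hc H]]].
split; [exists (continuation a k c); now apply continuation_mellin|].
split; [eexists; apply (continuation_kln a d k c n H)|].
intros F G HF HG.
assert (Hk : forall p q : R, (0 < p)%R -> (0 < q)%R -> Rbar_lt p a -> Rbar_lt q a -> Ccont_on k p q).
{ intros p q. now apply (Ccont_on_data a d k c). }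
assert (HFu : forall z, Rbar_lt d (Re z) ->
   locally' (T := C_UniformSpace) z (fun w => F w = continuation a k c w)).
{ intros z. apply (mellin_continuation_unique a d k F _ z Hk Ha (md_d _ _ _ _ H) HF).
  now apply continuation_mellin. }
assert (HGu : forall z, Rbar_lt d (Re z) ->
   locally' (T := C_UniformSpace) z (fun w => G w = (- 1) ^ n * C_derive_n (continuation a k c) n w)).
{ intros z. apply (mellin_continuation_unique a d kln G _ z (fun p q Hp Hq Hpa Hqa =>
     Ccont_on_kln k n p q (Hk p q Hp Hq Hpa Hqa)) Ha (md_d _ _ _ _ H) HG).
  now apply continuation_kln. }
split.
- intros z Hdz HFz HGz.
  apply (analytic_at_eq_center G (fun w => (- 1) ^ n * C_derive_n F n w) z HGz).
  + now apply analytic_at_scal, analytic_at_C_derive_n.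
  + assert (HFil : Filter (locally' (T := C_UniformSpace) z)) by apply within_filter, locally_filter.
    generalize (filter_and _ _ (HGu z Hdz) (locally'_open _ _ (HFu z Hdz))). apply filter_imp.
    intros w [-> H2]. f_equal. symmetry. now apply C_derive_n_ext_loc.
- intros m Hm. destruct m as [|m]; [lia|].
  replace (S m - 1)%nat with m by lia. rewrite S_INR, Nat.add_1_r.
  rewrite (C_derive_n_center K 0 c m r Hc).
  destruct (continuation_pole a d k c m n G H) as [P1 P2].
  { apply HGu. apply (Rbar_lt_le_trans d 1%R); [exact (md_d _ _ _ _ H)|].
    simpl. pose proof (pos_INR m). lra. }
  assert (Hfm : RtoC (INR (fact m)) <> 0).
  { intros E. apply RtoC_inj in E. now apply (INR_fact_neq_0 m). }
  split.
  + intros Hne. apply P1. intros E. apply Hne. rewrite E. ring.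
  + intros E. apply P2. apply NNPP. intros Hne. now apply (Cmult_neq_0 _ _ Hfm Hne).
Qed.
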